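(* Let $\alpha\in(0,1]$, $n\in\mathbb{N}$, $\rho_0\in\mathbb{R}$, $y_0\in\mathbb{C}^n$, and let $f:\mathbb{R}_{>0}\times\mathbb{C}^n\to\mathbb{C}^n$ be continuous with $|f(t,y_1)-f(t,y_2)|\leq c|y_1-y_2|$ for some $c\geq0$ and all $y_1,y_2\in\mathbb{C}^n$, $t>0$, and $(t\mapsto f(t,0))\in L^2_{\rho_0}(\mathbb{R}_{>0};\mathbb{C}^n)$. Let $\tilde f(t,y):=\chi_{\mathbb{R}_{>0}}(t)f(t,y)$ for $t\in\mathbb{R}$, $y\in\mathbb{C}^n$ (with $\tilde f(t,y)=0$ for $t\leq0$). Let $\rho>\max\{0,\rho_0\}$ and $y\in L^2_\rho(\mathbb{R};\mathbb{C}^n)$. Then the following are equivalent: (i) $y(t)=y_0\chi_{\mathbb{R}_{>0}}(t)+\frac{1}{\Gamma(\alpha)}\int_{-\infty}^t(t-s)^{\alpha-1}\tilde f(s,y(s))\,ds$ for almost every $t\in\mathbb{R}$; (ii) $y=\partial^{-\alpha}_{0,\rho}\tilde f(\cdot,y(\cdot))+y_0\chi_{\mathbb{R}_{>0}}$; (iii) $\partial^\alpha_{0,\rho}(y-y_0\chi_{\mathbb{R}_{>0}})=\tilde f(\cdot,y(\cdot))$.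
   Context: $\chi_{\mathbb{R}_{>0}}$ is the indicator of $(0,\infty)$. $L^2_\rho(\mathbb{R};\mathbb{C}^n)$ is the space of measurable $g$ with $\int|g(t)|^2e^{-2\rho t}dt<\infty$. $\mathcal{L}_\rho:L^2_\rho(\mathbb{R};\mathbb{C}^n)\to L^2(\mathbb{R};\mathbb{C}^n)$ is the unitary Fourier–Laplace transform, $(\mathcal{L}_\rho g)(\xi)=(2\pi)^{-1/2}\int e^{-(i\xi+\rho)t}g(t)dt$ for suitable $g$ (extended by continuity). For $\gamma\in\mathbb{R}$, $\partial^\gamma_{0,\rho}:=\mathcal{L}_\rho^*(im+\rho)^\gamma\mathcal{L}_\rho$ with maximal domain, where $((im+\rho)^\gamma h)(\xi)=(i\xi+\rho)^\gamma h(\xi)$ (principal branch), defined for those $h\in L^2$ for which the result lies in $L^2$. For these $\rho$, $y\mapsto\tilde f(\cdot,y(\cdot))$ maps $L^2_\rho(\mathbb{R};\mathbb{C}^n)$ into itself. *)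

(* Defs.v *)
From HB Require Import structures.
From mathcomp Require Import all_boot all_order all_algebra.
From mathcomp Require Import all_classical all_reals all_analysis.
From mathcomp Require Import complex.
Set Implicit Arguments.
Unset Strict Implicit.
Unset Printing Implicit Defensive.
Import Order.TTheory GRing.Theory Num.Theory.
Import numFieldNormedType.Exports.
Local Open Scope classical_set_scope.
Local Open Scope ring_scope.
Local Open Scope complex_scope.

Section Defs.
Variable R : realType.
Local Notation C := R[i].
Local Notation mu := (@lebesgue_measure R).

Definition vsub (n : nat) (u v : 'I_n -> C) : 'I_n -> C := fun i => u i - v i.
Definition vnorm2 (n : nat) (v : 'I_n -> C) : R :=
  (\sum_(i < n) (complex.Re (v i) ^+ 2 + complex.Im (v i) ^+ 2))%R.
Definition vnorm (n : nat) (v : 'I_n -> C) : R := Num.sqrt (vnorm2 v).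

Definition vmeas (n : nat) (D : set R) (g : R -> 'I_n -> C) : Prop :=
  forall i, measurable_fun D (fun t => complex.Re (g t i)) /\
            measurable_fun D (fun t => complex.Im (g t i)).

Definition L2w (n : nat) (D : set R) (rho : R) (g : R -> 'I_n -> C) : Prop :=
  vmeas D g /\
  (\int[mu]_(t in D) ((vnorm2 (g t) * expR (- (2 * rho * t)))%:E) < +oo)%E.

Definition chi (t : R) : R := if (0 < t)%R then 1%R else 0%R.
Definition chiv (n : nat) (y0 : 'I_n -> C) (t : R) : 'I_n -> C :=
  fun i => (chi t)%:C * y0 i.

Definition ftilde (n : nat) (f : R -> ('I_n -> C) -> ('I_n -> C))
  (t : R) (y : 'I_n -> C) : 'I_n -> C :=
  if (0 < t)%R then f t y else (fun _ => 0).

Definition cint (D : set R) (h : R -> C) : C :=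
  Complex (Rintegral mu D (fun x => complex.Re (h x))) (Rintegral mu D (fun x => complex.Im (h x))).

Definition cintegrable (D : set R) (h : R -> C) : Prop :=
  mu.-integrable D (fun x => (complex.Re (h x))%:E) /\
  mu.-integrable D (fun x => (complex.Im (h x))%:E).

Definition cexp (z : C) : C :=
  Complex (expR (complex.Re z) * cos (complex.Im z))%R (expR (complex.Re z) * sin (complex.Im z))%R.

(* principal argument in (-pi, pi] *)
Definition carg (z : C) : R :=
  if (0 < complex.Re z)%R then atan (complex.Im z / complex.Re z)
  else if (complex.Re z < 0)%R then
    (if (0 <= complex.Im z)%R then atan (complex.Im z / complex.Re z) + pi else atan (complex.Im z / complex.Re z) - pi)%R
  else if (0 < complex.Im z)%R then (pi / 2)%R
  else if (complex.Im z < 0)%R then (- (pi / 2))%R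
  else 0%R.

Definition cabs (z : C) : R := Num.sqrt (complex.Re z ^+ 2 + complex.Im z ^+ 2)%R.

Definition cpow (z : C) (gamma : R) : C :=
  if z == 0 then 0
  else (cabs z `^ gamma)%:C * cexp (Complex 0 (gamma * carg z)%R).

Definition Gamma (a : R) : R :=
  Rintegral mu `]0%R, +oo[ (fun t => (t `^ (a - 1)) * expR (- t))%R.

Definition c_sqrt2pi_inv : C := ((Num.sqrt (2 * pi))^-1)%:C.

Definition FLtrunc (n : nat) (rho : R) (g : R -> 'I_n -> C) (N : R) (xi : R)
  : 'I_n -> C :=
  fun i => c_sqrt2pi_inv *
    cint `[(- N)%R, N] (fun t => cexp (- (Complex rho xi * t%:C)) * g t i).

(* FL rho g h : h = L_rho g, i.e. g in L^2_rho, h in L^2 and h is the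
   L^2-limit of the truncated transforms (the extension by continuity) *)
Definition FL (n : nat) (rho : R) (g : R -> 'I_n -> C) (h : R -> 'I_n -> C)
  : Prop :=
  L2w setT rho g /\ L2w setT 0 h /\
  ((fun N : nat => (\int[mu]_xi ((vnorm2 (vsub (h xi) (FLtrunc rho g N%:R xi)))%:E))%E)
     @ \oo --> 0%E).

Definition FLadjtrunc (n : nat) (rho : R) (k : R -> 'I_n -> C) (N : R) (t : R)
  : 'I_n -> C :=
  fun i => c_sqrt2pi_inv *
    cint `[(- N)%R, N] (fun xi => cexp (Complex rho xi * t%:C) * k xi i).

Definition FLadj (n : nat) (rho : R) (k : R -> 'I_n -> C) (v : R -> 'I_n -> C)
  : Prop :=
  L2w setT 0 k /\ L2w setT rho v /\
  ((fun N : nat => (\int[mu]_t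
      ((vnorm2 (vsub (v t) (FLadjtrunc rho k N%:R t)) * expR (- (2 * rho * t)))%:E))%E)
     @ \oo --> 0%E).

(* fracD rho gamma u v : u is in the (maximal) domain of
   d^gamma_{0,rho} = L_rho^* (im + rho)^gamma L_rho  and  d^gamma_{0,rho} u = v *)
Definition fracD (n : nat) (rho gamma : R) (u v : R -> 'I_n -> C) : Prop :=
  exists h : R -> 'I_n -> C,
    FL rho u h /\
    L2w setT 0 (fun xi i => cpow (Complex rho xi) gamma * h xi i) /\
    FLadj rho (fun xi i => cpow (Complex rho xi) gamma * h xi i) v.

Definition cont_pos (n : nat) (f : R -> ('I_n -> C) -> ('I_n -> C)) : Prop :=
  forall t y, (0 < t)%R -> forall e : R, (0 < e)%R -> exists2 d : R, (0 < d)%R &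
    forall s z, (0 < s)%R -> (`|s - t| < d)%R -> (vnorm (vsub z y) < d)%R ->
      (vnorm (vsub (f s z) (f t y)) < e)%R.

End Defs.

(* Main.v *)
Require Import Defs.
From HB Require Import structures.
From mathcomp Require Import all_boot all_order all_algebra.
From mathcomp Require Import all_classical all_reals all_analysis.
From mathcomp Require Import measurable_realfun complex ring lra.
Set Implicit Arguments.
Unset Strict Implicit.
Unset Printing Implicit Defensive.
Import Order.TTheory GRing.Theory Num.Theory.
Import numFieldNormedType.Exports.
Local Open Scope classical_set_scope.
Local Open Scope ring_scope.

(* Conditions (ii) and (iii) both say that y - y0 chi equals the operator with
   symbol (i xi + rho)^-alpha applied to F = f~(.,y(.)), so two facts suffice.
   First, L_rho is unitary with inverse FLadj, which makes (ii) and (iii)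
   equivalent since (i xi + rho)^alpha (i xi + rho)^-alpha = 1.  Second, on
   L^2_rho that operator is the convolution with
   s^(alpha-1) / Gamma(alpha) on (0, oo), which is (i).

   Splitting into even and odd parts reduces the Fourier transform of complex
   functions to the real Hartley transform, with kernel cos + sin, which is its
   own inverse.  Regularizing the square of a transform by e^(-e|x|) produces the
   Poisson kernel, whence a Bessel inequality, and equality for indicators of
   intervals; completeness of L^2 and pairing with those indicators then give
   existence and inversion.  The symbol is identified by the differential
   equation satisfied in xi by the Laplace transform of s^(alpha-1), and
   multiplication by it becomes a convolution by Fubini on truncated integrals,
   passing to the limit with Young's inequality. *)

(** * Square-integrable functions *)

Section SquareIntegrable.
Context {R : realType}.
Local Notation mu := (@lebesgue_measure R).
Implicit Types (u v w : R -> R).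

(** Multiplying by e^(-rho t) turns L^2_rho into L^2, L_rho into the ordinary Fourier transform, and
    s^(alpha-1) into s^(alpha-1) e^(-rho s), which is integrable on (0, oo) because alpha > 0 and
    rho > 0. Young's inequality needs this integrability, and it also makes the integral in (i)
    converge at almost every t. The transform is only an L^2-limit of integrals over [-N, N], so it
    has no value at a given point. Each identity is therefore either exact for every N or obtained
    by pairing with a test function. Indicators of intervals are the test functions because their
    Poisson means are explicit differences of arctangents; Lebesgue differentiation shows that they
    separate L^2. Functions are not identified when they agree almost everywhere, so changes of
    representative are explicit steps. A separate matter is that f~(.,y(.)) lies in L^2_rho. Its
    measurability comes from the continuity of f on (0, oo) x C^n through countably many rational
    boxes, and its size from the Lipschitz bound. *)

Definition L1 u : Prop := mu.-integrable setT (EFin \o u).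
Definition nsq u : \bar R := (\int[mu]_x ((u x) ^+ 2)%:E)%E.
Definition L2 u : Prop := measurable_fun setT u /\ (nsq u < +oo)%E.
Definition cvg2 (u_ : nat -> R -> R) u : Prop :=
  (fun n => nsq (u_ n \- u)) @ \oo --> 0%E.

Lemma aeS (P Q : R -> Prop) : (forall x, P x -> Q x) ->
  {ae mu, forall x, P x} -> {ae mu, forall x, Q x}.
Proof. by have F := ae_filter_ringOfSetsType mu; exact: filterS. Qed.

Lemma aeI (P Q : R -> Prop) : {ae mu, forall x, P x} ->
  {ae mu, forall x, Q x} -> {ae mu, forall x, P x /\ Q x}.
Proof. by have F := ae_filter_ringOfSetsType mu; exact: filterS2. Qed.

Lemma L1_meas u : L1 u -> measurable_fun setT u.
Proof. by move=> /integrableP[/measurable_EFinP]. Qed.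

Lemma nsq_ge0 u : (0 <= nsq u)%E.
Proof. by apply: integral_ge0 => x _; rewrite lee_fin sqr_ge0. Qed.

Lemma le_L1 u v : measurable_fun setT u -> (forall x, `|u x| <= v x) ->
  L1 v -> L1 u.
Proof.
move=> mu_ uv; apply: le_integrable => //; first exact/measurable_EFinP.
by move=> x _ /=; rewrite lee_fin (le_trans (uv x))// ler_norm.
Qed.

Lemma L1D u v : L1 u -> L1 v -> L1 (u \+ v).
Proof. by move=> Iu Iv; apply: eq_integrable (integrableD _ Iu Iv). Qed.

Lemma L1B u v : L1 u -> L1 v -> L1 (u \- v).
Proof. by move=> Iu Iv; apply: eq_integrable (integrableB _ Iu Iv). Qed.

Lemma L1Z k u : L1 u -> L1 (fun x => k * u x).
Proof. by move=> Iu; apply: eq_integrable (integrableZl _ k Iu). Qed.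

Lemma L1_norm u : L1 u -> L1 (fun x => `|u x|).
Proof. by move=> Iu; apply: eq_integrable (integrable_abse Iu). Qed.

Lemma L1Mb (k : R -> R) M u : measurable_fun setT k -> (forall x, `|k x| <= M) -> L1 u ->
  L1 (fun x => k x * u x).
Proof.
move=> mk kM Iu; have := L1Z M (L1_norm Iu); apply: le_L1.
  by apply: measurable_funM => //; exact: L1_meas.
by move=> x; rewrite normrM ler_wpM2r.
Qed.

Lemma measurable_sqr u : measurable_fun setT u ->
  measurable_fun setT (fun x => (u x ^+ 2)%:E : \bar R).
Proof. by move=> mu_; apply/measurable_EFinP/measurable_funX. Qed.

Lemma L2_sqr u : L2 u -> L1 (fun x => u x ^+ 2).
Proof.
move=> [mu_ fu]; apply/integrableP; split; first exact: measurable_sqr.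
move: fu; apply: le_lt_trans; rewrite /nsq le_eqVlt; apply/orP; left.
apply/eqP; apply: eq_integral => x _ /=; by rewrite ger0_norm ?sqr_ge0.
Qed.

Lemma nsqE u : L2 u -> nsq u = (\int[mu]_x (u x ^+ 2))%:E.
Proof.
move=> /L2_sqr Iu; rewrite /nsq /Rintegral fineK//.
exact: (integrable_fin_num _ Iu).
Qed.

Lemma nsqZ k u : measurable_fun setT u ->
  nsq (fun x => k * u x) = ((k ^+ 2)%:E * nsq u)%E.
Proof.
move=> mu_; rewrite /nsq -ge0_integralZl//; last 3 first.
- exact: measurable_sqr.
- by move=> x _; rewrite lee_fin sqr_ge0.
- by rewrite lee_fin sqr_ge0.
by apply: eq_integral => x _; rewrite -EFinM exprMn.
Qed.

Lemma nsqN u : nsq (\- u) = nsq u.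
Proof. by apply: eq_integral => x _; rewrite sqrrN. Qed.

Lemma nsqBC u v : nsq (u \- v) = nsq (v \- u).
Proof. by apply: eq_integral => x _ /=; rewrite -sqrrN opprB. Qed.

Lemma le_nsq u v : measurable_fun setT u -> measurable_fun setT v ->
  (forall x, `|u x| <= `|v x|) -> (nsq u <= nsq v)%E.
Proof.
move=> mu_ mv uv; apply: ge0_le_integral => //.
- by move=> x _; rewrite lee_fin sqr_ge0.
- exact: measurable_sqr.
- exact: measurable_sqr.
by move=> x _; rewrite lee_fin -(real_normK (num_real (u x)))
  -(real_normK (num_real (v x))) lerXn2r ?nnegrE.
Qed.

(** From (a + b)^2 <= 2 a^2 + 2 b^2. Squared norms with this factor 2 replace Minkowski's
    inequality, and the factor is harmless in limits. *)
Lemma nsqD u v : measurable_fun setT u -> measurable_fun setT v ->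
  (nsq (u \+ v)%R <= 2%:E * nsq u + 2%:E * nsq v)%E.
Proof.
move=> mu_ mv; rewrite /nsq -!ge0_integralZl//; try exact: measurable_sqr;
  try by move=> x _; rewrite lee_fin sqr_ge0.
rewrite -ge0_integralD//; try by move=> x _; rewrite mule_ge0// lee_fin sqr_ge0.
- apply: ge0_le_integral => //.
  + by move=> x _; rewrite lee_fin sqr_ge0.
  + by apply: measurable_sqr; exact: measurable_funD.
  + apply: emeasurable_funD; under eq_fun do rewrite -EFinM;
    by apply/measurable_EFinP/measurable_funM => //; exact: measurable_funX.
  move=> x _; rewrite -!EFinM -EFinD lee_fin/=.
  by have := sqr_ge0 (u x - v x); nra.
- by under eq_fun do rewrite -EFinM;
    apply/measurable_EFinP/measurable_funM => //; exact: measurable_funX.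
- by under eq_fun do rewrite -EFinM;
    apply/measurable_EFinP/measurable_funM => //; exact: measurable_funX.
Qed.

Lemma nsqB3 u v w : measurable_fun setT u -> measurable_fun setT v ->
  measurable_fun setT w ->
  (nsq (u \- w)%R <= 2%:E * nsq (u \- v)%R + 2%:E * nsq (v \- w)%R)%E.
Proof.
move=> mu_ mv mw.
have -> : u \- w = (u \- v) \+ (v \- w).
  by apply/funext => x /=; rewrite addrA subrK.
by apply: nsqD; exact: measurable_funB.
Qed.

Lemma L2Mb (k : R -> R) M u : measurable_fun setT k -> (forall x, `|k x| <= M) -> L2 u ->
  L2 (fun x => k x * u x).
Proof.
move=> mk kM [mu_ fu]; split; first exact: measurable_funM.
apply: (@le_lt_trans _ _ (nsq (fun x => M * u x))).
  apply: le_nsq; [exact: measurable_funM|exact: measurable_funM|].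
  move=> x; rewrite !normrM ler_wpM2r// (le_trans (kM x))// ler_norm//.
by rewrite nsqZ// lte_mul_pinfty// lee_fin sqr_ge0.
Qed.

Lemma L2Z k u : L2 u -> L2 (fun x => k * u x).
Proof. by apply: (@L2Mb (fun=> k) `|k|). Qed.

Lemma L2D u v : L2 u -> L2 v -> L2 (u \+ v).
Proof.
move=> [mu_ fu] [mv fv]; split; first exact: measurable_funD.
by rewrite (le_lt_trans (nsqD mu_ mv))// lte_add_pinfty// lte_mul_pinfty.
Qed.

Lemma L2N u : L2 u -> L2 (fun x => - u x).
Proof.
by move=> [mu_ fu]; split; [exact: measurableT_comp|rewrite -/(\- u) nsqN].
Qed.

Lemma L2B u v : L2 u -> L2 v -> L2 (u \- v).
Proof. by move=> Lu Lv; apply: L2D => //; exact: L2N. Qed.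

Lemma L2M u v : L2 u -> L2 v -> L1 (fun x => u x * v x).
Proof.
move=> Lu Lv; have := L1D (L2_sqr Lu) (L2_sqr Lv).
apply: le_L1; first by apply: measurable_funM; [case: Lu|case: Lv].
move=> x /=; rewrite normrM -(real_normK (num_real (u x)))
  -(real_normK (num_real (v x))).
by have := sqr_ge0 (`|u x| - `|v x|); have := normr_ge0 (u x);
  have := normr_ge0 (v x); nra.
Qed.

Lemma nsq0_ae u : measurable_fun setT u -> nsq u = 0%E ->
  {ae mu, forall x, u x = 0}.
Proof.
move=> mu_; rewrite /nsq => u0.
have : ae_eq mu setT (fun x => (u x ^+ 2)%:E) (cst 0%E).
  apply/ae_eq_integral_abs => //; first exact: measurable_sqr.
  rewrite -[RHS]u0; apply: eq_integral => x _ /=.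
  by rewrite ger0_norm ?sqr_ge0.
apply: aeS => x /(_ I) [] /eqP; by rewrite sqrf_eq0 => /eqP.
Qed.

Lemma eq_nsq_ae u v : measurable_fun setT u -> measurable_fun setT v ->
  {ae mu, forall x, u x = v x} -> nsq u = nsq v.
Proof.
move=> mu_ mv uv; apply: ge0_ae_eq_integral => //.
- exact: measurable_sqr.
- exact: measurable_sqr.
- by move=> x _; rewrite lee_fin sqr_ge0.
- by move=> x _; rewrite lee_fin sqr_ge0.
by apply: aeS uv => x -> _.
Qed.

Lemma cvg2_squeeze (u_ : nat -> R -> R) u (b : nat -> \bar R) :
  (forall n, (nsq (u_ n \- u)%R <= b n)%E) -> b @ \oo --> 0%E -> cvg2 u_ u.
Proof.
move=> ub b0; apply: (squeeze_cvge _ (cvg_cst 0%E) b0).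
by apply: nearW => n; rewrite nsq_ge0 ub.
Qed.

Lemma cvg2D (u_ : nat -> R -> R) u (v_ : nat -> R -> R) v : (forall n, measurable_fun setT (u_ n)) ->
  (forall n, measurable_fun setT (v_ n)) -> measurable_fun setT u ->
  measurable_fun setT v -> cvg2 u_ u -> cvg2 v_ v ->
  cvg2 (fun n => u_ n \+ v_ n) (u \+ v).
Proof.
move=> mu_ mv_ mmu mv cu cv.
apply: (@cvg2_squeeze _ _
  (fun n => 2%:E * nsq (u_ n \- u)%R + 2%:E * nsq (v_ n \- v)%R)%E).
  move=> n; have -> : (u_ n \+ v_ n) \- (u \+ v) = (u_ n \- u) \+ (v_ n \- v).
    by apply/funext => x /=; ring.
  by apply: nsqD; exact: measurable_funB.
rewrite -(adde0 0%E) -{1}(mule0 2%:E) -{2}(mule0 2%:E).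
by apply: cvgeD => //; apply: cvgeZl.
Qed.

Lemma cvg2Z k (u_ : nat -> R -> R) u : (forall n, measurable_fun setT (u_ n)) ->
  measurable_fun setT u -> cvg2 u_ u ->
  cvg2 (fun n x => k * u_ n x) (fun x => k * u x).
Proof.
move=> mu_ mmu cu.
apply: (@cvg2_squeeze _ _ (fun n => (k ^+ 2)%:E * nsq (u_ n \- u)%R)%E).
  move=> n; rewrite -nsqZ; last exact: measurable_funB.
  apply: le_nsq => //; first by apply: measurable_funB; exact: measurable_funM.
    by apply: measurable_funM => //; exact: measurable_funB.
  by move=> x /=; rewrite mulrBr.
by rewrite -(mule0 (k ^+ 2)%:E); apply: cvgeZl.
Qed.

Lemma cvg2_unique (u_ : nat -> R -> R) u v : (forall n, measurable_fun setT (u_ n)) ->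
  measurable_fun setT u -> measurable_fun setT v -> cvg2 u_ u -> cvg2 u_ v ->
  {ae mu, forall x, u x = v x}.
Proof.
move=> mu_ mmu mv cu cv.
suff : nsq (u \- v) = 0%E.
  move=> /nsq0_ae; move/(_ (measurable_funB mmu mv)); apply: aeS => x /=.
  by move/eqP; rewrite subr_eq0 => /eqP.
apply/eqP; rewrite eq_le nsq_ge0 andbT.
have : (fun n => 2%:E * nsq (u_ n \- u)%R + 2%:E * nsq (u_ n \- v)%R)%E
    @ \oo --> 0%E.
  rewrite -(adde0 0%E) -{1}(mule0 2%:E) -{2}(mule0 2%:E).
  by apply: cvgeD => //; apply: cvgeZl.
move=> c0; have -> : 0%E = limn (fun n => 2%:E * nsq (u_ n \- u)%R
    + 2%:E * nsq (u_ n \- v)%R)%E by apply/esym/cvg_lim.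
apply: lime_ge; first by apply/cvg_ex; exists 0%E.
by apply: nearW => n; rewrite (nsqBC (u_ n) u); exact: nsqB3.
Qed.

(* [2 |u v| <= l u^2 + v^2 / l] *)
Lemma pairing_le u v (l : R) : 0 < l -> L2 u -> L2 v ->
  (`|\int[mu]_x (u x * v x)|%:E <= l%:E * nsq u + (l^-1)%:E * nsq v)%E.
Proof.
move=> l0 Lu Lv; have Iuv := L2M Lu Lv.
have I2 : L1 (fun x => l * u x ^+ 2 + l^-1 * v x ^+ 2).
  by apply: L1D; apply: L1Z; exact: L2_sqr.
rewrite (nsqE Lu) (nsqE Lv) -!EFinM -EFinD lee_fin.
rewrite -!RintegralZl//; try exact: L2_sqr.
rewrite -RintegralD//; try by apply: L1Z; exact: L2_sqr.
apply: (le_trans (le_normr_Rintegral _ Iuv)) => //.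
apply: le_Rintegral => //; first exact: L1_norm.
move=> x _; rewrite normrM -(real_normK (num_real (u x)))
  -(real_normK (num_real (v x))).
set a := `|u x|; set b := `|v x|.
have a0 : 0 <= a by exact: normr_ge0.
have b0 : 0 <= b by exact: normr_ge0.
have li : 0 < l^-1 by rewrite invr_gt0.
have := sqr_ge0 (l * a - b) => /(mulr_ge0 (ltW li)).
have -> : l^-1 * (l * a - b) ^+ 2 = l * a ^+ 2 - 2 * (a * b) + l^-1 * b ^+ 2.
  by field; rewrite gt_eqF.
by have := mulr_ge0 a0 b0; lra.
Qed.

Lemma cvg2_pairing (u_ : nat -> R -> R) u v : (forall n, L2 (u_ n)) -> L2 u -> L2 v ->
  cvg2 u_ u ->
  (fun n => \int[mu]_x (u_ n x * v x)) @ \oo --> \int[mu]_x (u x * v x).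
Proof.
move=> Lu_ Lu Lv cu; apply/cvgrPdist_le => e e0.
set V := \int[mu]_x (v x ^+ 2).
have V0 : 0 <= V by apply: Rintegral_ge0 => x _; exact: sqr_ge0.
(* This [l] makes V / l at most e / 2, and [nsq (u_ n \- u)] is then required to be below e / (2 l).
   The 1 keeps [l] positive when V = 0. *)
pose l := (2 * (V + 1)) / e.
have l0 : 0 < l by rewrite divr_gt0// mulr_gt0//; lra.
have d0 : 0 < e / 2 / l by rewrite divr_gt0// divr_gt0.
move/fine_cvgP : cu => [_ /cvgrPdist_lt /(_ _ d0)]; apply: filterS => n /=.
rewrite sub0r normrN.
have Ld := L2B (Lu_ n) Lu.
have -> : \int[mu]_x (u x * v x) - \int[mu]_x (u_ n x * v x) =
    - \int[mu]_x ((u_ n \- u) x * v x).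
  rewrite -opprB -RintegralB//; try exact: L2M.
  by congr (- _); apply: eq_Rintegral => x _ /=; rewrite mulrBl.
rewrite normrN -lee_fin => h.
apply: (le_trans (pairing_le l0 Ld Lv)).
move: h; rewrite (nsqE Ld) (nsqE Lv) /= -/V -!EFinM -EFinD lee_fin.
move=> /(le_lt_trans (ler_norm _)); rewrite ltr_pdivlMr// => h.
have : l^-1 * V <= e / 2.
  rewrite /l invf_div mulrAC ler_pdivrMr ?mulr_gt0//; last lra.
  nra.
nra.
Qed.

End SquareIntegrable.

(** * Completeness of L^2 *)

Section Completeness.
Context {R : realType}.
Local Notation mu := (@lebesgue_measure R).

Lemma ae_lty (f : R -> \bar R) : measurable_fun setT f ->
  (forall x, 0 <= f x)%E -> (\int[mu]_x f x < +oo)%E ->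
  {ae mu, forall x, f x < +oo}%E.
Proof.
move=> mf f0 fy.
have If : mu.-integrable setT f.
  apply/integrableP; split => //; move: fy; apply: le_lt_trans.
  rewrite le_eqVlt; apply/orP; left; apply/eqP; apply: eq_integral => x _.
  by rewrite gee0_abs.
have := integrable_ae measurableT If.
by apply: aeS => x /(_ I); rewrite ge0_fin_numE.
Qed.

Lemma sum_geo_half n : \sum_(0 <= k < n) (2^-1 : R) ^+ k <= 2.
Proof.
have -> : \sum_(0 <= k < n) (2^-1 : R) ^+ k = 2 - 2 * 2^-1 ^+ n.
  elim: n => [|n IH]; first by rewrite big_geq// expr0; ring.
  by rewrite big_nat_recr//= IH exprS; field.
by rewrite gerBl mulr_ge0// exprn_ge0.
Qed.

(** Since 2 |d k| <= 2^k (d k)^2 + 2^-k, the weighted bound makes the series absolutely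
    convergent. *)
Lemma cvg_of_weighted_sqr (d : nat -> R) (B : R) :
  (forall n, \sum_(0 <= k < n) 2 ^+ k * d k ^+ 2 <= B) ->
  cvgn (series d).
Proof.
move=> dB; apply: (@normed_cvg R R^o); apply: nondecreasing_is_cvgn.
  by apply: (@nondecreasing_series _ _ xpredT 0%N) => n _ _; exact: normr_ge0.
exists ((B + 2) / 2) => _ [n _ <-].
have h k : `|d k| <= 2^-1 * (2 ^+ k * d k ^+ 2) + 2^-1 * 2^-1 ^+ k.
  have t0 : 0 < (2:R) ^+ k by rewrite exprn_gt0.
  rewrite exprVn -(real_normK (num_real (d k))).
  set a := `|d k|; set t := 2 ^+ k in t0 *.
  have ti : 0 < t^-1 by rewrite invr_gt0.
  have := mulr_ge0 (ltW ti) (sqr_ge0 (t * a - 1)).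
  have -> : t^-1 * (t * a - 1) ^+ 2 = t * a ^+ 2 - 2 * a + t^-1.
    by field; rewrite gt_eqF.
  lra.
apply: (@le_trans _ _ (\sum_(0 <= k < n)
    (2^-1 * (2 ^+ k * d k ^+ 2) + 2^-1 * 2^-1 ^+ k))).
  by rewrite /series/=; apply: ler_sum => k _; exact: h.
rewrite big_split/= -!mulr_sumr.
by have := dB n; have := sum_geo_half n; lra.
Qed.

(* Along a subsequence with [nsq (u_(k+1) - u_k) <= 4^-k], the function
   [\sum_k 2^k (u_(k+1) - u_k)^2] is integrable, hence finite a.e. *)
Lemma L2_complete (u_ : nat -> R -> R) : (forall n, L2 (u_ n)) ->
  (forall e : R, 0 < e -> exists N, forall m n, (N <= m)%N -> (N <= n)%N ->
     (nsq (u_ m \- u_ n)%R <= e%:E)%E) ->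
  exists2 u, L2 u & cvg2 u_ u.
Proof.
move=> Lu cau.
have e4 k : 0 < (4^-1 : R) ^+ k by rewrite exprn_gt0.
have [N HN] := choice (fun k => cau _ (e4 k)).
(* The sum dominates every [N j] with j <= k, and the added k makes [ph] tend to infinity. *)
pose ph k := (\sum_(j < k.+1) N j + k)%N.
have phN j k : (j <= k)%N -> (N j <= ph k)%N.
  move=> jk; rewrite /ph; have jk1 : (j < k.+1)%N by [].
  by rewrite (bigD1 (Ordinal jk1))//= -addnA leq_addr.
have phk k : (k <= ph k)%N by rewrite leq_addl.
have mu_ n : measurable_fun setT (u_ n) by case: (Lu n).
pose d k := u_ (ph k.+1) \- u_ (ph k).
have md k : measurable_fun setT (d k) by exact: measurable_funB.
have dk k : (nsq (d k) <= (4^-1 ^+ k)%:E)%E.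
  by apply: HN; apply: phN => //; exact: leqW.
pose S x := (\sum_(0 <= k <oo) (2 ^+ k * d k x ^+ 2)%:E)%E.
have t0 k x : (0 <= (2 ^+ k * d k x ^+ 2)%:E)%E.
  by rewrite lee_fin; apply: mulr_ge0; [exact: exprn_ge0|exact: sqr_ge0].
have mt k : measurable_fun setT (fun x => (2 ^+ k * d k x ^+ 2)%:E).
  by apply/measurable_EFinP/measurable_funM => //; exact: measurable_funX.
have S0 x : (0 <= S x)%E by exact: nneseries_ge0.
have mS : measurable_fun setT S.
  by apply: ge0_emeasurable_sum => //.
have IS : (\int[mu]_x S x < +oo)%E.
  rewrite /S integral_nneseries//.
  apply: (@le_lt_trans _ _ 2%:E); last exact: ltry.
  apply: lime_le.
    by apply: is_cvg_nneseries => k _ _; exact: integral_ge0.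
  apply: nearW => n.
  apply: (@le_trans _ _ (\sum_(0 <= k < n) (2^-1 ^+ k)%:E)%E).
    apply: lee_sum => k _.
    under eq_integral do rewrite EFinM.
    rewrite ge0_integralZl//; last 2 first.
    - exact: measurable_sqr.
    - by move=> x _; rewrite lee_fin sqr_ge0.
    apply: (@le_trans _ _ ((2 ^+ k)%:E * (4^-1 ^+ k)%:E)%E).
      by apply: lee_wpmul2l; [rewrite lee_fin exprn_ge0|exact: dk].
    by rewrite -EFinM -exprMn lee_fin; apply: lerXn2r; rewrite ?nnegrE; lra.
  by rewrite sumEFin lee_fin sum_geo_half.
(* The upper limit exists at every point, so measurability requires no removal of the exceptional
   null set; [fine] then gives a finite value everywhere. *)
pose v x := limn_esup (fun k => (u_ (ph k) x)%:E).
pose u x := fine (v x).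
have mv : measurable_fun setT v.
  by apply: measurable_fun_limn_esup => k; exact/measurable_EFinP.
have mu' : measurable_fun setT u by apply: measurableT_comp.
have cu : {ae mu, forall x, (fun k => u_ (ph k) x) @ \oo --> u x}.
  have := ae_lty mS S0 IS; apply: aeS => x Sx.
  have : cvgn (series (fun k => d k x)).
    apply: (@cvg_of_weighted_sqr _ (fine (S x))) => n.
    rewrite -lee_fin fineK ?ge0_fin_numE// -sumEFin.
    by apply: nneseries_lim_ge => k _ _; exact: t0.
  move=> /cvg_ex[l hl].
  have cl : (fun k => u_ (ph k) x) @ \oo --> l + u_ (ph 0%N) x.
    have -> : (fun k => u_ (ph k) x) = (fun k => series (fun k => d k x) k
        + u_ (ph 0%N) x).
      apply/funext => k; rewrite /series/=.
      by rewrite (telescope_sumr (fun k => u_ (ph k) x))// subrK.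
    by apply: cvgD => //; exact: cvg_cst.
  have -> // : u x = l + u_ (ph 0%N) x.
  rewrite /u /v.
  have : (fun k => (u_ (ph k) x)%:E) @ \oo --> (l + u_ (ph 0%N) x)%:E.
    by apply: cvg_EFin => //; exact: nearW.
  by move=> /cvg_limn_einf_sup[_ ->].
(* Fatou along the subsequence: a Cauchy bound on [u_ m \- u_ n] for all n >= m survives when [u_ n]
   is replaced by the limit. It gives both that [u] is in L^2 and that the whole sequence
   converges. *)
have key e m : 0 < e -> (forall n, (m <= n)%N -> (nsq (u_ m \- u_ n)%R <= e%:E)%E) ->
    (nsq (u_ m \- u)%R <= e%:E)%E.
  move=> e0 he.
  have : (\int[mu]_x limn_einf (fun k => ((u_ m x - u_ (ph k) x) ^+ 2)%:E)
      <= limn_einf (fun k => \int[mu]_x ((u_ m x - u_ (ph k) x) ^+ 2)%:E))%E.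
    apply: fatou => //.
      by move=> k; apply: measurable_sqr; exact: measurable_funB.
    by move=> k x _; rewrite lee_fin sqr_ge0.
  have -> : (\int[mu]_x limn_einf (fun k => ((u_ m x - u_ (ph k) x) ^+ 2)%:E)
      = nsq (u_ m \- u)%R)%E.
    apply: ge0_ae_eq_integral => //.
    - under eq_fun do rewrite -[limn_einf _]oppeK -limn_esupN.
      apply: measurableT_comp => //; apply: measurable_fun_limn_esup => k.
      apply: measurableT_comp => //.
      by apply: measurable_sqr; exact: measurable_funB.
    - by apply: measurable_sqr; exact: measurable_funB.
    - move=> x _; rewrite limn_einf_lim; apply: lime_ge.
        exact: is_cvg_einfs.
      apply: nearW => n; apply: le_ereal_inf_tmp => _ [k _ <-].
      by rewrite lee_fin sqr_ge0.
    - by move=> x _; rewrite lee_fin sqr_ge0.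
    apply: aeS cu => x cx _.
    have : (fun k => ((u_ m x - u_ (ph k) x) ^+ 2)%:E) @ \oo
        --> ((u_ m x - u x) ^+ 2)%:E.
      apply: cvg_EFin; first exact: nearW.
      rewrite /=; under eq_fun do rewrite expr2.
      by rewrite expr2; apply: cvgM; apply: cvgB => //; exact: cvg_cst.
    by move=> /cvg_limn_einf_sup[-> _].
  move=> /le_trans; apply.
  rewrite limn_einf_lim; apply: lime_le; first exact: is_cvg_einfs.
  apply: nearW => n; apply: ge_ereal_inf.
  exists (nsq (u_ m \- u_ (ph (n + m)%N))); last first.
    by apply: he; rewrite (leq_trans _ (phk _))// leq_addl.
  by exists (n + m)%N => //=; rewrite leq_addr.
have Lu' : L2 u.
  have [M HM] := cau 1 ltr01.
  have -> : u = u_ M \- (u_ M \- u) by apply/funext => x /=; ring.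
  apply: L2B => //; split; first exact: measurable_funB.
  apply: (@le_lt_trans _ _ 1%:E); last exact: ltry.
  by apply: key => // n Mn; apply: HM.
exists u => //; rewrite /cvg2.
apply/fine_cvgP; split.
  by apply: nearW => n; rewrite ge0_fin_numE ?nsq_ge0//; case: (L2B (Lu n) Lu').
apply/cvgrPdist_le => e e0; have [M HM] := cau e e0.
exists M => // m /= Mm; rewrite sub0r normrN ger0_norm; last first.
  by rewrite fine_ge0// nsq_ge0.
rewrite -lee_fin fineK; last first.
  by rewrite ge0_fin_numE ?nsq_ge0//; case: (L2B (Lu m) Lu').
by apply: key => // n mn; apply: HM => //; exact: leq_trans mn.
Qed.

End Completeness.

(** * Integral operators with bounded kernels *)

Section Kernels.
Context {R : realType}.
Local Notation mu := (@lebesgue_measure R).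
Implicit Types (phi psi : R -> R) (k : R * R -> R).

Lemma integrable_kernel phi psi k (M : R) : measurable_fun setT k ->
  (forall z, `|k z| <= M) -> L1 phi -> L1 psi ->
  (mu \x mu)%E.-integrable setT
    (fun z => (phi z.1 * (k z * psi z.2))%:E).
Proof.
move=> mk kM Iphi Ipsi.
have mphi := L1_meas Iphi; have mpsi := L1_meas Ipsi.
have mf : measurable_fun setT
    (fun z : R * R => (phi z.1 * (k z * psi z.2))%:E).
  apply/measurable_EFinP/measurable_funM; first exact: measurableT_comp.
  by apply: measurable_funM => //; exact: measurableT_comp.
apply/integrable12ltyP; first exact: mf.
apply: (@le_lt_trans _ _ (\int[mu]_x (`|phi x| * (M * \int[mu]_y `|psi y|))%:E)%E).
  apply: ge0_le_integral => //.
  - by move=> x _; exact: integral_ge0.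
  - apply: (@measurable_fun_fubini_tonelli_F _ _ _ _ _ mu
      (fun z : R * R => `|(phi z.1 * (k z * psi z.2))%:E|%E)) => //.
    exact: measurableT_comp.
  - apply/measurable_EFinP/measurable_funM => //; exact: measurableT_comp.
  move=> x _ /=.
  have I1 : L1 (fun y => `|phi x| * M * `|psi y|) by apply: L1Z; exact: L1_norm.
  apply: (@le_trans _ _ (\int[mu]_y (`|phi x| * M * `|psi y|)%:E)%E).
    apply: ge0_le_integral => //.
    - do 2 apply: measurableT_comp => //.
      apply/measurable_funM => //; apply: measurable_funM => //.
      exact: measurableT_comp.
    - by case/integrableP: I1.
    move=> y _ /=; rewrite lee_fin !normrM mulrA ler_wpM2r// ler_wpM2l//.
  have -> : (\int[mu]_y (`|phi x| * M * `|psi y|)%:E)%E =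
      (\int[mu]_y (`|phi x| * M * `|psi y|))%:E.
    by rewrite /Rintegral fineK//; exact: (integrable_fin_num _ I1).
  by rewrite RintegralZl ?mulrA//; exact: L1_norm.
set c := M * _.
have I2 : L1 (fun x => c * `|phi x|) by apply: L1Z; exact: L1_norm.
under eq_integral do rewrite mulrC.
have := integrable_fin_num measurableT I2.
by rewrite ge0_fin_numE// integral_ge0// => x _; rewrite lee_fin
  mulr_ge0// /c mulr_ge0 ?(le_trans _ (kM (0,0)))// Rintegral_ge0.
Qed.

Lemma L1_slice psi k (M : R) (x : R) : measurable_fun setT k -> (forall z, `|k z| <= M) ->
  L1 psi -> L1 (fun y => k (x, y) * psi y).
Proof. by move=> mk kM; apply: L1Mb => //; exact: measurableT_comp. Qed.

Lemma L1_slice2 phi k (M : R) (y : R) : measurable_fun setT k -> (forall z, `|k z| <= M) ->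
  L1 phi -> L1 (fun x => k (x, y) * phi x).
Proof. by move=> mk kM; apply: L1Mb => //; exact: measurableT_comp. Qed.

Lemma Fubini_kernel phi psi k (M : R) : measurable_fun setT k ->
  (forall z, `|k z| <= M) -> L1 phi -> L1 psi ->
  \int[mu]_x (phi x * \int[mu]_y (k (x, y) * psi y)) =
  \int[mu]_y (psi y * \int[mu]_x (k (x, y) * phi x)).
Proof.
move=> mk kM Iphi Ipsi; have I := integrable_kernel mk kM Iphi Ipsi.
have := Fubini I; rewrite /= /Rintegral => H.
congr fine; rewrite -[LHS]/(\int[mu]_x _)%E.
transitivity (\int[mu]_x \int[mu]_y (phi x * (k (x, y) * psi y))%:E)%E.
  apply: eq_integral => x _; have I1 := L1_slice x mk kM Ipsi.
  rewrite EFinM fineK; last exact: (integrable_fin_num _ I1).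
  by rewrite -integralZl//.
rewrite H; apply: eq_integral => y _; have I1 := L1_slice2 y mk kM Iphi.
rewrite EFinM fineK; last exact: (integrable_fin_num _ I1).
rewrite -integralZl//; apply: eq_integral => x _.
by rewrite -EFinM; congr EFin; ring.
Qed.

(* Multiplying by a positive integrable weight reduces this to Fubini. *)
Lemma measurable_kernel psi k (M : R) : measurable_fun setT k ->
  (forall z, `|k z| <= M) -> L1 psi ->
  measurable_fun setT (fun x => \int[mu]_y (k (x, y) * psi y)).
Proof.
move=> mk kM Ipsi.
have Ig : L1 (@gauss_fun R) by exact: integrableT_gauss.
have I := integrable_kernel mk kM Ig Ipsi.
have := measurable_fubini_F I; rewrite /fubini_F /= => mF.
have -> : (fun x => \int[mu]_y (k (x, y) * psi y)) =
    (fun x => (gauss_fun x)^-1 *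
      fine (\int[mu]_y (gauss_fun x * (k (x, y) * psi y))%:E)%E).
  apply/funext => x; have I1 := L1_slice x mk kM Ipsi.
  under [in RHS]eq_integral do rewrite EFinM.
  rewrite integralZl// fineM//; last exact: (integrable_fin_num _ I1).
  by rewrite /= mulKf// /gauss_fun gt_eqF// expR_gt0.
apply: measurable_funM.
  have -> : (fun x : R => (gauss_fun x)^-1) = (fun x => expR (x ^+ 2)).
    by apply/funext => x; rewrite /gauss_fun -expRN opprK.
  by apply: measurableT_comp => //; exact: measurable_funX.
by apply: measurableT_comp mF => //.
Qed.

Lemma L1_kernel phi psi k (M : R) : measurable_fun setT k ->
  (forall z, `|k z| <= M) -> L1 phi -> L1 psi ->
  L1 (fun x => phi x * \int[mu]_y (k (x, y) * psi y)).
Proof.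
move=> mk kM Iphi Ipsi.
have B x : `|\int[mu]_y (k (x, y) * psi y)| <= M * \int[mu]_y `|psi y|.
  have I1 := L1_slice x mk kM Ipsi.
  rewrite (le_trans (le_normr_Rintegral _ I1))//.
  rewrite -RintegralZl//; last exact: L1_norm.
  apply: le_Rintegral => //; first exact: L1_norm.
    by apply: L1Z; exact: L1_norm.
  by move=> y _; rewrite normrM ler_wpM2r.
have := L1Mb (measurable_kernel mk kM Ipsi) B Iphi.
by apply: eq_integrable => // x _; rewrite /= mulrC.
Qed.

(** * Invariance of Lebesgue measure under x -> a - x *)

Definition reflect (a x : R) : R := a - x.

Lemma measurable_reflect (a : R) :
  measurable_fun setT (reflect a : measurableTypeR R -> measurableTypeR R).
Proof. exact: measurable_funB. Qed.

HB.instance Definition _ (a : R) :=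
  isMeasurableFun.Build _ _ _ _ (reflect a : measurableTypeR R -> measurableTypeR R)
    (measurable_reflect a).

(** Lebesgue measure is determined by its values on half-open intervals. The preimage is half-open
    on the other side, which leaves its length unchanged. *)
Lemma pushforward_reflect (a : R) (A : set R) : measurable A ->
  pushforward mu (reflect a : measurableTypeR R -> measurableTypeR R) A = mu A.
Proof.
move=> mA; apply/esym/lebesgue_measure_unique => //= _ [[s t]] _ <-.
rewrite /pushforward.
have -> : reflect a @^-1` `]s, t] = `[a - t, a - s[%classic.
  by apply/seteqP; split => x; rewrite /reflect /= !in_itv/= => /andP[h1 h2];
    apply/andP; split; lra.
rewrite !lebesgue_measure_itv/= !lte_fin.
have -> : (a - t < a - s) = (s < t) by rewrite ltrD2l ltrN2.
by case: ifP => // _; rewrite -!EFinB; congr EFin; ring.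
Qed.

Lemma ge0_integral_reflect (a : R) (f : R -> \bar R) : measurable_fun setT f ->
  (forall x, 0 <= f x)%E -> (\int[mu]_x f (a - x)%R = \int[mu]_x f x)%E.
Proof.
move=> mf f0.
have := @ge0_integral_pushforward _ _ _ _ R _ (measurable_reflect a) mu setT f
  measurableT mf (fun x _ => f0 x).
rewrite preimage_setT => /esym ->.
by apply: eq_measure_integral => A mA _; exact: pushforward_reflect.
Qed.

Lemma L1_reflect (a : R) (f : R -> R) : L1 f -> L1 (fun x => f (a - x)).
Proof.
move=> If; apply/integrableP; have /integrableP[mf fy] := If; split.
  by apply: (measurableT_comp mf); exact: measurable_reflect.
rewrite /= (@ge0_integral_reflect a (fun x => `|(f x)%:E|)%E)//.
exact: measurableT_comp.
Qed.

Lemma Rintegral_reflect (a : R) (f : R -> R) : L1 f ->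
  \int[mu]_x f (a - x) = \int[mu]_x f x.
Proof.
move=> If; congr fine.
have If' := L1_reflect a If.
have := integral_pushforward (measurable_reflect a) (measurable_int _ If)
  (D := setT).
rewrite preimage_setT => /(_ mu If' measurableT) /esym ->.
by apply: eq_measure_integral => A mA _; exact: pushforward_reflect.
Qed.

End Kernels.

(** * One-variable calculus *)

Section Calculus.
Context {R : realType}.
Local Notation mu := (@lebesgue_measure R).
Implicit Types (f g F : R -> R) (x a b e s t u : R).

(* The library states derivatives of sums, products and composites with the
   module operation [*:]; these versions expose plain products in [R]. *)
Lemma isd_cst (c : R) x : is_derive x 1 (fun _ : R => c) 0.
Proof. exact: is_derive_cst. Qed.

Lemma isd_eq f x a b : is_derive x 1 f a -> a = b -> is_derive x 1 f b.
Proof. by move=> ? <-. Qed.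

Lemma isd_id x : is_derive x 1 (fun y : R => y) 1.
Proof. exact: is_derive_id. Qed.

Lemma isdD f g x a b : is_derive x 1 f a -> is_derive x 1 g b ->
  is_derive x 1 (fun y => f y + g y) (a + b).
Proof. by move=> df dg; exact: is_deriveD. Qed.

Lemma isdN f x a : is_derive x 1 f a -> is_derive x 1 (fun y => - f y) (- a).
Proof. by move=> df; exact: is_deriveN. Qed.

Lemma isdM f g x a b : is_derive x 1 f a -> is_derive x 1 g b ->
  is_derive x 1 (fun y => f y * g y) (f x * b + g x * a).
Proof. by move=> df dg; exact: (@is_deriveM _ _ f g). Qed.

Lemma isdZ c f x a : is_derive x 1 f a ->
  is_derive x 1 (fun y => c * f y) (c * a).
Proof.
by move=> df; apply: (isd_eq (isdM (isd_cst c x) df)); rewrite mulr0 addr0.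
Qed.

Lemma isd_lin c x : is_derive x 1 (fun y => c * y) c.
Proof. by have := isdZ c (isd_id x); rewrite mulr1. Qed.

Lemma isd_comp f g x a b : is_derive (g x) 1 f a -> is_derive x 1 g b ->
  is_derive x 1 (fun y => f (g y)) (a * b).
Proof. by move=> df dg; exact: is_derive1_comp. Qed.

Lemma isd_cos g x b : is_derive x 1 g b ->
  is_derive x 1 (fun y => cos (g y)) (- sin (g x) * b).
Proof. by apply: isd_comp; exact: is_derive_cos. Qed.

Lemma isd_sin g x b : is_derive x 1 g b ->
  is_derive x 1 (fun y => sin (g y)) (cos (g x) * b).
Proof. by apply: isd_comp; exact: is_derive_sin. Qed.

Lemma isd_exp g x b : is_derive x 1 g b ->
  is_derive x 1 (fun y => expR (g y)) (expR (g x) * b).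
Proof. by apply: isd_comp; exact: is_derive_expR. Qed.

Lemma isd_cont f x a : is_derive x 1 f a -> {for x, continuous f}.
Proof.
by move=> df; apply: differentiable_continuous; apply/derivable1_diffP;
  exact: ex_derive.
Qed.

Lemma isd_derive1 f x a : is_derive x 1 f a -> derive1 f x = a.
Proof. by move=> df; rewrite derive1E derive_val. Qed.

(** Fatou's lemma in the form that removes a regularizing factor or a truncation when only uniform
    bounds on the integrals are known. *)
Lemma le_integral_of_cvg (f_ : nat -> R -> R) f (B : \bar R) :
  (forall n, measurable_fun setT (f_ n)) -> (forall n x, 0 <= f_ n x) ->
  (forall x, (fun n => f_ n x) @ \oo --> f x) ->
  (forall n, (\int[mu]_x (f_ n x)%:E <= B)%E) ->
  (\int[mu]_x (f x)%:E <= B)%E.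
Proof.
move=> mf f0 cf fB.
have -> : (\int[mu]_x (f x)%:E =
    \int[mu]_x limn_einf (fun n => (f_ n x)%:E))%E.
  apply: eq_integral => x _.
  have : (fun n => (f_ n x)%:E) @ \oo --> (f x)%:E.
    by apply: cvg_EFin; [exact: nearW|exact: cf].
  by move=> /cvg_limn_einf_sup[-> _].
apply: (le_trans (fatou mu measurableT _ _)) => //.
- by move=> n; apply/measurable_EFinP; exact: mf.
- by move=> n x _; rewrite lee_fin.
rewrite limn_einf_lim; apply: lime_le; first exact: is_cvg_einfs.
apply: nearW => n; apply: ge_ereal_inf.
by exists (\int[mu]_x (f_ n x)%:E)%E => //; exists n => /=.
Qed.

(** Adapted to integrands singular at 0, such as t^(alpha-1): integrability on the open half-line
    and one-sided limits of the primitive replace continuity at 0. The compact case is applied on an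
    exhausting sequence and dominated convergence concludes. *)
Lemma integral_FTC0y f F A B :
  (forall x, 0 < x -> is_derive x 1 F (f x)) ->
  (forall x, 0 < x -> {for x, continuous f}) ->
  mu.-integrable `]0, +oo[ (EFin \o f) ->
  F x @[x --> 0^'+] --> A -> F x @[x --> +oo] --> B ->
  \int[mu]_(x in `]0, +oo[) f x = B - A.
Proof.
move=> dF cf If FA FB.
(* The shift by 2 ensures 1/(n+2) < 1 < n+2, so every interval is nondegenerate and contained in (0,
   oo). *)
pose a n : R := n.+2%:R^-1; pose b n : R := n.+2%:R.
have a0 n : 0 < a n by rewrite invr_gt0.
have b0 n : 0 < b n by [].
have ab n : a n < b n.
  apply: (@lt_trans _ _ 1); first by rewrite invf_lt1// ltr1n.
  by rewrite ltr1n.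
have E n : (\int[mu]_(x in `[a n, b n]) (f x)%:E =
    (F (b n))%:E - (F (a n))%:E)%E.
  apply: continuous_FTC2 => //.
  - apply: continuous_in_subspaceT => x; rewrite inE/= in_itv/= => /andP[h _].
    by apply: cf; exact: lt_le_trans h.
  - split.
    + move=> x; rewrite in_itv/= => /andP[h _].
      by have := dF x (lt_trans (a0 n) h) => d; exact: ex_derive.
    + by apply: cvg_at_right_filter; exact: (isd_cont (dF _ (a0 n))).
    + by apply: cvg_at_left_filter; exact: (isd_cont (dF _ (b0 n))).
  move=> x; rewrite in_itv/= => /andP[h _].
  exact: (isd_derive1 (dF _ (lt_trans (a0 n) h))).
have sub n : `[a n, b n]%classic `<=` `]0, +oo[%classic.
  move=> x /=; rewrite !in_itv/= => /andP[h _]; rewrite andbT.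
  exact: lt_le_trans h.
have bcv : b n @[n --> \oo] --> +oo.
  apply/cvgryPge => r; near=> n; rewrite /b (le_trans (_ : r <= n%:R))//.
    by near: n; exact: nbhs_infty_ger.
  by rewrite ler_nat ltnW.
have acv : a n @[n --> \oo] --> (0:R).
  by apply/(@gtr0_cvgV0 _ _ _ _ b) => //; near=> n.
have mf : measurable_fun (`]0%R, +oo[%classic : set R) (EFin \o f) by case/integrableP: If.
have D : (fun n => \int[mu]_(x in `]0%R, +oo[) ((EFin \o f) \_ `[a n, b n]) x)%E
    @ \oo --> (\int[mu]_(x in `]0%R, +oo[) (f x)%:E)%E.
  have : [/\ mu.-integrable `]0, +oo[ (EFin \o f), _ & _] :=
    @dominated_convergence _ _ _ mu `]0, +oo[ _
    (fun n => (EFin \o f) \_ `[a n, b n]) (EFin \o f) (fun x => `|(f x)%:E|)%E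
    _ _ _ _ _.
  case => //.
  - move=> n; apply: (@measurable_funS _ _ _ _ setT) => //.
    apply/(measurable_restrictT _ _).1 => //.
    exact: measurable_funS (sub n) mf.
  - apply: aeW => x; rewrite /= in_itv/= andbT => x0.
    apply: cvg_near_cst; near=> n.
    rewrite patchE mem_set//= in_itv/=; apply/andP; split.
      by near: n; exact: cvgr_le acv _ x0.
    by near: n; move/cvgryPge : bcv => /(_ x).
  - exact: integrable_abse.
  apply: aeW => x n _; rewrite patchE; case: ifP => //= _.
  by rewrite normr0 lee_fin.
apply: EFin_inj; rewrite /Rintegral fineK; last exact: integrable_fin_num.
apply: (cvg_unique _ D) => //.
have -> : (fun n => \int[mu]_(x in `]0%R, +oo[) ((EFin \o f) \_ `[a n, b n]) x)%E
    = (fun n => (F (b n) - F (a n))%:E).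
  apply/funext => n; rewrite -integral_mkcondr setIidr// E -EFinB//.
apply: cvg_EFin; first exact: nearW.
apply: cvgB.
  exact: (cvg_comp _ _ bcv FB).
by move/cvg_at_rightP : FA; apply; split.
Unshelve. all: by end_near. Qed.

Lemma ge0_integral_half_lines (f : R -> \bar R) : measurable_fun setT f ->
  (forall x, 0 <= f x)%E ->
  (\int[mu]_x f x = \int[mu]_(x in `]0%R, +oo[) (f x + f (- x)%R))%E.
Proof.
move=> mf f0.
have mfN : measurable_fun setT (fun x : R => f (- x)).
  exact: (measurableT_comp mf).
rewrite ge0_integralD//; try exact: measurable_funTS.
rewrite (_ : [set: R] = `]-oo, 0%R] `|` `]0%R, +oo[); last first.
  by rewrite -setCitvr setvU.
rewrite ge0_integral_setU//; last 2 first.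
- exact: measurable_funTS.
- rewrite disj_set2E; apply/eqP; rewrite -subset0 => x []/= /[!in_itv]/=.
  by move=> h; rewrite ltNge h.
rewrite addeC; congr (_ + _)%E.
have := @ge0_integration_by_substitution0 R (fun x => f (- x)) mfN
  (fun x => f0 _).
rewrite integral_itv_obnd_cbnd; last exact: measurable_funTS.
by move=> ->; apply: eq_integral => x _; rewrite opprK.
Qed.

Lemma Rintegral_half_lines f : L1 f ->
  \int[mu]_x f x = \int[mu]_(x in `]0, +oo[) (f x + f (- x)).
Proof.
move=> If.
have IfN : L1 (fun x => f (- x)).
  have := L1_reflect 0 If; apply: eq_integrable => // x _.
  by rewrite /= sub0r.
have sub (g : R -> R) : L1 g -> mu.-integrable `]0, +oo[ (EFin \o g).
  by apply: integrableS.
have mI : measurable (`]0%R, +oo[%classic : set R) by [].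
rewrite RintegralD//; [|exact: sub..].
rewrite (_ : [set: R] = `]-oo, 0%R] `|` `]0%R, +oo[); last first.
  by rewrite -setCitvr setvU.
rewrite Rintegral_setU//; last 2 first.
- by rewrite -setCitvr setvU.
- rewrite disj_set2E; apply/eqP; rewrite -subset0 => x []/= /[!in_itv]/=.
  by move=> h; rewrite ltNge h.
rewrite addrC; congr (_ + _).
rewrite Rintegral_itv_obnd_cbnd; last exact: sub.
rewrite [LHS]Rintegral_mkcond [RHS]Rintegral_mkcond.
rewrite -(@Rintegral_reflect R 0 (f \_ `]-oo, 0])); last first.
  have : mu.-integrable `]-oo, 0] (EFin \o f) by exact: integrableS If.
  by rewrite integrable_mkcond// restrict_EFin.
apply: eq_Rintegral => x _; rewrite /= !patchE sub0r.
by rewrite !mem_setE !in_itv/= andbT oppr_le0.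
Qed.

Definition expw (e x : R) : R := expR (- (e * `|x|)).

Lemma measurable_expw e : measurable_fun setT (expw e).
Proof.
apply: measurableT_comp => //; apply: measurableT_comp => //.
by apply: measurable_funM => //; exact: measurableT_comp.
Qed.

Lemma expw_ge0 e x : 0 <= expw e x. Proof. exact: expR_ge0. Qed.

Lemma cvg_expR_scaled e : 0 < e -> expR (- (e * x)) @[x --> +oo] --> (0 : R).
Proof.
move=> e0; have h : (fun x : R => e * x) x @[x --> +oo] --> +oo.
  apply/cvgryPge => A; near=> x; rewrite mulrC -ler_pdivrMr//.
exact: (cvg_comp _ _ h (@cvgr_expR R)).
Unshelve. all: by end_near. Qed.

Lemma integral_exp_half_line e : 0 < e ->
  (\int[mu]_(x in `]0%R, +oo[) (expR (- (e * x)))%:E = (e^-1)%:E)%E.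
Proof.
move=> e0.
have dF x : is_derive x 1 (fun y => - e^-1 * expR (- (e * y))) (expR (- (e * x))).
  apply: (isd_eq (isdZ _ (isd_exp (isdN (isd_lin e x))))).
  by field; rewrite gt_eqF.
have mf : measurable_fun setT (fun x : R => (expR (- (e * x)))%:E).
  apply/measurable_EFinP; apply: measurableT_comp => //.
  by apply: measurableT_comp => //; exact: measurable_funM.
rewrite integral_itv_obnd_cbnd; last exact: measurable_funTS.
rewrite (@ge0_continuous_FTC2y _ _ (fun y => - e^-1 * expR (- (e * y))) 0 0).
- by rewrite mulr0 oppr0 expR0 mulr1 -EFinB; congr EFin; ring.
- by move=> x _; exact: expR_ge0.
- apply: continuous_subspaceT => x.
  exact: (isd_cont (isd_exp (isdN (isd_lin e x)))).
- rewrite -[X in _ --> X](mulr0 (- e^-1)); apply: cvgMr.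
  exact: cvg_expR_scaled.
- by move=> x _; have d := dF x; exact: ex_derive.
- by apply: cvg_at_right_filter; exact: (isd_cont (dF 0)).
- by move=> x _; exact: (isd_derive1 (dF x)).
Qed.

Lemma L1_expw e : 0 < e -> L1 (expw e).
Proof.
move=> e0; apply/integrableP; split.
  by apply/measurable_EFinP; exact: measurable_expw.
have -> : (\int[mu]_x `|(EFin \o expw e) x| = \int[mu]_x (expw e x)%:E)%E.
  by apply: eq_integral => x _ /=; rewrite ger0_norm// expw_ge0.
rewrite (@ge0_integral_half_lines (EFin \o expw e)); last 2 first.
- by apply/measurable_EFinP; exact: measurable_expw.
- by move=> x; rewrite lee_fin expw_ge0.
rewrite ge0_integralD//=; last 4 first.
- by move=> x _; rewrite lee_fin expw_ge0.
- by apply/measurable_EFinP; apply: measurable_funTS; exact: measurable_expw.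
- by move=> x _; rewrite lee_fin expw_ge0.
- apply/measurable_EFinP; apply: measurable_funTS.
  by apply: (measurableT_comp (measurable_expw e)).
have h : (\int[mu]_(x in `]0%R, +oo[) (expw e x)%:E = (e^-1)%:E)%E.
  rewrite -integral_exp_half_line//; apply: eq_integral => x.
  by rewrite inE/= in_itv/= andbT => x0; rewrite /expw gtr0_norm.
rewrite h; under eq_integral do rewrite /expw normrN -/(expw e _).
by rewrite h -EFinD ltry.
Qed.

(** Folding the line onto (0, oo) cancels the odd sine term, so its frequency [b] may differ from
    [a]. This matters because a product of two kernels cas(x s) cas(x t) has frequency t - s in the
    cosine and t + s in the sine. *)
Lemma Rintegral_expw_trig e a b : 0 < e ->
  \int[mu]_x ((cos (x * a) + sin (x * b)) * expw e x) =
    2 * e / (e ^+ 2 + a ^+ 2).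
Proof.
move=> e0.
have n0 : e ^+ 2 + a ^+ 2 != 0.
  by rewrite gt_eqF// ltr_wpDr ?sqr_ge0// exprn_gt0.
have mtrig (c : R) : measurable_fun setT (fun x : R => cos (x * c)) /\
    measurable_fun setT (fun x : R => sin (x * c)).
  by split; apply: continuous_measurable_fun => x;
    have := isd_lin c x; under eq_fun do rewrite mulrC;
    [move=> /isd_cos|move=> /isd_sin] => /isd_cont.
have B x : `|cos (x * a) + sin (x * b)| <= 2.
  by rewrite (le_trans (ler_normD _ _))// -[2]/(1 + 1) lerD ?cos_max ?sin_max.
rewrite Rintegral_half_lines; last first.
  apply: (L1Mb _ B (L1_expw e0)).
  by apply: measurable_funD; [exact: (mtrig a).1|exact: (mtrig b).2].
pose f x := 2 * (cos (a * x) * expR (- (e * x))).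
pose F x := 2 / (e ^+ 2 + a ^+ 2) *
  ((a * sin (a * x) - e * cos (a * x)) * expR (- (e * x))).
have dF x : is_derive x 1 F (f x).
  have d1 := isd_lin a x.
  have d2 := isdD (isdZ a (isd_sin d1)) (isdN (isdZ e (isd_cos d1))).
  have d3 := isdM d2 (isd_exp (isdN (isd_lin e x))).
  by apply: (isd_eq (isdZ _ d3)); rewrite /f; field.
have cf x : {for x, continuous f}.
  have d1 := isd_lin a x.
  exact: (isd_cont (isdZ 2 (isdM (isd_cos d1) (isd_exp (isdN (isd_lin e x)))))).
transitivity (\int[mu]_(x in `]0, +oo[) f x).
  apply: eq_Rintegral => x; rewrite inE/= in_itv/= andbT => x0.
  rewrite /f /expw normrN gtr0_norm// !mulNr cosN sinN (mulrC a).
  by ring.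
rewrite (@integral_FTC0y f F (F 0) 0)//.
- rewrite /F !mulr0 cos0 sin0 oppr0 expR0; field; exact: n0.
- apply: (@le_integrable _ _ _ mu `]0, +oo[ _ _ (EFin \o (fun x => 2 * expw e x))) => //.
  + apply/measurable_EFinP; apply: measurable_funTS.
    by apply: continuous_measurable_fun => x; exact: cf.
  + move=> x; rewrite /= in_itv/= andbT => x0; rewrite lee_fin /f /expw.
    rewrite (gtr0_norm x0) !normrM ler_wpM2l// ler_piMl// cos_max//.
  apply: integrableS (L1Z 2 (L1_expw e0)) => //.
- by apply: cvg_at_right_filter; exact: (isd_cont (dF 0)).
rewrite -[X in _ --> X](mulr0 (2 / (e ^+ 2 + a ^+ 2))); apply: cvgMr.
apply/norm_cvg0P.
have hl : (`|a| + `|e|) * expR (- (e * x)) @[x --> +oo] --> (0 : R).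
  rewrite -[X in _ --> X](mulr0 (`|a| + `|e|)); apply: cvgMr.
  exact: cvg_expR_scaled.
apply: (squeeze_cvgr _ (cvg_cst 0) hl); apply: nearW => x /=.
rewrite normr_ge0/= normrM (ger0_norm (expR_ge0 _)).
rewrite ler_wpM2r ?expR_ge0// (le_trans (ler_normB _ _))// !normrM.
by apply: lerD; rewrite ler_piMr// ?cos_max ?sin_max.
Qed.

(** * The Poisson kernel *)

Definition poisson (e u : R) : R := e / (pi * (e ^+ 2 + u ^+ 2)).

Lemma sqr_pos (e u : R) : 0 < e -> 0 < e ^+ 2 + u ^+ 2.
Proof. by move=> e0; rewrite ltr_wpDr ?sqr_ge0// exprn_gt0. Qed.

Lemma poisson_ge0 e u : 0 < e -> 0 <= poisson e u.
Proof.
by move=> e0; rewrite divr_ge0 ?ltW// mulr_gt0 ?pi_gt0// sqr_pos.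
Qed.

Lemma isd_poisson (e s : R) : 0 < e ->
  is_derive s 1 (fun u => pi^-1 * atan (e^-1 * u)) (poisson e s).
Proof.
move=> e0; apply: (isd_eq (isdZ _ (isd_comp (is_derive1_atan _) (isd_lin _ s)))).
have p0 : pi != 0 :> R by rewrite gt_eqF// pi_gt0.
have := sqr_pos s e0 => /lt0r_neq0 n0.
have ne : e != 0 by rewrite gt_eqF.
rewrite /poisson; move: p0; move: (@pi R) => p p0; field; by rewrite ne p0 n0.
Qed.

Lemma poisson_cont e s : 0 < e -> {for s, continuous (poisson e)}.
Proof.
move=> e0; apply: cvgM; first exact: cvg_cst.
apply: cvgV; first by rewrite gt_eqF// mulr_gt0 ?pi_gt0// sqr_pos.
apply: cvgMr; apply: cvgD; first exact: cvg_cst.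
by under eq_fun do rewrite expr2; rewrite expr2; apply: cvgM; exact: cvg_id.
Qed.

Lemma measurable_poisson e : 0 < e -> measurable_fun setT (poisson e).
Proof. by move=> e0; apply: continuous_measurable_fun => s; exact: poisson_cont. Qed.

Lemma integral_poisson e : 0 < e -> (\int[mu]_x (poisson e x)%:E = 1)%E.
Proof.
move=> e0; have p0 := @pi_gt0 R.
have mP := measurable_poisson e0.
rewrite (@ge0_integral_half_lines (EFin \o poisson e)); last 2 first.
- exact/measurable_EFinP.
- by move=> x; rewrite lee_fin poisson_ge0.
under eq_integral do rewrite /= {2}/poisson sqrrN -/(poisson e _) -EFinD.
rewrite integral_itv_obnd_cbnd; last first.
  by apply: measurable_funTS; apply/measurable_EFinP; exact: measurable_funD.
pose F u := 2 * (pi^-1 * atan (e^-1 * u)).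
have dF x : is_derive x 1 F (poisson e x + poisson e x).
  by apply: (isd_eq (isdZ 2 (isd_poisson x e0))); ring.
rewrite (@ge0_continuous_FTC2y _ _ F 0 1).
- by rewrite /F mulr0 atan0 !mulr0 sube0.
- by move=> x _; rewrite addr_ge0// poisson_ge0.
- apply: continuous_subspaceT => x.
  by apply: cvgD; exact: poisson_cont.
- rewrite (_ : 1%R = 2 * (pi^-1 * (pi / 2))); last first.
    by move: (gt_eqF p0); move: (@pi R) => p np; field; rewrite np.
  do 2 apply: cvgMr.
  have h : e^-1 * x @[x --> +oo] --> +oo.
    apply/cvgryPge => A; near=> x; rewrite mulrC ler_pdivlMr//.
  exact: (cvg_comp _ _ h (@cvgy_atan R)).
- by move=> x _; have d := dF x; exact: ex_derive.
- by apply: cvg_at_right_filter; exact: (isd_cont (dF 0)).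
- by move=> x _; exact: (isd_derive1 (dF x)).
Unshelve. all: by end_near. Qed.

(** This is the Poisson mean of the indicator of [a, b]. Its limit as e tends to 0 can be read off
    from the arctangents, which replaces a general theorem on approximate identities. *)
Lemma integral_poisson_itv e a b t : 0 < e -> a < b ->
  \int[mu]_(s in `[a, b]) poisson e (t - s) =
    pi^-1 * atan (e^-1 * (t - a)) - pi^-1 * atan (e^-1 * (t - b)).
Proof.
move=> e0 ab.
pose F s := - (pi^-1 * atan (e^-1 * (t - s))).
have dF x : is_derive x 1 F (poisson e (t - x)).
  have d1 := isdD (isd_cst t x) (isdN (isd_id x)).
  have d2 := isdN (@isd_comp (fun u => pi^-1 * atan (e^-1 * u)) (fun s => t - s) _ _ _
    (isd_poisson (t - x) e0) d1).
  by apply: (isd_eq d2); ring.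
rewrite /Rintegral (@continuous_FTC2 _ _ F)//.
- by rewrite /F /=; ring.
- apply: continuous_subspaceT => x.
  apply: (@continuous_comp _ _ _ (fun s => t - s)); last exact: poisson_cont.
  by apply: cvgB; [exact: cvg_cst|exact: cvg_id].
- split; first by move=> x _; have d := dF x; exact: ex_derive.
  + by apply: cvg_at_right_filter; exact: (isd_cont (dF a)).
  + by apply: cvg_at_left_filter; exact: (isd_cont (dF b)).
- by move=> x _; exact: (isd_derive1 (dF x)).
Qed.

End Calculus.

(** * Convolution *)

Section Convolution.
Context {R : realType}.
Local Notation mu := (@lebesgue_measure R).
Implicit Types (K u v : R -> R) (t s : R).

(** Tonelli is applied to the positive and negative parts separately. Where a slice is not
    integrable their difference takes a default value, and measurability covers those points as
    well. *)
Lemma measurable_Rintegral_slice (F : R * R -> R) : measurable_fun setT F ->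
  measurable_fun setT (fun t => \int[mu]_s F (t, s)).
Proof.
move=> mF; apply: measurableT_comp => //.
have mE : measurable_fun setT (EFin \o F) by exact/measurable_EFinP.
under eq_fun do rewrite integralE.
apply: emeasurable_funB.
- have := @measurable_fun_fubini_tonelli_F _ _ _ _ _ mu (EFin \o F)^\+%E
    (measurable_funepos mE) (funepos_ge0 _) => h.
  refine (eq_ind _ (measurable_fun setT) h _ _).
  by apply/funext => x; apply: eq_integral => s _; rewrite !funeposE.
- have := @measurable_fun_fubini_tonelli_F _ _ _ _ _ mu (EFin \o F)^\-%E
    (measurable_funeneg mE) (funeneg_ge0 _) => h.
  refine (eq_ind _ (measurable_fun setT) h _ _).
  by apply/funext => x; apply: eq_integral => s _; rewrite !funenegE.
Qed.

Lemma measurable_sub2 : measurable_fun setT (fun z : R * R => z.1 - z.2).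
Proof. by apply: measurable_funB. Qed.

Definition conv K u t : R := \int[mu]_s (K (t - s) * u s).

Lemma measurable_conv_kernel K u : measurable_fun setT K ->
  measurable_fun setT u ->
  measurable_fun setT (fun z : R * R => K (z.1 - z.2) * u z.2).
Proof.
move=> mK mu_; apply: measurable_funM.
  exact: (measurableT_comp mK measurable_sub2).
exact: measurableT_comp.
Qed.

Lemma measurable_conv K u : measurable_fun setT K -> measurable_fun setT u ->
  measurable_fun setT (conv K u).
Proof.
by move=> mK mu_; exact: (measurable_Rintegral_slice (measurable_conv_kernel mK mu_)).
Qed.

(** A translation is the composite of two reflections. *)
Lemma integral_shift K s : measurable_fun setT K -> (forall x, 0 <= K x) ->
  (\int[mu]_t (K (t - s))%:E = \int[mu]_t (K t)%:E)%E.
Proof.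
move=> mK K0.
have mKN : measurable_fun setT (fun x : R => (K (- x))%:E).
  by apply/measurable_EFinP; exact: measurableT_comp.
have := @ge0_integral_reflect R s (fun x => (K (- x))%:E) mKN
  (fun x => K0 _).
have := @ge0_integral_reflect R 0 (fun x => (K x)%:E) _ (fun x => K0 _).
under eq_integral do rewrite sub0r.
move=> <-; last exact/measurable_EFinP.
by move=> <-; apply: eq_integral => x _; rewrite opprB.
Qed.

Section Young.
Variable K : R -> R.
Hypotheses (IK : L1 K) (K0 : forall x, 0 <= K x).
Let mK : measurable_fun setT K := L1_meas IK.
Let kappa := \int[mu]_x K x.

Let kappaE : (\int[mu]_t (K t)%:E = kappa%:E)%E.
Proof. by rewrite /kappa /Rintegral fineK//; exact: (integrable_fin_num _ IK). Qed.

Let kappa0 : 0 <= kappa. Proof. exact: Rintegral_ge0. Qed.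

Let L1K t : L1 (fun s => K (t - s)). Proof. exact: L1_reflect. Qed.

Lemma conv_tonelli u : measurable_fun setT u ->
  (\int[mu]_t \int[mu]_s (K (t - s) * u s ^+ 2)%:E = kappa%:E * nsq u)%E.
Proof.
move=> mu_.
have m2 : measurable_fun setT (fun x => u x ^+ 2) by exact: measurable_funX.
rewrite (@fubini_tonelli _ _ _ _ _ mu mu
  (fun z : R * R => (K (z.1 - z.2) * u z.2 ^+ 2)%:E)); last 2 first.
- by apply/measurable_EFinP; exact: (measurable_conv_kernel mK m2).
- by move=> z; rewrite lee_fin mulr_ge0// sqr_ge0.
rewrite /nsq -ge0_integralZl//; last 2 first.
- exact: measurable_sqr.
- by move=> x _; rewrite lee_fin sqr_ge0.
apply: eq_integral => s _ /=.
under eq_integral do rewrite mulrC EFinM.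
rewrite ge0_integralZl//; last 3 first.
- by apply/measurable_EFinP; apply: (measurableT_comp mK); exact: measurable_funB.
- by move=> x _; rewrite lee_fin.
- by rewrite lee_fin sqr_ge0.
by rewrite integral_shift// kappaE muleC.
Qed.

Lemma conv_ae_fin u : L2 u ->
  {ae mu, forall t, (\int[mu]_s (K (t - s) * u s ^+ 2)%:E < +oo)%E}.
Proof.
move=> [mu_ fu]; apply: ae_lty.
- apply: (@measurable_fun_fubini_tonelli_F _ _ _ _ _ mu
    (fun z : R * R => (K (z.1 - z.2) * u z.2 ^+ 2)%:E)).
    apply/measurable_EFinP.
    exact: (measurable_conv_kernel mK (measurable_funX 2 mu_)).
  by move=> z; rewrite lee_fin mulr_ge0// sqr_ge0.
- by move=> t; apply: integral_ge0 => s _; rewrite lee_fin mulr_ge0// sqr_ge0.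
by rewrite conv_tonelli// lte_mul_pinfty.
Qed.

Let fin_L1sqr u t : measurable_fun setT u ->
  (\int[mu]_s (K (t - s) * u s ^+ 2)%:E < +oo)%E ->
  L1 (fun s => K (t - s) * u s ^+ 2).
Proof.
move=> mu_ h; apply/integrableP; split.
  apply/measurable_EFinP; apply: measurable_funM; first exact: L1_meas (L1K t).
  exact: measurable_funX.
move: h; apply: le_lt_trans; rewrite le_eqVlt; apply/orP; left; apply/eqP.
by apply: eq_integral => s _ /=; rewrite ger0_norm// mulr_ge0// sqr_ge0.
Qed.

Let fin_L1 u t : measurable_fun setT u ->
  (\int[mu]_s (K (t - s) * u s ^+ 2)%:E < +oo)%E ->
  L1 (fun s => K (t - s) * u s).
Proof.
move=> mu_ h; have := L1D (L1K t) (fin_L1sqr mu_ h).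
apply: le_L1.
  by apply: measurable_funM => //; exact: L1_meas (L1K t).
move=> s /=; rewrite normrM (ger0_norm (K0 _)) -{2}(mulr1 (K (t - s))) -mulrDr.
rewrite ler_wpM2l// -(real_normK (num_real (u s))).
by have := sqr_ge0 (`|u s| - 1); have := normr_ge0 (u s); nra.
Qed.

(** By Tonelli \int K(t-s) u(s)^2 ds is finite for almost every t; there |u| <= 1 + u^2 and the
    integrability of [K] give the claim. The integrability asserted in condition (i) ultimately
    comes from here. *)
Lemma conv_ae_L1 u : L2 u -> {ae mu, forall t, L1 (fun s => K (t - s) * u s)}.
Proof.
by move=> Lu; apply: aeS (conv_ae_fin Lu) => t; apply: fin_L1; case: Lu.
Qed.

(* Expand [0 <= \int K(t-s) (u s - x)^2 ds] at the mean [x]. *)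
Let conv_sqr_le u t : 0 < kappa -> measurable_fun setT u ->
  ((conv K u t ^+ 2)%:E <= kappa%:E * \int[mu]_s (K (t - s) * u s ^+ 2)%:E)%E.
Proof.
move=> k0 mu_.
have [h|] := ltP (\int[mu]_s (K (t - s) * u s ^+ 2)%:E)%E +oo%E; last first.
  by rewrite leye_eq => /eqP ->; rewrite gt0_muley// leey.
have I1 := fin_L1 mu_ h; have I2 := fin_L1sqr mu_ h.
have -> : (\int[mu]_s (K (t - s) * u s ^+ 2)%:E =
    (\int[mu]_s (K (t - s) * u s ^+ 2))%:E)%E.
  by rewrite /Rintegral fineK//; exact: (integrable_fin_num _ I2).
rewrite -EFinM lee_fin.
set J := \int[mu]_s _; set x := conv K u t / kappa.
have kE : \int[mu]_s K (t - s) = kappa by rewrite Rintegral_reflect.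
have : 0 <= \int[mu]_s (K (t - s) * (u s - x) ^+ 2).
  by apply: Rintegral_ge0 => s _; rewrite mulr_ge0// sqr_ge0.
have -> : \int[mu]_s (K (t - s) * (u s - x) ^+ 2) =
    \int[mu]_s (K (t - s) * u s ^+ 2
      - (2 * x * (K (t - s) * u s) - x ^+ 2 * K (t - s))).
  by apply: eq_Rintegral => s _; ring.
rewrite RintegralB//; last first.
  by apply: L1B; apply: L1Z => //; exact: L1K.
rewrite RintegralB//; [|exact: L1Z|by apply: L1Z; exact: L1K].
rewrite !RintegralZl//; last exact: L1K.
rewrite kE -/(conv K u t) -/J.
have -> : J - (2 * x * conv K u t - x ^+ 2 * kappa) = J - conv K u t ^+ 2 / kappa.
  by rewrite /x; field; rewrite gt_eqF.
by rewrite subr_ge0 ler_pdivrMr// mulrC.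
Qed.

(** One factor [kappa] comes from the pointwise Cauchy-Schwarz inequality for the weight K(t-s) ds,
    the other from Tonelli. *)
Lemma young u : 0 < kappa -> measurable_fun setT u ->
  (nsq (conv K u) <= (kappa ^+ 2)%:E * nsq u)%E.
Proof.
move=> k0 mu_.
have mf : measurable_fun setT (fun t => \int[mu]_s (K (t - s) * u s ^+ 2)%:E)%E.
  apply: (@measurable_fun_fubini_tonelli_F _ _ _ _ _ mu
    (fun z : R * R => (K (z.1 - z.2) * u z.2 ^+ 2)%:E)).
    apply/measurable_EFinP.
    exact: (measurable_conv_kernel mK (measurable_funX 2 mu_)).
  by move=> z; rewrite lee_fin mulr_ge0// sqr_ge0.
have f0 t : (0 <= \int[mu]_s (K (t - s) * u s ^+ 2)%:E)%E.
  by apply: integral_ge0 => s _; rewrite lee_fin mulr_ge0// sqr_ge0.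
apply: (@le_trans _ _
    (\int[mu]_t (kappa%:E * \int[mu]_s (K (t - s) * u s ^+ 2)%:E))%E).
  apply: ge0_le_integral => //.
  - by move=> x _; rewrite lee_fin sqr_ge0.
  - by apply: measurable_sqr; exact: measurable_conv.
  - exact: measurable_funeM.
  - by move=> t _; exact: conv_sqr_le.
by rewrite ge0_integralZl// conv_tonelli// muleA -EFinM expr2.
Qed.

Lemma L2_conv u : 0 < kappa -> L2 u -> L2 (conv K u).
Proof.
move=> k0 [mu_ fu]; split; first exact: measurable_conv.
by rewrite (le_lt_trans (young k0 mu_))// lte_mul_pinfty// lee_fin sqr_ge0.
Qed.

Lemma cvg2_conv (u_ : nat -> R -> R) u : 0 < kappa -> (forall n, L2 (u_ n)) ->
  L2 u -> cvg2 u_ u -> cvg2 (fun n => conv K (u_ n)) (conv K u).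
Proof.
move=> k0 Lu_ Lu cu.
apply: (@cvg2_squeeze _ _ _ (fun n => (kappa ^+ 2)%:E * nsq (u_ n \- u)%R)%E).
  move=> n; have [m_ _] := Lu_ n; have [m _] := Lu.
  (* The convolution is additive in its second argument only at points where both integrals
     converge, hence only almost everywhere. *)
  rewrite (_ : nsq _ = nsq (conv K (u_ n \- u))); last first.
    apply: eq_nsq_ae.
    - by apply: measurable_funB; exact: measurable_conv.
    - by apply: measurable_conv => //; exact: measurable_funB.
    apply: aeS (aeI (conv_ae_L1 (Lu_ n)) (conv_ae_L1 Lu)) => t [I1 I2] /=.
    rewrite /conv -RintegralB//.
    by apply: eq_Rintegral => s _ /=; ring.
  by apply: young => //; exact: measurable_funB.
by rewrite -(mule0 (kappa ^+ 2)%:E); apply: cvgeZl.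
Qed.

End Young.

End Convolution.

(** * The Hartley transform *)

Section Hartley.
Context {R : realType}.
Local Notation mu := (@lebesgue_measure R).
Implicit Types (f g h u v k : R -> R) (x t s a b e N : R).

Definition cas x : R := cos x + sin x.

Lemma normr_cas x : `|cas x| <= 2.
Proof.
by rewrite (le_trans (ler_normD _ _))// -[2]/(1 + 1) lerD ?cos_max ?sin_max.
Qed.

Lemma continuous_sin' : continuous (@sin R).
Proof. by move=> x; exact: (isd_cont (is_derive_sin x)). Qed.

Lemma continuous_cos' : continuous (@cos R).
Proof. by move=> x; exact: (isd_cont (is_derive_cos x)). Qed.

Lemma measurable_cos : measurable_fun setT (@cos R).
Proof. exact: continuous_measurable_fun continuous_cos'. Qed.

Lemma measurable_sin : measurable_fun setT (@sin R).
Proof. exact: continuous_measurable_fun continuous_sin'. Qed.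

Lemma measurable_cas : measurable_fun setT cas.
Proof. by apply: measurable_funD; [exact: measurable_cos|exact: measurable_sin]. Qed.

Definition casM (z : R * R) : R := cas (z.1 * z.2).

Lemma measurable_prod2 : measurable_fun setT (fun z : R * R => z.1 * z.2).
Proof. exact: measurable_funM. Qed.

Lemma measurable_casM : measurable_fun setT casM.
Proof. exact: (measurableT_comp measurable_cas measurable_prod2). Qed.

Lemma normr_casM z : `|casM z| <= 2. Proof. exact: normr_cas. Qed.

Lemma cas_mul x s t :
  cas (x * s) * cas (x * t) = cos (x * (t - s)) + sin (x * (t + s)).
Proof. by rewrite /cas (mulrBr x t s) (mulrDr x t s) cosB sinD; ring. Qed.

Definition hc : R := (Num.sqrt (2 * pi))^-1.

Lemma hc_sqr : hc ^+ 2 = (2 * pi)^-1.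
Proof. by rewrite /hc exprVn sqr_sqrtr// mulr_ge0// pi_ge0. Qed.

Definition hart f x : R := hc * \int[mu]_y (casM (x, y) * f y).

Lemma L1_casM f x : L1 f -> L1 (fun y => casM (x, y) * f y).
Proof. exact: (L1_slice x measurable_casM normr_casM). Qed.

Lemma measurable_hart f : measurable_fun setT f -> measurable_fun setT (hart f).
Proof.
move=> mf; apply: measurable_funM => //.
apply: (@measurable_Rintegral_slice _ (fun z => casM z * f z.2)).
by apply: measurable_funM; [exact: measurable_casM|exact: measurableT_comp].
Qed.

Lemma hartB f g : L1 f -> L1 g -> hart (f \- g) = hart f \- hart g.
Proof.
move=> If Ig; apply/funext => x; rewrite /hart /= -mulrBr -RintegralB//;
  try exact: L1_casM.
by congr (_ * _); apply: eq_Rintegral => y _ /=; rewrite mulrBr.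
Qed.

Lemma hart_pair f g : L1 f -> L1 g ->
  \int[mu]_x (f x * hart g x) = \int[mu]_x (hart f x * g x).
Proof.
move=> If Ig.
have E : \int[mu]_x (f x * hart g x) =
    hc * \int[mu]_x (f x * \int[mu]_y (casM (x, y) * g y)).
  rewrite -RintegralZl//; first by apply: eq_Rintegral => x _; rewrite /hart; ring.
  exact: (L1_kernel measurable_casM normr_casM).
rewrite E (Fubini_kernel measurable_casM normr_casM If Ig).
have S y : \int[mu]_x (casM (x, y) * f x) = \int[mu]_x (casM (y, x) * f x).
  by apply: eq_Rintegral => x _; rewrite /casM/= (mulrC x).
under eq_Rintegral do rewrite S.
rewrite -RintegralZl//; last exact: (L1_kernel measurable_casM normr_casM).
by apply: eq_Rintegral => y _; rewrite /hart; ring.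
Qed.

(** The self-adjointness [hart_pair], used twice, moves both transforms off [f]. What remains
    between f(t) and f(s) is hc^2 times the integral of cas(x s) cas(x t) e^(-e|x|), that is the
    Poisson kernel at t - s. The weight makes all these integrals absolutely convergent. *)
Lemma hart_wsq f e : 0 < e -> L1 f ->
  \int[mu]_x (hart f x ^+ 2 * expw e x) = \int[mu]_t (f t * conv (poisson e) f t).
Proof.
move=> e0 If.
have Iw := L1_expw e0.
have Iwc t : L1 (fun x => casM (t, x) * expw e x) by exact: L1_casM.
have Iwh : L1 (fun x => expw e x * hart f x).
  have := L1Z hc (L1_kernel measurable_casM normr_casM Iw If).
  by apply: eq_integrable => // x _ /=; rewrite /hart; congr EFin; ring.
transitivity (\int[mu]_x ((fun y => expw e y * hart f y) x * hart f x)).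
  by apply: eq_Rintegral => x _; ring.
rewrite hart_pair//; apply: eq_Rintegral => t _; rewrite mulrC; congr (_ * _).
transitivity (hc * \int[mu]_x ((fun y => casM (t, y) * expw e y) x * hart f x)).
  by congr (_ * _); apply: eq_Rintegral => x _; rewrite mulrA.
rewrite hart_pair//.
rewrite -RintegralZl//; last first.
  have := L1Z hc (L1_kernel measurable_casM normr_casM If (Iwc t)).
  by apply: eq_integrable => // x _ /=; rewrite /hart; congr EFin; ring.
apply: eq_Rintegral => s _; rewrite /hart mulrA mulrA -expr2 hc_sqr.
congr (_ * _).
have -> : \int[mu]_x (casM (s, x) * (casM (t, x) * expw e x)) =
    \int[mu]_x ((cos (x * (t - s)) + sin (x * (t + s))) * expw e x).
  apply: eq_Rintegral => x _; rewrite mulrA /casM/=.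
  by rewrite (mulrC s) (mulrC t) cas_mul.
rewrite Rintegral_expw_trig// /poisson.
have := lt0r_neq0 (sqr_pos (t - s) e0); have := lt0r_neq0 (@pi_gt0 R).
by move: (@pi R) => p p0 n0; field; rewrite p0 n0.
Qed.

Lemma L1_poisson e : 0 < e -> L1 (poisson e : R -> R).
Proof.
move=> e0; apply/integrableP; split.
  by apply/measurable_EFinP; exact: measurable_poisson.
rewrite (_ : (\int[mu]_x `|(EFin \o poisson e) x|)%E =
    (\int[mu]_x (poisson e x)%:E)%E); first by rewrite integral_poisson// ltry.
by apply: eq_integral => x _ /=; rewrite ger0_norm// poisson_ge0.
Qed.

Lemma Rintegral_poisson e : 0 < e -> \int[mu]_x poisson e x = 1.
Proof. by move=> e0; rewrite /Rintegral integral_poisson. Qed.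

(** From 2 f g <= f^2 + g^2 with g the Poisson mean of [f]: since the Poisson kernel has mass 1,
    Young's inequality bounds the norm of g by that of [f]. *)
Lemma hart_wsq_le f e : 0 < e -> L1 f -> L2 f ->
  \int[mu]_x (hart f x ^+ 2 * expw e x) <= \int[mu]_x (f x ^+ 2).
Proof.
move=> e0 If Lf; rewrite hart_wsq//.
have k0 : 0 < \int[mu]_x poisson e x by rewrite Rintegral_poisson.
have Lc := L2_conv (L1_poisson e0) (fun z : R => poisson_ge0 z e0) k0 Lf.
have := young (L1_poisson e0) (fun z : R => poisson_ge0 z e0) k0 Lf.1.
rewrite Rintegral_poisson// expr1n mul1e (nsqE Lc) (nsqE Lf) lee_fin => hle.
suff : 2 * \int[mu]_t (f t * conv (poisson e) f t) <=
    \int[mu]_x (f x ^+ 2) + \int[mu]_x (conv (poisson e) f x ^+ 2) by lra.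
rewrite -RintegralZl//; last exact: L2M.
rewrite -RintegralD//; try exact: L2_sqr.
apply: le_Rintegral => //.
- by apply: L1Z; exact: L2M.
- by apply: L1D; exact: L2_sqr.
move=> x _; set c := conv _ _ _.
by have := sqr_ge0 (f x - c); nra.
Qed.

Lemma expw_cvg x : (fun n => expw n.+1%:R^-1 x) @ \oo --> (1 : R).
Proof.
rewrite -[X in _ --> X](@expR0 R).
apply: (@continuous_cvg _ _ _ _ _ (fun n : nat => - (n.+1%:R^-1 * `|x|)) expR).
  exact: continuous_expR.
rewrite -[X in _ --> X]oppr0; apply: cvgN.
rewrite -[X in _ --> X](mul0r `|x|); apply: cvgMl.
exact: cvg_harmonic.
Qed.

Lemma expw_le1 e x : 0 < e -> expw e x <= 1.
Proof. by move=> e0; rewrite -expR0 ler_expR oppr_le0 mulr_ge0// ltW. Qed.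

Lemma normr_hart f x : L1 f -> `|hart f x| <= hc * (2 * \int[mu]_y `|f y|).
Proof.
move=> If; have h0 : 0 <= hc by rewrite invr_ge0 sqrtr_ge0.
rewrite normrM (ger0_norm h0) ler_wpM2l//.
have I1 := L1_casM x If.
rewrite (le_trans (le_normr_Rintegral _ I1))// -RintegralZl//; last exact: L1_norm.
apply: le_Rintegral => //; first exact: L1_norm.
  by apply: L1Z; exact: L1_norm.
by move=> y _; rewrite normrM ler_wpM2r// normr_casM.
Qed.

Lemma L1_hart_wsq f e : 0 < e -> L1 f -> L1 (fun x => hart f x ^+ 2 * expw e x).
Proof.
move=> e0 If; pose B := hc * (2 * \int[mu]_y `|f y|).
apply: (@L1Mb _ (fun x => hart f x ^+ 2) (B ^+ 2)); last exact: L1_expw.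
  by apply: measurable_funX; apply: measurable_hart; exact: L1_meas.
move=> x; rewrite normrX lerXn2r ?nnegrE//; last exact: normr_hart.
exact: (le_trans _ (normr_hart x If)).
Qed.

Lemma nsq_hart_le f : L1 f -> L2 f -> (nsq (hart f) <= nsq f)%E.
Proof.
move=> If Lf.
have e0 n : 0 < (n.+1%:R : R)^-1 by rewrite invr_gt0.
have mh := measurable_hart (L1_meas If).
apply: (@le_integral_of_cvg _ (fun n x => hart f x ^+ 2 * expw n.+1%:R^-1 x)).
- move=> n; apply: measurable_funM; last exact: measurable_expw.
  exact: measurable_funX.
- by move=> n x; rewrite mulr_ge0 ?sqr_ge0// expw_ge0.
- move=> x; rewrite -[X in _ --> X](mulr1 (hart f x ^+ 2)); apply: cvgMr.
  exact: expw_cvg.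
move=> n; have I := L1_hart_wsq (e0 n) If.
rewrite (nsqE Lf) -(@fineK _ (\int[mu]_x _)%E); last exact: (integrable_fin_num _ I).
by rewrite lee_fin; exact: hart_wsq_le.
Qed.

Lemma L2_hart f : L1 f -> L2 f -> L2 (hart f).
Proof.
move=> If Lf; split; first by apply: measurable_hart; exact: L1_meas.
by rewrite (le_lt_trans (nsq_hart_le If Lf))//; case: Lf.
Qed.

(** * Indicators of intervals, truncation, and the transform on L^2 *)

Definition ind a b x : R := \1_(`[a, b]%classic : set R) x.

Lemma indE a b x : ind a b x = if a <= x <= b then 1 else 0.
Proof. by rewrite /ind indicE mem_setE in_itv/=; case: ifP. Qed.

Lemma measurable_ind a b : measurable_fun setT (ind a b).
Proof. exact: measurable_indic. Qed.

Lemma L1_ind a b : L1 (ind a b).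
Proof. exact: integrable_indic_itv. Qed.

Lemma ind_sqr a b x : ind a b x ^+ 2 = ind a b x.
Proof. by rewrite indE; case: ifP; rewrite ?expr1n ?expr0n. Qed.

Lemma Rintegral_ind a b : a <= b -> \int[mu]_x ind a b x = b - a.
Proof.
move=> ab; rewrite /Rintegral /ind integral_indic// setIT.
transitivity (fine (lebesgue_measure (`[a, b]%classic : set R))); first by [].
rewrite lebesgue_measure_itv/= lte_fin; case: ltP => // ba.
by rewrite /=; apply/esym/eqP; rewrite subr_eq0 eq_le ab ba.
Qed.

Lemma L2_ind a b : L2 (ind a b).
Proof.
split; first exact: measurable_ind.
rewrite /nsq; under eq_integral do rewrite ind_sqr.
have /integrableP[_] := L1_ind a b; apply: le_lt_trans.
by apply: ge0_le_integral => //;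
  [move=> x _; rewrite lee_fin indE; case: ifP
  |apply/measurable_EFinP; exact: measurable_ind
  |apply: measurableT_comp => //; apply/measurable_EFinP; exact: measurable_ind
  |move=> x _; rewrite /= lee_fin ler_norm].
Qed.

Definition trunc N u x : R := ind (- N) N x * u x.

Lemma L1_trunc N u : L2 u -> L1 (trunc N u).
Proof. by move=> Lu; apply: L2M => //; exact: L2_ind. Qed.

Lemma normr_ind a b x : `|ind a b x| <= 1.
Proof. by rewrite indE; case: ifP; rewrite ?normr1 ?normr0. Qed.

Lemma L2_trunc N u : L2 u -> L2 (trunc N u).
Proof. by apply: (L2Mb (measurable_ind _ _) (normr_ind _ _)). Qed.

Lemma trunc_cvg2 u : L2 u -> cvg2 (fun n => trunc n%:R u) u.
Proof.
move=> Lu; have mu_ := Lu.1.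
have D := @dominated_convergence _ _ _ mu setT measurableT
  (fun n x => ((trunc n%:R u x - u x) ^+ 2)%:E) (cst 0%E)
  (fun x => (u x ^+ 2)%:E).
have : [/\ mu.-integrable setT (cst 0%E), _ & _] := D _ _ _ _ _.
case => //.
- move=> n; apply: measurable_sqr; apply: measurable_funB => //.
  by case: (L2_trunc n%:R Lu).
- apply: aeW => x _; apply: cvg_near_cst; near=> n.
  rewrite /trunc indE ifT ?mul1r ?subrr ?expr0n//.
  rewrite -ler_norml; near: n; exact: nbhs_infty_ger.
- exact: L2_sqr.
- apply: aeW => x n _; rewrite lee_fin /trunc indE.
  case: ifP => _; rewrite ?mul1r ?subrr ?expr0n ?normr0 ?sqr_ge0//=.
  by rewrite mul0r sub0r sqrrN ger0_norm// sqr_ge0.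
by rewrite integral0.
Unshelve. all: by end_near. Qed.

Definition HT N u := hart (trunc N u).

Lemma L2_HT N u : L2 u -> L2 (HT N u).
Proof. by move=> Lu; apply: L2_hart; [exact: L1_trunc|exact: L2_trunc]. Qed.

Lemma HT_pair N u v : L2 u -> L1 v ->
  \int[mu]_x (HT N u x * v x) = \int[mu]_x (trunc N u x * hart v x).
Proof. by move=> Lu Lv; rewrite hart_pair//; exact: L1_trunc. Qed.

(** The truncations of [u] form a Cauchy sequence in L^2, and the Bessel inequality applied to their
    differences carries this over to the transforms. *)
Lemma HT_exists u : L2 u -> exists2 h, L2 h & cvg2 (fun n => HT n%:R u) h.
Proof.
move=> Lu; apply: L2_complete; first by move=> n; exact: L2_HT.
move=> e e0; have e4 : 0 < e / 4 by rewrite divr_gt0.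
have /fine_cvgP[_ /cvgrPdist_le /(_ _ e4)[M _ HM]] := trunc_cvg2 Lu.
exists M => m n Mm Mn.
rewrite /HT -hartB; [|exact: L1_trunc..].
have Lm := L2_trunc m%:R Lu; have Ln := L2_trunc n%:R Lu.
apply: (le_trans (nsq_hart_le _ _)).
- by apply: L1B; exact: L1_trunc.
- exact: L2B.
apply: (le_trans (nsqB3 Lm.1 Lu.1 Ln.1)).
have h (k : nat) : (M <= k)%N -> (nsq (trunc k%:R u \- u)%R <= (e / 4)%:E)%E.
  move=> Mk; have := HM _ Mk; rewrite /= sub0r normrN => hk.
  have Lk := L2B (L2_trunc k%:R Lu) Lu.
  by rewrite -(@fineK _ (nsq _)) ?lee_fin; [rewrite (le_trans (ler_norm _))
    |rewrite ge0_fin_numE ?nsq_ge0//; case: Lk].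
rewrite (nsqBC u).
apply: (@le_trans _ _ (2%:E * (e / 4)%:E + 2%:E * (e / 4)%:E)%E).
  by apply: leeD; apply: lee_wpmul2l => //; exact: h.
by rewrite -!EFinM -EFinD lee_fin; lra.
Qed.

Lemma L1_sub_nsq u N : L2 u -> \int[mu]_x (trunc N u x * u x) =
  \int[mu]_x (trunc N u x ^+ 2).
Proof.
move=> Lu; apply: eq_Rintegral => x _.
by rewrite /trunc exprMn ind_sqr -mulrA -expr2.
Qed.

(** * Norm equality and inversion for indicators *)

Lemma cvg_atan_scaled x : 0 < x ->
  (fun n => pi^-1 * atan (n.+1%:R^-1^-1 * x)) @ \oo --> (2^-1 : R).
Proof.
move=> x0; have p0 := @pi_gt0 R.
have -> : 2^-1 = pi^-1 * (pi / 2) :> R.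
  by move: (gt_eqF p0); move: (@pi R) => p np; field; rewrite np.
apply: cvgMr; apply: (cvg_comp _ _ _ (@cvgy_atan R)).
apply/cvgryPge => A; near=> n; rewrite invrK -ler_pdivrMr//.
rewrite (@le_trans _ _ n%:R)// ?ler_nat//.
by near: n; exact: nbhs_infty_ger.
Unshelve. all: by end_near. Qed.

Lemma normr_atan_pi x : `|pi^-1 * atan x| <= 2^-1.
Proof.
have p0 := @pi_gt0 R.
rewrite normrM gtr0_norm ?invr_gt0// ler_pdivrMl// ler_norml.
by rewrite (ltW (atan_gtNpi2 x)) (ltW (atan_ltpi2 x)).
Qed.

(** As e = 1/(n+1) tends to 0, the Poisson means [q n] of the indicator tend to 1 inside (a, b), so
    \int f (q n) tends to b - a by dominated convergence with majorant [f]. By [hart_wsq] each of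
    these integrals is a weighted square integral of the transform, with weight at most 1. *)
Lemma hart_ind_ge a b : a < b -> ((b - a)%:E <= nsq (hart (ind a b)))%E.
Proof.
move=> ab; set f := ind a b; have If : L1 f := L1_ind a b.
have e0 n : 0 < (n.+1%:R : R)^-1 by rewrite invr_gt0.
pose q n t := pi^-1 * atan (n.+1%:R^-1^-1 * (t - a))
  - pi^-1 * atan (n.+1%:R^-1^-1 * (t - b)) : R.
have convE n t : conv (poisson n.+1%:R^-1) f t = q n t.
  rewrite /q -integral_poisson_itv// Rintegral_mkcond.
  apply: eq_Rintegral => s _; rewrite patch_indic /f /ind//.
have mq n : measurable_fun setT (q n).
  rewrite (_ : q n = conv (poisson n.+1%:R^-1) f); last exact/esym/funext/convE.
  by apply: measurable_conv; [exact: measurable_poisson|exact: L1_meas].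
have D := @dominated_convergence _ _ _ mu setT measurableT
  (fun n t => (f t * q n t)%:E) (EFin \o f) (EFin \o f).
have : [/\ mu.-integrable setT (EFin \o f), _ & _] := D _ _ _ _ _.
case => //.
- move=> n; apply/measurable_EFinP.
  by apply: measurable_funM; [exact: L1_meas|exact: mq].
- exact: (measurable_int _ If).
(* At the two endpoints the Poisson means tend to 1/2 instead of 1, so these points are
   discarded. *)
- have nab c : {ae mu, forall x, x <> c}.
    exists [set c]; split => //; first exact: lebesgue_measure_set1.
    by move=> x /= /contrapT.
  apply: aeS (aeI (nab a) (nab b)) => x [xa xb] _.
  rewrite /= /f indE; apply: cvg_EFin; first exact: nearW.
  rewrite /comp/=; case: ifP => [/andP[ax xb']|_]; last first.
    by under eq_cvg do rewrite mul0r; exact: cvg_cst.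
  under eq_cvg do rewrite mul1r.
  have -> : 1 = 2^-1 - - 2^-1 :> R by field.
  apply: cvgB.
    apply: cvg_atan_scaled; rewrite subr_gt0 lt_neqAle ax andbT.
    by apply/eqP => /esym.
  under eq_cvg do rewrite -opprB mulrN atanN mulrN.
  apply: cvgN; apply: cvg_atan_scaled; rewrite subr_gt0 lt_neqAle xb' andbT.
  exact/eqP.
- apply: aeW => x n _; rewrite /= lee_fin /f indE; case: ifP => _; last first.
    by rewrite mul0r normr0.
  rewrite mul1r (le_trans (ler_normB _ _))//.
  by rewrite (splitr 1) mul1r lerD// normr_atan_pi.
move=> _ _ cv.
have E : (\int[mu]_x (EFin \o f) x = (b - a)%:E)%E.
  rewrite -(Rintegral_ind (ltW ab)) /Rintegral fineK//.
  exact: (integrable_fin_num _ If).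
rewrite E in cv.
rewrite -(cvg_lim (@ereal_hausdorff R) cv).
apply: lime_le; first by apply/cvg_ex; eexists; exact: cv.
apply: nearW => n /=.
have -> : (\int[mu]_x (f x * q n x)%:E =
    \int[mu]_x (hart f x ^+ 2 * expw n.+1%:R^-1 x)%:E)%E.
  have I1 : L1 (fun x => f x * q n x).
    have Lf : L2 f := L2_ind a b.
    have Lc : L2 (q n).
      have k0 : 0 < \int[mu]_x poisson (n.+1%:R)^-1 x by rewrite Rintegral_poisson.
      have := L2_conv (L1_poisson (e0 n)) (fun z : R => poisson_ge0 z (e0 n)) k0 Lf.
      by rewrite (_ : conv _ _ = q n)//; apply/funext => t; exact: convE.
    exact: L2M.
  have I2 := L1_hart_wsq (e0 n) If.
  rewrite -[LHS](@fineK _) ?(integrable_fin_num _ I1)//.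
  rewrite -[RHS](@fineK _) ?(integrable_fin_num _ I2)//.
  congr EFin; rewrite -[RHS]/(Rintegral _ _ _) hart_wsq//.
  by apply: eq_Rintegral => t _; rewrite convE.
have mh := measurable_hart (L1_meas If).
apply: ge0_le_integral => //.
- by move=> x _; rewrite lee_fin mulr_ge0 ?sqr_ge0// expw_ge0.
- apply/measurable_EFinP; apply: measurable_funM; last exact: measurable_expw.
  exact: measurable_funX.
- exact: measurable_sqr.
by move=> x _; rewrite lee_fin ler_piMr ?sqr_ge0// expw_le1.
Qed.

(* Expand the square: Bessel on one side, [hart_ind_ge] on the other. *)
Lemma HT_hart_ind a b : a < b ->
  cvg2 (fun n => HT n%:R (hart (ind a b))) (ind a b).
Proof.
move=> ab; set f := ind a b; set k := hart f.
have If : L1 f := L1_ind a b; have Lf : L2 f := L2_ind a b.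
have Lk : L2 k by exact: L2_hart.
have fE : \int[mu]_x (f x ^+ 2) = b - a.
  by under eq_Rintegral do rewrite ind_sqr; exact: Rintegral_ind (ltW ab).
apply: (cvg2_squeeze _ (trunc_cvg2 Lk)) => n.
have Lt := L2_trunc n%:R Lk; have Lh := L2_HT n%:R Lk.
rewrite (nsqE (L2B Lh Lf)) (nsqE (L2B Lt Lk)) lee_fin.
have sq2 (u v : R -> R) : L2 u -> L2 v -> \int[mu]_x ((u \- v) x ^+ 2) =
    \int[mu]_x (u x ^+ 2) - 2 * \int[mu]_x (u x * v x) + \int[mu]_x (v x ^+ 2).
  move=> Lu Lv; rewrite -RintegralZl//; last exact: L2M.
  rewrite -RintegralB//; [|exact: L2_sqr|by apply: L1Z; exact: L2M].
  rewrite -RintegralD//; [|by apply: L1B; [exact: L2_sqr|apply: L1Z; exact: L2M]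
    |exact: L2_sqr].
  by apply: eq_Rintegral => x _ /=; ring.
(* By duality the cross term \int (HT_n k) f equals \int (trunc_n k) k, which is the square integral
   of trunc_n k. The comparison of the two expanded squares thus splits into the two inequalities
   below. *)
rewrite !sq2// fE (HT_pair _ Lk If) -/k L1_sub_nsq//.
have : \int[mu]_x (HT n%:R k x ^+ 2) <= \int[mu]_x (trunc n%:R k x ^+ 2).
  rewrite -lee_fin -(nsqE Lh) -(nsqE Lt); apply: nsq_hart_le => //.
  exact: L1_trunc.
have : b - a <= \int[mu]_x (k x ^+ 2).
  by rewrite -lee_fin -(nsqE Lk); exact: hart_ind_ge.
move: (Rintegral _ _ _) (Rintegral _ _ _) (Rintegral _ _ _) => A B D; lra.
Qed.

(** The primitive of [u] starting at -n vanishes identically, while by Lebesgue differentiation its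
    derivative is [u] at almost every point to the right of -n. Countably many n cover the line. *)
Lemma ae_eq0_of_ind u : L2 u ->
  (forall a b, a < b -> \int[mu]_x (u x * ind a b x) = 0) ->
  {ae mu, forall x, u x = 0}.
Proof.
move=> Lu u0.
have Iitv a b : mu.-integrable `[a, b] (EFin \o u).
  have := L2M Lu (L2_ind a b).
  rewrite /L1 (_ : EFin \o _ = (EFin \o u) \_ `[a, b]); last first.
    by rewrite restrict_EFin patch_indic.
  by rewrite -integrable_mkcond.
have loc : locally_integrable setT u.
  split; [exact: Lu.1|exact: openT|] => K _ cK.
  have [M [_ HM]] := compact_bounded cK.
  have sub : K `<=` `[- (`|M| + 1), `|M| + 1]%classic.
    move=> x Kx; rewrite /= in_itv/= -ler_norml; apply: HM => //.
    by rewrite (le_lt_trans (ler_norm M))// ltrDl.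
  have mK := compact_measurable cK.
  have I2 : mu.-integrable K (EFin \o u).
    by apply: integrableS (Iitv (- (`|M| + 1)) (`|M| + 1)).
  by have /integrableP[_] := I2.
have H n : {ae mu, forall x, - n%:R < x -> u x = 0}.
  have := @FTC1 R u (BLeft (- n%:R)) (fun y => Iitv _ _) loc.
  apply: aeS => x + nx.
  move=> H; have [|_] := H; first by rewrite /= lte_fin.
  have -> : (fun y => \int[mu]_(t in `[(- n%:R)%R, y]) u t) = cst 0.
    apply/funext => y /=.
    have [ny|ny] := ltP (- n%:R) y.
      rewrite Rintegral_mkcond -[RHS](u0 _ _ ny); apply: eq_Rintegral => t _.
      by rewrite patch_indic.
    have [->|ne] := eqVneq (- n%:R) y; first by rewrite set_itv1 Rintegral_set1.
    by rewrite set_itv_ge ?Rintegral_set0// -leNgt// bnd_simp lt_neqAle eq_sym ne.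
  by rewrite derive1_cst => /esym.
have : {ae mu, forall x, forall n : nat, - n%:R < x -> u x = 0}.
  exact: ae_foralln.
apply: aeS => x /(_ (Num.bound `|x|)); apply.
by rewrite ltrNl (le_lt_trans _ (archi_boundP (normr_ge0 x)))// -normrN ler_norm.
Qed.

(** Let v be the limit of the transforms of [h]. For an indicator f with transform k, both \int v f
    and \int u f equal \int h k: the first by duality, the second because f is recovered from k by
    [HT_hart_ind]. Hence v - u is orthogonal to all indicators. *)
Theorem HT_inversion u h : L2 u -> L2 h -> cvg2 (fun n => HT n%:R u) h ->
  cvg2 (fun n => HT n%:R h) u.
Proof.
move=> Lu Lh ch; have [v Lv cv] := HT_exists Lh.
have LHu n := L2_HT n%:R Lu; have LHh n := L2_HT n%:R Lh.
suff uv : {ae mu, forall x, v x = u x}.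
  rewrite /cvg2 (_ : (fun n => _) = (fun n => nsq (HT n%:R h \- v)))//.
  apply/funext => n; apply: eq_nsq_ae.
  - by apply: measurable_funB; [case: (LHh n)|case: Lu].
  - by apply: measurable_funB; [case: (LHh n)|case: Lv].
  by apply: aeS uv => x /= ->.
suff : {ae mu, forall x, (v \- u) x = 0}.
  by apply: aeS => x /= /eqP; rewrite subr_eq0 => /eqP.
apply: ae_eq0_of_ind; first exact: L2B.
move=> a b ab; set f := ind a b; set k := hart f.
have If : L1 f := L1_ind a b; have Lf : L2 f := L2_ind a b.
have Lk : L2 k by exact: L2_hart.
have Ev : \int[mu]_x (v x * f x) = \int[mu]_x (h x * k x).
  have c1 := cvg2_pairing LHh Lv Lf cv.
  have c2 := cvg2_pairing (fun n => L2_trunc n%:R Lh) Lh Lk (trunc_cvg2 Lh).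
  apply: (cvg_unique _ c1) => //; apply: cvg_trans c2.
  by apply: near_eq_cvg; apply: nearW => n; rewrite HT_pair.
(* Two limits are taken in turn: for a fixed truncation m of k, the truncation n of [u] is removed,
   which gives [E]; only then does m tend to infinity. *)
have Eu : \int[mu]_x (f x * u x) = \int[mu]_x (k x * h x).
  have c1 := cvg2_pairing (fun n => L2_HT n%:R Lk) Lf Lu (HT_hart_ind ab).
  have c2 := cvg2_pairing (fun n => L2_trunc n%:R Lk) Lk Lh (trunc_cvg2 Lk).
  apply: (cvg_unique _ c1) => //; apply: cvg_trans c2.
  apply: near_eq_cvg; apply: nearW => m.
  have LHk := L2_HT m%:R Lk; have Lt := L2_trunc m%:R Lk.
  have d1 := cvg2_pairing (fun n => L2_trunc n%:R Lu) Lu LHk (trunc_cvg2 Lu).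
  have d2 := cvg2_pairing LHu Lh Lt ch.
  have E : \int[mu]_x (u x * HT m%:R k x) = \int[mu]_x (h x * trunc m%:R k x).
    apply: (cvg_unique _ d1) => //; apply: cvg_trans d2.
    apply: near_eq_cvg; apply: nearW => n.
    exact: (HT_pair n%:R Lu (L1_trunc m%:R Lk)).
  under eq_Rintegral do rewrite mulrC.
  by rewrite -E; apply: eq_Rintegral => x _; rewrite mulrC.
under eq_Rintegral do rewrite /= mulrBl.
rewrite RintegralB//; [|exact: L2M..].
rewrite Ev; under [X in _ - X]eq_Rintegral do rewrite mulrC.
by rewrite Eu; apply/eqP; rewrite subr_eq0; apply/eqP; apply: eq_Rintegral => x _;
  rewrite mulrC.
Qed.

End Hartley.

(** * The Laplace transform of powers *)

Section GammaKernel.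
Context {R : realType}.
Local Notation mu := (@lebesgue_measure R).
Implicit Types (f F : R -> R) (x t p : R).

Definition scale (r x : R) : R := r * x.

Lemma measurable_scale (r : R) :
  measurable_fun setT (scale r : measurableTypeR R -> measurableTypeR R).
Proof. exact: measurable_funM. Qed.

(** The image of Lebesgue measure under x -> r x, multiplied by r, agrees with Lebesgue measure on
    half-open intervals. It serves the substitution u = rho t in the Gamma integral. *)
Lemma integral_scale (r : R) (f : R -> \bar R) : 0 < r ->
  measurable_fun setT f -> (forall x, 0 <= f x)%E ->
  (\int[mu]_x f (r * x)%R = (r^-1)%:E * \int[mu]_x f x)%E.
Proof.
move=> r0 mf f0.
pose pm : {measure set (measurableTypeR R) -> \bar R} :=
  measure_function_pushforward__canonical__measure_function_Measure
    mu (measurable_scale r).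
have pmE A : measurable A -> mu A = mscale (NngNum (ltW r0)) pm A.
  apply: lebesgue_measure_unique => _ [[s t] _ <-].
  have pre : scale r @^-1` `]s, t] = `]s / r, t / r]%classic.
    apply/seteqP; split => x; rewrite /scale /= !in_itv/=;
      by rewrite ltr_pdivrMr// ler_pdivlMr// (mulrC x).
  transitivity (r%:E * mu (scale r @^-1` `]s, t]))%E; last by [].
  rewrite pre !lebesgue_measure_itv/= !lte_fin ltr_pM2r ?invr_gt0//.
  case: ifP => _; last by rewrite mule0.
  by rewrite -!EFinB -EFinM; congr EFin; field; rewrite gt_eqF.
have := @ge0_integral_pushforward _ _ _ _ R _ (measurable_scale r) mu setT f
  measurableT mf (fun x _ => f0 x).
rewrite preimage_setT => /esym E; rewrite [LHS]E.
rewrite [in RHS](eq_measure_integral (mscale (NngNum (ltW r0)) pm)); last first.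
  by move=> A mA _; exact: pmE.
rewrite ge0_integral_mscale// muleA -EFinM mulVf ?gt_eqF// mul1e.
by [].
Qed.

Let mI : measurable (`]0%R, +oo[%classic : set (measurableTypeR R)).
Proof. exact: measurable_itv. Qed.

Lemma isd_powR p x : 0 < x ->
  is_derive x 1 (fun y : R => y `^ p) (p * x `^ (p - 1)).
Proof.
move=> x0; have xi : x \in `]0, +oo[ by rewrite in_itv/= x0.
apply: DeriveDef; first exact: derivable_powR.
by rewrite -derive1E powR_derive1.
Qed.

(** The integrals of [f] over [1/(n+2), n+2] are differences of values of the bounded primitive,
    hence at most 2 M; Fatou extends the bound to (0, oo). It supplies the integrability that
    [integral_FTC0y] assumes. *)
Lemma integrable_FTC0y f F (M : R) :
  (forall x, 0 < x -> is_derive x 1 F (f x)) ->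
  (forall x, 0 < x -> {for x, continuous f}) ->
  (forall x, 0 < x -> 0 <= f x) ->
  (forall x, 0 < x -> `|F x| <= M) ->
  mu.-integrable `]0, +oo[ (EFin \o f).
Proof.
move=> dF cf f0 FM.
pose a n : R := n.+2%:R^-1; pose b n : R := n.+2%:R.
have a0 n : 0 < a n by rewrite invr_gt0.
have b0 n : 0 < b n by [].
have ab n : a n < b n.
  apply: (@lt_trans _ _ 1); first by rewrite invf_lt1// ltr1n.
  by rewrite ltr1n.
have mf : measurable_fun (`]0%R, +oo[%classic : set R) f.
  apply: open_continuous_measurable_fun => // x.
  by rewrite inE/= in_itv/= andbT => /cf.
have sub n : `[a n, b n]%classic `<=` `]0, +oo[%classic.
  move=> x /=; rewrite !in_itv/= => /andP[h _]; rewrite andbT.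
  exact: lt_le_trans h.
apply/integrableP; split; first exact/measurable_EFinP.
apply: (@le_lt_trans _ _ (M + M)%:E); last exact: ltry.
rewrite integral_mkcond.
rewrite (_ : (\int[mu]_x _)%E = (\int[mu]_x ((f \_ `]0%R, +oo[) x)%:E)%E); last first.
  apply: eq_integral => x _; rewrite !patchE; case: ifPn => //.
  by rewrite inE/= in_itv/= andbT => /f0 h /=; rewrite ger0_norm.
apply: (@le_integral_of_cvg _ (fun n => f \_ `[a n, b n])).
- move=> n; apply/(measurable_restrictT _ _).1 => //.
  exact: measurable_funS (sub n) mf.
- move=> n x; rewrite patchE; case: ifPn => //; rewrite inE => /sub/=.
  by rewrite in_itv/= andbT; exact: f0.
- move=> x; rewrite patchE; case: ifPn; last first.
    move=> nx; apply: cvg_near_cst; apply: nearW => n; rewrite patchE ifN//.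
    by apply: contra nx; rewrite !inE; exact: sub.
  rewrite inE/= in_itv/= andbT => x0.
  apply: cvg_near_cst; near=> n; rewrite patchE mem_set//= in_itv/=.
  have : `|x| + x^-1 <= n%:R by near: n; exact: nbhs_infty_ger.
  have xi : 0 < x^-1 by rewrite invr_gt0.
  rewrite gtr0_norm// => h; apply/andP; split.
    rewrite /a -[leRHS]invrK lef_pV2 ?posrE//.
    apply: (le_trans (le_trans _ h)); first by rewrite lerDr ltW.
    by rewrite ler_nat ltnW.
  rewrite /b; apply: (le_trans (le_trans _ h)); first by rewrite lerDl ltW.
  by rewrite ler_nat ltnW.
move=> n.
have -> : (\int[mu]_x ((f \_ `[a n, b n]) x)%:E =
    (F (b n))%:E - (F (a n))%:E)%E.
  transitivity (\int[mu]_(x in `[a n, b n]) (f x)%:E)%E.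
    rewrite [RHS]integral_mkcond; apply: eq_integral => x _.
    by rewrite !patchE; case: ifP.
  apply: continuous_FTC2 => //.
  - apply: continuous_in_subspaceT => x; rewrite inE/= in_itv/= => /andP[h _].
    by apply: cf; exact: lt_le_trans h.
  - split.
    + move=> x; rewrite in_itv/= => /andP[h _].
      by have := dF x (lt_trans (a0 n) h) => d; exact: ex_derive.
    + by apply: cvg_at_right_filter; exact: (isd_cont (dF _ (a0 n))).
    + by apply: cvg_at_left_filter; exact: (isd_cont (dF _ (b0 n))).
  move=> x; rewrite in_itv/= => /andP[h _].
  exact: (isd_derive1 (dF _ (lt_trans (a0 n) h))).
rewrite -EFinB lee_fin (le_trans (ler_norm _))// (le_trans (ler_normB _ _))//.
by rewrite lerD// FM.
Unshelve. all: by end_near. Qed.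

Section FixedExponents.
Variables (alpha rho : R).
Hypotheses (alpha01 : 0 < alpha <= 1) (rho0 : 0 < rho).

Definition gker t := t `^ (alpha - 1) * expR (- (rho * t)).

Let a0 : 0 < alpha. Proof. by case/andP: alpha01. Qed.
Let a1 : alpha <= 1. Proof. by case/andP: alpha01. Qed.

Lemma gker_ge0 t : 0 <= gker t.
Proof. by rewrite mulr_ge0 ?powR_ge0 ?expR_ge0. Qed.

Lemma measurable_gker : measurable_fun setT gker.
Proof.
apply: measurable_funM; first exact: measurable_powR.
by apply: measurableT_comp => //; apply: measurableT_comp => //; exact: measurable_funM.
Qed.

(** From 1 + x <= e^x at x = r t / 2 one gets 1 + t <= (1 + 2/r) e^(r t / 2), then squares. It lets
    the exponential absorb polynomial growth. *)
Lemma sqr1D_expR (r t : R) : 0 < r -> 0 < t ->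
  (1 + t) ^+ 2 * expR (- (r * t)) <= (1 + 2 / r) ^+ 2.
Proof.
move=> r0 t0.
have e0 := expR_gt0 (r * t / 2).
have h : 1 + t <= (1 + 2 / r) * expR (r * t / 2).
  have := expR_ge1Dx (r * t / 2) => h.
  have i0 : 0 < 2 / r by rewrite divr_gt0.
  apply: (@le_trans _ _ ((1 + 2 / r) * (1 + r * t / 2))); last first.
    by rewrite ler_wpM2l//; lra.
  have -> : (1 + 2 / r) * (1 + r * t / 2) = 1 + t + (2 / r + r * t / 2).
    by field; rewrite gt_eqF.
  by rewrite lerDl addr_ge0// ?ltW// divr_gt0// mulr_gt0.
have -> : expR (- (r * t)) = (expR (r * t / 2) ^+ 2)^-1.
  by rewrite -expRM_natl -expRN; congr expR; field.
rewrite ler_pdivrMr ?exprn_gt0// -exprMn lerXn2r// nnegrE.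
  by lra.
by rewrite mulr_ge0 ?ltW//; have := divr_gt0 (ltr0n R 2) r0; lra.
Qed.

(* [(t/(1+t))^alpha / alpha] is a bounded primitive of
   [t^(alpha-1) (1+t)^(-alpha-1)]. *)
Lemma integrable_gker : mu.-integrable `]0, +oo[ (EFin \o gker).
Proof.
pose G t := (t / (1 + t)) `^ (alpha - 1) * ((1 + t)^-1) ^+ 2.
pose F t := alpha^-1 * (t / (1 + t)) `^ alpha.
have d1 t : 0 < t -> is_derive t 1 (fun y => y / (1 + y)) (((1 + t)^-1) ^+ 2).
  move=> t0.
  have n0 : 1 + t != 0 by rewrite gt_eqF// ltr_wpDr// ltW.
  have dd := isdD (isd_cst 1 t) (isd_id t).
  have di : is_derive t 1 (fun y => (1 + y)^-1) (- (1 + t) ^- 2 *: (0 + 1)).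
    exact: (@is_deriveV _ (fun y => 1 + y)).
  by apply: (isd_eq (isdM (isd_id t) di)); rewrite /GRing.scale/=; field.
have dF t : 0 < t -> is_derive t 1 F (G t).
  move=> t0; have q0 : 0 < t / (1 + t) by rewrite divr_gt0// ltr_wpDr// ltW.
  have := isdZ alpha^-1 (@isd_comp R (fun y => y `^ alpha) (fun y => y / (1 + y)) _ _ _
    (isd_powR alpha q0) (d1 t t0)).
  by move=> h; apply: (isd_eq h); rewrite /G -mulrA mulKf// gt_eqF.
have cG t : 0 < t -> {for t, continuous G}.
  move=> t0; have q0 : 0 < t / (1 + t) by rewrite divr_gt0// ltr_wpDr// ltW.
  have n0 : 1 + t != 0 by rewrite gt_eqF// ltr_wpDr// ltW.
  have h1 := @isd_comp R (fun y => y `^ (alpha - 1)) (fun y => y / (1 + y)) _ _ _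
    (isd_powR (alpha - 1) q0) (d1 t t0).
  have di : is_derive t 1 (fun y => (1 + y)^-1) (- (1 + t) ^- 2 *: (0 + 1)).
    have dd := isdD (isd_cst 1 t) (isd_id t).
    exact: (@is_deriveV _ (fun y => 1 + y)).
  exact: (isd_cont (isdM h1 (isdM di di))).
have IG : mu.-integrable `]0, +oo[ (EFin \o G).
  apply: (@integrable_FTC0y G F alpha^-1) => //.
    by move=> t t0; rewrite mulr_ge0 ?powR_ge0// exprn_ge0// invr_ge0; lra.
  move=> t t0; rewrite normrM gtr0_norm ?invr_gt0//.
  rewrite ger0_norm ?powR_ge0// ler_piMr//; first by rewrite invr_ge0 ltW.
  rewrite -[leRHS](@powRr0 R (t / (1 + t))); apply: ger_powR; last exact: ltW.
  rewrite divr_gt0//=; last lra.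
  by rewrite ler_pdivrMr; lra.
have := integrableZl mI ((1 + 2 / rho) ^+ 2) IG.
apply: le_integrable => //.
  by apply/measurable_EFinP; apply: measurable_funTS; exact: measurable_gker.
move=> t; rewrite /= in_itv/= andbT => t0; rewrite lee_fin.
have n0 : 0 < 1 + t by lra.
rewrite (ger0_norm (gker_ge0 t)) ger0_norm; last first.
  by rewrite !mulr_ge0 ?powR_ge0// ?exprn_ge0 ?invr_ge0 ?ltW//;
    have := divr_gt0 (ltr0n R 2) rho0; lra.
have E : G t = t `^ (alpha - 1) * ((1 + t) `^ (alpha + 1))^-1.
  rewrite /G powRM ?invr_ge0 ?ltW// -mulrA; congr (_ * _).
  rewrite -powR_inv1 ?ltW// -powRrM -powR_mulrn ?powR_ge0// -powRrM -powRN -powRD; last first.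
    by rewrite (lt0r_neq0 n0) implybT.
  by congr (_ `^ _); ring.
rewrite E /gker mulrCA ler_wpM2l ?powR_ge0// ler_pdivlMr ?powR_gt0//.
rewrite mulrC; apply: le_trans (sqr1D_expR rho0 t0).
rewrite ler_wpM2r ?expR_ge0//.
rewrite -(powR_mulrn 2 (ltW n0)); apply: ler_powR.
  by rewrite lerDl ltW.
by rewrite -[2%:R]/(1 + 1) lerD2r.
Qed.

Lemma gker_cont t : 0 < t -> {for t, continuous gker}.
Proof.
move=> t0; exact: (isd_cont (isdM (isd_powR (alpha - 1) t0)
  (isd_exp (isdN (isd_lin rho t))))).
Qed.

Lemma integrable_gker_bounded (h : R -> R) (M : R) : measurable_fun setT h ->
  (forall t, `|h t| <= M) ->
  mu.-integrable `]0, +oo[ (EFin \o (fun t => gker t * h t)).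
Proof.
move=> mh hM; have := integrableZl mI M integrable_gker.
apply: le_integrable => //.
  apply/measurable_EFinP; apply: measurable_funTS; apply: measurable_funM => //.
  exact: measurable_gker.
move=> t _; rewrite /= lee_fin normrM mulrC.
rewrite (ger0_norm (gker_ge0 t)) (le_trans _ (ler_norm _))//.
by rewrite ler_wpM2r// gker_ge0.
Qed.

End FixedExponents.

Section LaplaceTransform.
Variables (alpha rho : R).
Hypotheses (alpha01 : 0 < alpha <= 1) (rho0 : 0 < rho).
Local Notation gk := (gker alpha rho).

Let a0 : 0 < alpha. Proof. by case/andP: alpha01. Qed.

(** Half of the exponential absorbs the extra factor, t <= (2/rho) e^(rho t / 2), and the other half
    keeps the kernel integrable, being the same kernel with rho / 2. *)
Lemma integrable_mul_gker :
  mu.-integrable `]0, +oo[ (EFin \o (fun t => `|t| * gk t)).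
Proof.
have r2 : 0 < rho / 2 by rewrite divr_gt0.
have := integrableZl mI (2 / rho) (integrable_gker alpha01 r2).
apply: le_integrable => //.
  apply/measurable_EFinP; apply: measurable_funTS; apply: measurable_funM => //.
  exact: measurable_gker.
move=> t; rewrite /= in_itv/= andbT => t0; rewrite lee_fin.
rewrite (gtr0_norm t0) (ger0_norm (mulr_ge0 (ltW t0) (gker_ge0 _ _ _))).
rewrite (le_trans _ (ler_norm _))// /gker mulrCA [leRHS]mulrCA ler_wpM2l ?powR_ge0//.
have -> : expR (- (rho * t)) = expR (- (rho / 2 * t)) * expR (- (rho / 2 * t)).
  by rewrite -expRD; congr expR; field.
rewrite mulrA ler_wpM2r ?expR_ge0//.
rewrite expRN ler_pdivrMr ?expR_gt0//.
have := expR_ge1Dx (rho / 2 * t) => h.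
rewrite mulrC -ler_pdivrMr ?divr_gt0// invf_div.
by apply: (le_trans _ h); rewrite mulrC lerDr.
Qed.

Let mcosl (x : R) : measurable_fun setT (fun t : R => cos (x * t)).
Proof.
by apply: continuous_measurable_fun => t; exact: (isd_cont (isd_cos (isd_lin x t))).
Qed.

Let msinl (x : R) : measurable_fun setT (fun t : R => sin (x * t)).
Proof.
by apply: continuous_measurable_fun => t; exact: (isd_cont (isd_sin (isd_lin x t))).
Qed.

(** [Lc - i Ls] is the Laplace transform of t^(alpha-1) at rho + i x; [Mc] and [Ms] carry the extra
    factor t that differentiation in x brings down. *)
Let Lc x := \int[mu]_(t in `]0, +oo[) (gk t * cos (x * t)).
Let Ls x := \int[mu]_(t in `]0, +oo[) (gk t * sin (x * t)).
Let Mc x := \int[mu]_(t in `]0, +oo[) (t * gk t * cos (x * t)).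
Let Ms x := \int[mu]_(t in `]0, +oo[) (t * gk t * sin (x * t)).

Let ILc x : mu.-integrable `]0, +oo[ (EFin \o (fun t => gk t * cos (x * t))).
Proof. by apply: (@integrable_gker_bounded _ _ _ _ _ 1) => // t; exact: cos_max. Qed.

Let ILs x : mu.-integrable `]0, +oo[ (EFin \o (fun t => gk t * sin (x * t))).
Proof. by apply: (@integrable_gker_bounded _ _ _ _ _ 1) => // t; exact: sin_max. Qed.

Let IM (h : R -> R) : measurable_fun setT h -> (forall t, `|h t| <= 1) ->
  mu.-integrable `]0, +oo[ (EFin \o (fun t => t * gk t * h t)).
Proof.
move=> mh h1; have := integrable_mul_gker; apply: le_integrable => //.
  apply/measurable_EFinP; apply: measurable_funTS.
  apply: measurable_funM => //; apply: measurable_funM => //.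
  exact: measurable_gker.
move=> t _; rewrite /= lee_fin !normrM normr_id ler_piMr// mulr_ge0//.
Qed.

Let IMs x : mu.-integrable `]0, +oo[ (EFin \o (fun t => t * gk t * sin (x * t))).
Proof. by apply: IM => // t; exact: sin_max. Qed.

(** The x-derivative of the integrand is bounded by |t| |g0 t| uniformly in x, which is the majorant
    needed to differentiate under the integral sign. *)
Lemma isd_param_integral (g0 tr tr' : R -> R) :
  (forall y : R, is_derive y 1 tr (tr' y)) -> (forall y, `|tr' y| <= 1) ->
  (forall x, mu.-integrable `]0, +oo[ (EFin \o (fun t => g0 t * tr (x * t)))) ->
  mu.-integrable `]0, +oo[ (EFin \o (fun t => `|t| * `|g0 t|)) ->
  forall x, is_derive x 1 (fun x => \int[mu]_(t in `]0, +oo[) (g0 t * tr (x * t)))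
    (\int[mu]_(t in `]0, +oo[) (t * g0 t * tr' (x * t))).
Proof.
move=> dtr tr1 I IG x.
pose f z t := g0 t * tr (z * t).
have df (z t : R) : is_derive z 1 (f ^~ t) (t * g0 t * tr' (z * t)).
  have hl : is_derive z 1 (fun w : R => w * t) t.
    by apply: (isd_eq (isdM (isd_id z) (isd_cst t z))); rewrite mulr0 add0r mulr1.
  have h := isdZ (g0 t) (@isd_comp R tr (fun w => w * t) _ _ _ (dtr (z * t)) hl).
  by apply: (isd_eq h); ring.
have xI : `](x - 1), (x + 1)[%classic x by rewrite /= in_itv/=; lra.
have d1 z t : derivable (f ^~ t) z 1 by have d := df z t; exact: ex_derive.
have d1E z t : partial1of2 f z t = t * g0 t * tr' (z * t).
  exact: (isd_derive1 (df z t)).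
have B z t : `](x - 1), (x + 1)[%classic z -> `]0%R, +oo[%classic t ->
    `|partial1of2 f z t| <= `|t| * `|g0 t|.
  by move=> _ _; rewrite d1E !normrM ler_piMr// mulr_ge0.
have G0 t : 0 <= `|t| * `|g0 t| by rewrite mulr_ge0.
have D1 := @derivable_under_integral R _ _ mu f _ mI x _ _ xI
  (fun z _ => I z) (fun z t _ _ => d1 z t) _ G0 IG B.
have D2 := @differentiation_under_integral R _ _ mu f _ mI x _ _ xI
  (fun z _ => I z) (fun z t _ _ => d1 z t) _ G0 IG B.
apply: DeriveDef; first exact: D1.
by rewrite -derive1E D2; apply: eq_Rintegral => t _; exact: d1E.
Qed.

Let dLc x : is_derive x 1 Lc (- Ms x).
Proof.
have h := @isd_param_integral gk (@cos R) (fun y => - sin y)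
  (@is_derive_cos R) _ ILc _ x.
apply: (isd_eq (h _ _)).
- by move=> y; rewrite normrN sin_max.
- have := integrable_mul_gker; apply: eq_integrable => // t _ /=.
  by rewrite (ger0_norm (gker_ge0 _ _ _)).
rewrite /Ms -mulN1r -RintegralZl//.
by apply: eq_Rintegral => t _; ring.
Qed.

Let dLs x : is_derive x 1 Ls (Mc x).
Proof.
have h := @isd_param_integral gk (@sin R) (@cos R)
  (@is_derive_sin R) _ ILs _ x.
apply: (isd_eq (h _ _)) => //.
- by move=> y; rewrite cos_max.
- have := integrable_mul_gker; apply: eq_integrable => // t _ /=.
  by rewrite (ger0_norm (gker_ge0 _ _ _)).
Qed.

(** These are the boundary terms of the integration by parts below. At 0 they vanish because alpha >
    0; at infinity half of the exponential absorbs t^alpha <= (1 + t)^2. *)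
Let cvg0_mul (tr : R -> R) : (forall t, `|tr t| <= 1) ->
  (fun t => t `^ alpha * expR (- (rho * t)) * tr t) x @[x --> 0^'+] --> (0 : R) /\
  (fun t => t `^ alpha * expR (- (rho * t)) * tr t) x @[x --> +oo] --> (0 : R).
Proof.
move=> tr1; split; apply/norm_cvg0P.
  have h : t `^ alpha @[t --> 0^'+] --> (0 : R) by exact: powR_cvg0.
  apply: (squeeze_cvgr _ (cvg_cst 0) h); near=> t.
  have t0 : 0 < t by near: t; exact: nbhs_right_gt.
  rewrite normr_ge0/= !normrM (ger0_norm (powR_ge0 _ _)).
  rewrite -mulrA ler_piMr ?powR_ge0// mulr_ile1//.
  by rewrite ger0_norm ?expR_ge0// -expR0 ler_expR oppr_le0 mulr_ge0// ltW.
pose C := (1 + 2 / (rho / 2)) ^+ 2.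
have r2 : 0 < rho / 2 by rewrite divr_gt0.
have h : C * expR (- (rho / 2 * t)) @[t --> +oo] --> (0 : R).
  by rewrite -[X in _ --> X](mulr0 C); apply: cvgMr; exact: cvg_expR_scaled.
apply: (squeeze_cvgr _ (cvg_cst 0) h); near=> t.
have t0 : 0 < t by near: t; apply: nbhs_pinfty_gt; exact: num_real.
rewrite normr_ge0/= !normrM (ger0_norm (powR_ge0 _ _)) (ger0_norm (expR_ge0 _)).
rewrite (le_trans (ler_piMr _ (tr1 t)))//; first by rewrite mulr_ge0 ?powR_ge0 ?expR_ge0.
have -> : expR (- (rho * t)) = expR (- (rho / 2 * t)) * expR (- (rho / 2 * t)).
  by rewrite -expRD; congr expR; field.
rewrite mulrA ler_wpM2r ?expR_ge0//.
apply: le_trans (sqr1D_expR r2 t0); rewrite ler_wpM2r ?expR_ge0//.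
have a1 : alpha <= 1 by case/andP: alpha01.
apply: (@le_trans _ _ ((1 + t) `^ alpha)).
  by rewrite ge0_ler_powR// ?nnegrE ?lerDr// ?addr_ge0// ltW.
rewrite -powR_mulrn; last by lra.
by apply: ler_powR; lra.
Unshelve. all: by end_near. Qed.

(** The derivative of t^alpha e^(-rho t) tr(x t) integrates to 0 over (0, oo), and its three terms
    by the product rule are the three integrals here. *)
Let by_parts (tr tr' : R -> R) :
  (forall y : R, is_derive y 1 tr (tr' y)) -> (forall t, {for t, continuous tr'}) ->
  (forall t, `|tr t| <= 1) -> (forall t, `|tr' t| <= 1) -> forall x,
  alpha * \int[mu]_(t in `]0, +oo[) (gk t * tr (x * t)) =
  rho * \int[mu]_(t in `]0, +oo[) (t * gk t * tr (x * t)) -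
  x * \int[mu]_(t in `]0, +oo[) (t * gk t * tr' (x * t)).
Proof.
move=> dtr ctr' tr1 tr'1 x.
have ctr t : {for t, continuous (fun t => tr (x * t))}.
  exact: (isd_cont (isd_comp (dtr (x * t)) (isd_lin x t))).
have ctr2 t : {for t, continuous (fun t => tr' (x * t))}.
  apply: (@continuous_comp _ _ _ (fun t => x * t)); last exact: ctr'.
  exact: (isd_cont (isd_lin x t)).
have mtr := continuous_measurable_fun ctr.
have mtr' := continuous_measurable_fun ctr2.
have I1 := @integrable_gker_bounded _ _ alpha01 rho0 _ 1 mtr (fun t => tr1 _).
have I2 := IM mtr (fun t => tr1 _).
have I3 := IM mtr' (fun t => tr'1 _).
pose F t := t `^ alpha * expR (- (rho * t)) * tr (x * t).
pose f t := alpha * (gk t * tr (x * t)) - (rho * (t * gk t * tr (x * t))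
   - x * (t * gk t * tr' (x * t))).
have J1 := integrableZl mI alpha I1.
have J2 := integrableZl mI rho I2.
have J3 := integrableZl mI x I3.
have [c1 c2] := cvg0_mul (tr := fun t => tr (x * t)) (fun t => tr1 _).
suff : \int[mu]_(t in `]0, +oo[) f t = 0 - 0.
  rewrite /f RintegralB//; last exact: integrableB J2 J3.
  rewrite RintegralB// !RintegralZl// subr0 => /eqP.
  by rewrite subr_eq0 => /eqP.
apply: (@integral_FTC0y _ f F) => //.
- move=> t t0.
  have h := isdM (isdM (isd_powR alpha t0) (isd_exp (isdN (isd_lin rho t))))
    (isd_comp (dtr (x * t)) (isd_lin x t)).
  apply: (isd_eq h); rewrite /f /gker.
  have -> : t `^ alpha = t * t `^ (alpha - 1) by rewrite mulr_powRB1// ltW.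
  by ring.
- move=> t t0; rewrite /f.
  have cg := @gker_cont alpha rho _ t0.
  apply: cvgB; first by apply: cvgMr; apply: cvgM cg _; exact: ctr.
  have ci : {for t, continuous (fun t => t * gk t)}.
    by apply: cvgM cg; exact: cvg_id.
  apply: cvgB; apply: cvgMr; apply: cvgM ci _; [exact: ctr|exact: ctr2].
- exact: (integrableB mI J1 (integrableB mI J2 J3)).
Qed.

Let bpc x : alpha * Lc x = rho * Mc x + x * Ms x.
Proof.
rewrite (@by_parts (@cos R) (fun y => - sin y))//.
- rewrite -/(Mc x); congr (_ + _).
  rewrite -mulrN; congr (_ * _); rewrite -mulN1r -RintegralZl//.
    by apply: eq_Rintegral => t _; ring.
  have := integrableN (IMs x); apply: eq_integrable => // t _ /=.
  by rewrite -mulrN.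
- by move=> t; apply: cvgN; exact: continuous_sin'.
- by move=> t; exact: cos_max.
- by move=> t; rewrite normrN; exact: sin_max.
Qed.

Let bps x : alpha * Ls x = rho * Ms x - x * Mc x.
Proof.
rewrite (@by_parts (@sin R) (@cos R))//.
- by move=> t; exact: continuous_cos'.
- by move=> t; exact: sin_max.
- by move=> t; exact: cos_max.
Qed.

(** [S x] is |rho + i x|^2, so [A x] and [th x] below are the modulus and the argument of (rho + i
    x)^alpha. *)
Let S x := rho ^+ 2 + x ^+ 2.
Let S0 x : 0 < S x. Proof. exact: sqr_pos. Qed.
Let A x := S x `^ (alpha / 2).
Let th x := alpha * atan (rho^-1 * x).

Let dA x : is_derive x 1 A (alpha * x / S x * A x).
Proof.
have dS : is_derive x 1 S (2 * x).
  by apply: (isd_eq (isdD (isd_cst (rho ^+ 2) x) (isdM (isd_id x) (isd_id x)))); ring.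
have h := @isd_comp R (fun y => y `^ (alpha / 2)) S _ _ _ (isd_powR (alpha / 2) (S0 x)) dS.
apply: (isd_eq h); rewrite /A powRB; last by rewrite (gt_eqF (S0 x)) implybT.
rewrite powRr1 ?ltW//; field.
by rewrite gt_eqF.
Qed.

Let dth x : is_derive x 1 th (alpha * rho / S x).
Proof.
have h := isdZ alpha (@isd_comp R (@atan R) (fun y => rho^-1 * y) _ _ _
  (is_derive1_atan (rho^-1 * x)) (isd_lin rho^-1 x)).
apply: (isd_eq h).
have h1 := lt0r_neq0 (S0 x); have h2 := lt0r_neq0 rho0.
have -> : 1 + (rho^-1 * x) ^+ 2 = S x / rho ^+ 2 by rewrite /S; field.
by field; rewrite h1 h2.
Qed.

(** The relations [bpc] and [bps] are linear in [Mc] and [Ms] with determinant [S x]. Solving them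
    makes the differential equations for [Lc] and [Ls] a closed system. *)
Let McE x : Mc x = alpha * (rho * Lc x - x * Ls x) / S x.
Proof.
apply/eqP; rewrite eq_sym -subr_eq0; apply/eqP.
have := lt0r_neq0 (S0 x) => h1.
have -> : alpha * (rho * Lc x - x * Ls x) = rho * (alpha * Lc x) - x * (alpha * Ls x).
  by ring.
by rewrite bpc bps; rewrite /S in h1 *; field.
Qed.

Let MsE x : Ms x = alpha * (rho * Ls x + x * Lc x) / S x.
Proof.
apply/eqP; rewrite eq_sym -subr_eq0; apply/eqP.
have := lt0r_neq0 (S0 x) => h1.
have -> : alpha * (rho * Ls x + x * Lc x) = rho * (alpha * Ls x) + x * (alpha * Lc x).
  by ring.
by rewrite bpc bps; rewrite /S in h1 *; field.
Qed.

(* [U - i V] is [(rho + i x)^alpha] times the Laplace transform [Lc - i Ls];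
   it is constant. *)
Let U x := A x * (Lc x * cos (th x) + Ls x * sin (th x)).
Let V x := A x * (Ls x * cos (th x) - Lc x * sin (th x)).

Let dU x : is_derive x 1 U 0.
Proof.
have h := isdM (dA x) (isdD (isdM (dLc x) (isd_cos (dth x))) (isdM (dLs x) (isd_sin (dth x)))).
apply: (isd_eq h); rewrite McE MsE.
have h1 := lt0r_neq0 (S0 x).
by field.
Qed.

Let dV x : is_derive x 1 V 0.
Proof.
have h := isdM (dA x) (isdD (isdM (dLs x) (isd_cos (dth x)))
  (isdN (isdM (dLc x) (isd_sin (dth x))))).
apply: (isd_eq h); rewrite McE MsE.
have h1 := lt0r_neq0 (S0 x).
by field.
Qed.

(** The substitution u = rho t. This value at x = 0 is what identifies the constant [U]. *)
Let Lc0 : Lc 0 = rho `^ (- alpha) * Gamma alpha.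
Proof.
pose h (u : R) := ((u `^ (alpha - 1) * expR (- u)) * (if 0 < u then 1 else 0)).
have h0 u : 0 <= h u.
  by rewrite !mulr_ge0 ?powR_ge0 ?expR_ge0//; case: ifP.
have mh : measurable_fun setT h.
  apply: measurable_funM.
    apply: measurable_funM; first exact: measurable_powR.
    exact: measurableT_comp.
  by apply: measurable_fun_ifT => //; exact: measurable_fun_ltr.
have E1 : Gamma alpha = \int[mu]_u h u.
  rewrite /Gamma Rintegral_mkcond; apply: eq_Rintegral => u _.
  by rewrite patchE mem_setE in_itv/= andbT /h; case: ifP; rewrite ?mulr1 ?mulr0.
have E2 : Lc 0 = \int[mu]_t (rho `^ (1 - alpha) * h (rho * t)).
  rewrite /Lc Rintegral_mkcond; apply: eq_Rintegral => t _.
  rewrite patchE mem_setE in_itv/= andbT mul0r cos0 mulr1 /h pmulr_rgt0//.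
  case: ifP => t0; rewrite ?mulr1 ?mulr0// /gker powRM ?ltW//.
  rewrite !mulrA -powRD; last by rewrite (gt_eqF rho0) implybT.
  by rewrite (_ : 1 - alpha + (alpha - 1) = 0) ?powRr0 ?mul1r//; ring.
rewrite E2 E1 /Rintegral.
under eq_integral do rewrite EFinM.
have mhr : measurable_fun setT (fun t => (h (rho * t))%:E).
  by apply/measurable_EFinP; apply: (measurableT_comp mh); exact: measurable_funM.
rewrite ge0_integralZl//; last 2 first.
- by move=> t _; rewrite lee_fin.
- by rewrite lee_fin powR_ge0.
rewrite (@integral_scale rho (EFin \o h))//; last exact/measurable_EFinP.
rewrite muleA -EFinM.
have -> : rho `^ (1 - alpha) / rho = rho `^ (- alpha).
  rewrite -(powR_inv1 (ltW rho0)) -powRD; last by rewrite (gt_eqF rho0) implybT.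
  by congr (_ `^ _); ring.
have If : mu.-integrable setT (EFin \o h).
  have := (integrable_mkcond _ mI).1 (integrable_gker alpha01 ltr01).
  apply: eq_integrable => // t _ /=.
  rewrite patchE mem_setE in_itv/= andbT /h /gker mul1r.
  by case: ifP; rewrite ?mulr1 ?mulr0.
by rewrite fineM// (integrable_fin_num _ If).
Qed.

Let U0 x : U x = Gamma alpha.
Proof.
rewrite (is_derive_0_is_cst x 0 dU) /U /th mulr0 atan0 mulr0 cos0 sin0.
rewrite mulr0 addr0 mulr1 Lc0 /A /S expr0n/= addr0.
rewrite -powR_mulrn ?ltW// -powRrM (_ : 2%:R * (alpha / 2) = alpha); last by field.
rewrite mulrA -powRD; last by rewrite (gt_eqF rho0) implybT.
by rewrite subrr powRr0 mul1r.
Qed.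

Let V0 x : V x = 0.
Proof.
rewrite (is_derive_0_is_cst x 0 dV) /V /th mulr0 atan0 mulr0 cos0 sin0.
rewrite mulr0 subr0 mulr1 (_ : Ls 0 = 0) ?mulr0// /Ls.
under eq_Rintegral do rewrite mul0r sin0 mulr0.
by rewrite Rintegral_cst// mul0r.
Qed.

(** [V x = 0] makes the vector (Lc, Ls) parallel to (cos th, sin th), and [U x = Gamma alpha] fixes
    its length. *)
Lemma laplace_cos x : \int[mu]_(t in `]0, +oo[) (gk t * cos (x * t)) =
  Gamma alpha * ((rho ^+ 2 + x ^+ 2) `^ (alpha / 2))^-1 *
    cos (alpha * atan (rho^-1 * x)).
Proof.
rewrite -/(Lc x) -/(S x) -/(A x) -/(th x) -(U0 x).
have A0 : A x != 0 by rewrite gt_eqF// powR_gt0.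
have := V0 x; rewrite /V => /eqP; rewrite mulf_eq0 (negbTE A0)/= => /eqP e.
have := cos2Dsin2 (th x); rewrite /U => e2.
rewrite (mulrC (A x)) mulfK// mulrDl -[LHS]mulr1 -e2.
have -> : Ls x * sin (th x) * cos (th x) = Ls x * cos (th x) * sin (th x) by ring.
by move/eqP : e; rewrite subr_eq0 => /eqP ->; ring.
Qed.

Lemma laplace_sin x : \int[mu]_(t in `]0, +oo[) (gk t * sin (x * t)) =
  Gamma alpha * ((rho ^+ 2 + x ^+ 2) `^ (alpha / 2))^-1 *
    sin (alpha * atan (rho^-1 * x)).
Proof.
rewrite -/(Ls x) -/(S x) -/(A x) -/(th x) -(U0 x).
have A0 : A x != 0 by rewrite gt_eqF// powR_gt0.
have := V0 x; rewrite /V => /eqP; rewrite mulf_eq0 (negbTE A0)/= => /eqP e.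
have := cos2Dsin2 (th x); rewrite /U => e2.
rewrite (mulrC (A x)) mulfK// mulrDl -[LHS]mulr1 -e2.
have -> : Lc x * cos (th x) * sin (th x) = Lc x * sin (th x) * cos (th x) by ring.
by move/eqP : e; rewrite subr_eq0 => /eqP <-; ring.
Qed.

End LaplaceTransform.

(** On [1/2, 1] the integrand is at least e^(-1), because alpha <= 1 gives t^(alpha-1) >= 1
    there. *)
Lemma Gamma_gt0 (alpha : R) : 0 < alpha <= 1 -> 0 < Gamma alpha.
Proof.
move=> alpha01; have a1 : alpha <= 1 by case/andP: alpha01.
have gE t : t `^ (alpha - 1) * expR (- t) = gker alpha 1 t by rewrite /gker mul1r.
have h2 : (2^-1 : R) <= 1 by rewrite invf_le1// ler1n.
apply: (@lt_le_trans _ _ (expR (-1) * (1 - 2^-1))).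
  by rewrite mulr_gt0 ?expR_gt0//; lra.
rewrite -(Rintegral_ind h2) -RintegralZl//; last exact: L1_ind.
rewrite (_ : \int[mu]_x (expR (-1) * ind 2^-1 1 x) =
    \int[mu]_(x in `]0, +oo[) (expR (-1) * ind 2^-1 1 x)); last first.
  rewrite [RHS]Rintegral_mkcond; apply: eq_Rintegral => x _.
  rewrite patchE mem_setE in_itv/= andbT; case: ifPn => // x0.
  rewrite indE ifF ?mulr0//; apply/negbTE; rewrite negb_and -!ltNge.
  by rewrite (le_lt_trans _ (_ : 0 < 2^-1))// leNgt.
rewrite /Gamma; apply: le_Rintegral => //.
- by apply: integrableS (L1Z (expR (-1)) (L1_ind 2^-1 1)) => //.
- have := integrable_gker alpha01 ltr01; apply: eq_integrable => // t _ /=.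
  by rewrite gE.
move=> t; rewrite /= in_itv/= andbT => t0.
rewrite indE; case: ifPn => [/andP[t2 t1]|_]; last first.
  by rewrite mulr0 mulr_ge0 ?powR_ge0 ?expR_ge0.
rewrite mulr1 -[leLHS]mul1r; apply: ler_pM; rewrite ?expR_ge0//; last first.
  by rewrite ler_expR lerN2.
rewrite -[leLHS](@powRr0 R t); apply: ger_powR; first by rewrite t0.
by rewrite subr_le0.
Qed.

End GammaKernel.

(** * The Fourier transform in real and imaginary parts *)

Section FourierPairs.
Context {R : realType}.
Local Notation mu := (@lebesgue_measure R).
Implicit Types (a b p q u v : R -> R) (x y t s N : R).

Definition cosM (z : R * R) : R := cos (z.1 * z.2).
Definition sinM (z : R * R) : R := sin (z.1 * z.2).

Lemma measurable_cosM : measurable_fun setT cosM.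
Proof. exact: (measurableT_comp measurable_cos measurable_prod2). Qed.

Lemma measurable_sinM : measurable_fun setT sinM.
Proof. exact: (measurableT_comp measurable_sin measurable_prod2). Qed.

Lemma normr_cosM z : `|cosM z| <= 1. Proof. exact: cos_max. Qed.
Lemma normr_sinM z : `|sinM z| <= 1. Proof. exact: sin_max. Qed.

Definition CT N u x : R := hc * \int[mu]_y (cosM (x, y) * trunc N u y).
Definition ST N u x : R := hc * \int[mu]_y (sinM (x, y) * trunc N u y).

(* For [h = u + i v], the real part of [hc * \int_(-N)^N e^(i x y) h y dy]. *)
Definition IR N u v x : R := CT N u x - ST N v x.

Let Icos N u x : L2 u -> L1 (fun y => cosM (x, y) * trunc N u y).
Proof. by move=> Lu; apply: (L1_slice x measurable_cosM normr_cosM); exact: L1_trunc. Qed.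

Let Isin N u x : L2 u -> L1 (fun y => sinM (x, y) * trunc N u y).
Proof. by move=> Lu; apply: (L1_slice x measurable_sinM normr_sinM); exact: L1_trunc. Qed.

Lemma HT_CS N u x : L2 u -> HT N u x = CT N u x + ST N u x.
Proof.
move=> Lu; rewrite /HT /hart /CT /ST -mulrDr -RintegralD//; [|exact: Icos|exact: Isin].
by congr (_ * _); apply: eq_Rintegral => y _; rewrite /casM /cas /cosM /sinM mulrDl.
Qed.

Lemma CT_opp N u x : CT N u (- x) = CT N u x.
Proof.
by congr (_ * _); apply: eq_Rintegral => y _; rewrite /cosM/= mulNr cosN.
Qed.

Lemma RintegralN u : L1 u -> \int[mu]_x (- u x) = - \int[mu]_x u x.
Proof.
move=> Iu; rewrite -mulN1r -RintegralZl//.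
by apply: eq_Rintegral => x _; rewrite mulN1r.
Qed.

Lemma ST_opp N u x : L2 u -> ST N u (- x) = - ST N u x.
Proof.
move=> Lu; rewrite /ST -mulrN -(RintegralN (Isin N x Lu)).
by congr (_ * _); apply: eq_Rintegral => y _; rewrite /sinM/= mulNr sinN; ring.
Qed.

Lemma ST_oppr N u x : L2 u -> ST N (fun y => - u y) x = - ST N u x.
Proof.
move=> Lu; rewrite /ST -mulrN -(RintegralN (Isin N x Lu)).
by congr (_ * _); apply: eq_Rintegral => y _; rewrite /trunc; ring.
Qed.

Lemma nsq_reflect u : measurable_fun setT u -> nsq (fun x => u (- x)) = nsq u.
Proof.
move=> mu_; rewrite /nsq.
rewrite -(@ge0_integral_reflect R 0 _ (measurable_sqr mu_) (fun x => sqr_ge0 (u x))).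
by apply: eq_integral => x _; rewrite sub0r.
Qed.

Lemma L2_reflect u : L2 u -> L2 (fun x => u (- x)).
Proof.
by move=> [mu_ fu]; split; [exact: measurableT_comp|rewrite nsq_reflect].
Qed.

Lemma cvg2_reflect (u_ : nat -> R -> R) u : (forall n, measurable_fun setT (u_ n)) ->
  measurable_fun setT u -> cvg2 u_ u ->
  cvg2 (fun n x => u_ n (- x)) (fun x => u (- x)).
Proof.
move=> m_ m cu; rewrite /cvg2 (_ : (fun n => _) = (fun n => nsq (u_ n \- u)))//.
by apply/funext => n; rewrite -(nsq_reflect (measurable_funB (m_ n) m)).
Qed.

(* The even part of [u] plus [c] times the odd part of [v]: this mixing
   exchanges Fourier transforms of complex functions and Hartley transforms. *)
Definition mix (c : R) u v x : R :=
  2^-1 * (u x + u (- x)) + c * 2^-1 * (v x - v (- x)).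

Lemma L2_mix c u v : L2 u -> L2 v -> L2 (mix c u v).
Proof.
move=> Lu Lv; have Lu' := L2_reflect Lu; have Lv' := L2_reflect Lv.
apply: (@L2D _ (fun x => 2^-1 * (u x + u (- x)))
  (fun x => c * 2^-1 * (v x - v (- x)))); apply: L2Z.
  exact: (L2D Lu Lu').
exact: (L2B Lv Lv').
Qed.

Lemma cvg2N (u_ : nat -> R -> R) u : cvg2 u_ u ->
  cvg2 (fun n x => - u_ n x) (fun x => - u x).
Proof.
rewrite /cvg2 (_ : (fun n => nsq (u_ n \- u)) =
  (fun n => nsq ((fun x => - u_ n x) \- (fun x => - u x))))//.
by apply/funext => n; apply: eq_integral => x _ /=; rewrite -opprD sqrrN.
Qed.

Lemma cvg2_mix c (u_ v_ : nat -> R -> R) u v : (forall n, L2 (u_ n)) ->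
  (forall n, L2 (v_ n)) -> L2 u -> L2 v -> cvg2 u_ u -> cvg2 v_ v ->
  cvg2 (fun n => mix c (u_ n) (v_ n)) (mix c u v).
Proof.
move=> Lu_ Lv_ Lu Lv cu cv.
have mu_ n := (Lu_ n).1; have mv_ n := (Lv_ n).1.
have m1 := Lu.1; have m2 := Lv.1.
have ru n := (L2_reflect (Lu_ n)).1; have rv n := (L2_reflect (Lv_ n)).1.
have r1 := (L2_reflect Lu).1; have r2 := (L2_reflect Lv).1.
have c1 := cvg2_reflect mu_ m1 cu; have c2 := cvg2N (cvg2_reflect mv_ m2 cv).
have nv n : measurable_fun setT (fun x => - v_ n (- x)) by exact: measurableT_comp.
have n2 : measurable_fun setT (fun x => - v (- x)) by exact: measurableT_comp.
apply: (@cvg2D _ (fun n x => 2^-1 * (u_ n x + u_ n (- x)))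
  (fun x => 2^-1 * (u x + u (- x)))
  (fun n x => c * 2^-1 * (v_ n x - v_ n (- x)))
  (fun x => c * 2^-1 * (v x - v (- x)))).
- by move=> n; apply: measurable_funM => //; exact: measurable_funD.
- by move=> n; apply: measurable_funM => //; exact: measurable_funB.
- by apply: measurable_funM => //; exact: measurable_funD.
- by apply: measurable_funM => //; exact: measurable_funB.
- apply: (@cvg2Z _ 2^-1 (fun n x => u_ n x + u_ n (- x)) (fun x => u x + u (- x))).
  + by move=> n; exact: measurable_funD.
  + exact: measurable_funD.
  + exact: (cvg2D mu_ ru m1 r1 cu c1).
- apply: (@cvg2Z _ (c * 2^-1) (fun n x => v_ n x - v_ n (- x)) (fun x => v x - v (- x))).
  + by move=> n; exact: measurable_funB.
  + exact: measurable_funB.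
  + exact: (cvg2D mv_ nv m2 n2 cv c2).
Qed.

Lemma mixK c u v : c ^+ 2 = 1 -> mix c (mix (- c) u v) (mix c v u) = u.
Proof.
move=> c1; apply/funext => x; rewrite /mix !opprK.
have -> : 2^-1 * (2^-1 * (u x + u (- x)) + - c * 2^-1 * (v x - v (- x)) +
    (2^-1 * (u (- x) + u x) + - c * 2^-1 * (v (- x) - v x))) +
  c * 2^-1 * (2^-1 * (v x + v (- x)) + c * 2^-1 * (u x - u (- x)) -
    (2^-1 * (v (- x) + v x) + c * 2^-1 * (u (- x) - u x))) =
  2^-1 * (u x + u (- x)) + c ^+ 2 * (2^-1 * (u x - u (- x))) by field.
by rewrite c1; field.
Qed.

Let refl_int (g w : R -> R) : L1 (fun y => g y * w (- y)) ->
  \int[mu]_y (g y * w (- y)) = \int[mu]_y (g (- y) * w y).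
Proof.
move=> /(Rintegral_reflect 0) <-.
by apply: eq_Rintegral => y _; rewrite sub0r opprK.
Qed.

(** The cosine transform annihilates odd functions and the sine transform even ones, so each of the
    two halves of [mix] is seen by only one of them. *)
Lemma HT_mix N c u v x : L2 u -> L2 v ->
  HT N (mix c u v) x = CT N u x + c * ST N v x.
Proof.
move=> Lu Lv; have Lu' := L2_reflect Lu; have Lv' := L2_reflect Lv.
have tr w y : trunc N (fun z => w (- z)) y = trunc N w (- y).
  rewrite /trunc !indE (_ : (- N <= - y <= N) = (- N <= y <= N))//.
  by rewrite lerN2 (lerNl y) andbC.
have CE w : L2 w -> CT N (fun z => w (- z)) x = CT N w x.
  move=> Lw; have I := Icos N x (L2_reflect Lw).
  rewrite /CT; congr (_ * _); under eq_Rintegral do rewrite tr.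
  rewrite (@refl_int (fun y => cosM (x, y)) (trunc N w)); last first.
    by move: I; apply: eq_integrable => // y _ /=; rewrite tr.
  by apply: eq_Rintegral => y _; rewrite /cosM/= mulrN cosN.
have SE w : L2 w -> ST N (fun z => w (- z)) x = - ST N w x.
  move=> Lw; have I := Isin N x (L2_reflect Lw).
  rewrite /ST -mulrN; congr (_ * _); under eq_Rintegral do rewrite tr.
  rewrite (@refl_int (fun y => sinM (x, y)) (trunc N w)); last first.
    by move: I; apply: eq_integrable => // y _ /=; rewrite tr.
  rewrite -(RintegralN (Isin N x Lw)).
  by apply: eq_Rintegral => y _; rewrite /sinM/= mulrN sinN; ring.
have CL : CT N (mix c u v) x = 2^-1 * (CT N u x + CT N (fun z => u (- z)) x)
   + c * 2^-1 * (CT N v x - CT N (fun z => v (- z)) x).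
  rewrite /CT.
  have I1 := Icos N x Lu; have I2 := Icos N x Lu'.
  have I3 := Icos N x Lv; have I4 := Icos N x Lv'.
  rewrite -!(mulrDr hc) -(mulrBr hc) -RintegralD// -RintegralB//.
  rewrite (mulrCA 2^-1) (mulrCA (c * 2^-1)) -mulrDr; congr (_ * _).
  rewrite -!RintegralZl//; [|exact: L1B|exact: L1D].
  rewrite -RintegralD//; [|by apply: L1Z; exact: L1D|by apply: L1Z; exact: L1B].
  by apply: eq_Rintegral => y _; rewrite /trunc /mix; ring.
have SL : ST N (mix c u v) x = 2^-1 * (ST N u x + ST N (fun z => u (- z)) x)
   + c * 2^-1 * (ST N v x - ST N (fun z => v (- z)) x).
  rewrite /ST.
  have I1 := Isin N x Lu; have I2 := Isin N x Lu'.
  have I3 := Isin N x Lv; have I4 := Isin N x Lv'.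
  rewrite -!(mulrDr hc) -(mulrBr hc) -RintegralD// -RintegralB//.
  rewrite (mulrCA 2^-1) (mulrCA (c * 2^-1)) -mulrDr; congr (_ * _).
  rewrite -!RintegralZl//; [|exact: L1B|exact: L1D].
  rewrite -RintegralD//; [|by apply: L1Z; exact: L1D|by apply: L1Z; exact: L1B].
  by apply: eq_Rintegral => y _; rewrite /trunc /mix; ring.
rewrite HT_CS; last exact: L2_mix.
by rewrite CL SL !CE// !SE//; field.
Qed.

(** [F2] expresses that p + i q is the Fourier transform of a + i b, with kernel e^(-i x y); [G2]
    expresses that a + i b is the inverse transform of p + i q, with kernel e^(i x y). Each conjunct
    is the real or the imaginary part. *)
Definition F2 a b p q :=
  cvg2 (fun n => IR n%:R a (fun x => - b x)) p /\ cvg2 (fun n => IR n%:R b a) q.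

Definition G2 p q a b :=
  cvg2 (fun n => IR n%:R p q) a /\ cvg2 (fun n => IR n%:R q (fun x => - p x)) b.

Lemma IR_HT N p q : L2 p -> L2 q -> IR N p q = HT N (mix (-1) p q).
Proof. by move=> Lp Lq; apply/funext => x; rewrite HT_mix// /IR mulN1r. Qed.

Lemma IR_HTN N p q : L2 p -> L2 q -> IR N q (fun x => - p x) = HT N (mix 1 q p).
Proof.
by move=> Lp Lq; apply/funext => x; rewrite HT_mix// /IR mul1r ST_oppr// opprK.
Qed.

Lemma L2_IR N p q : L2 p -> L2 q -> L2 (IR N p q).
Proof. by move=> Lp Lq; rewrite IR_HT//; apply: L2_HT; exact: L2_mix. Qed.

Lemma G2_HT p q a b : L2 p -> L2 q ->
  G2 p q a b <-> cvg2 (fun n => HT n%:R (mix (-1) p q)) a /\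
                 cvg2 (fun n => HT n%:R (mix 1 q p)) b.
Proof.
move=> Lp Lq; rewrite /G2.
under [in X in X /\ _]eq_fun do rewrite IR_HT//.
by under [in X in _ /\ X <-> _]eq_fun do rewrite IR_HTN//.
Qed.

(** Here the mixing is applied after the transform, whereas in [G2_HT] it is applied before. Both
    conditions thereby become Hartley transforms between the same functions, in opposite directions,
    which is exactly what [HT_inversion] relates. The two implications hold since mixing is
    continuous in L^2 and inverted by [mixK]. *)
Lemma F2_HT a b p q : L2 a -> L2 b -> L2 p -> L2 q ->
  F2 a b p q <-> cvg2 (fun n => HT n%:R a) (mix (-1) p q) /\
                 cvg2 (fun n => HT n%:R b) (mix 1 q p).
Proof.
move=> La Lb Lp Lq.
have LbN : L2 (fun x => - b x) by exact: L2N.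
pose X (n : nat) := IR n%:R a (fun x => - b x); pose Y (n : nat) := IR n%:R b a.
pose A (n : nat) := HT n%:R a; pose B (n : nat) := HT n%:R b.
have LX n : L2 (X n) by exact: L2_IR.
have LY n : L2 (Y n) by exact: L2_IR.
have LA n : L2 (A n) by exact: L2_HT.
have LB n : L2 (B n) by exact: L2_HT.
have XE n x : X n x = CT n%:R a x + ST n%:R b x by rewrite /X /IR ST_oppr// opprK.
have XrE n x : X n (- x) = CT n%:R a x - ST n%:R b x by rewrite XE CT_opp ST_opp.
have YE n x : Y n x = CT n%:R b x - ST n%:R a x by [].
have YrE n x : Y n (- x) = CT n%:R b x + ST n%:R a x.
  by rewrite YE CT_opp ST_opp// opprK.
have AE n : A n = mix (-1) (X n) (Y n).
  by apply/funext => x; rewrite /mix XE XrE YE YrE /A HT_CS//; field.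
have BE n : B n = mix 1 (Y n) (X n).
  by apply/funext => x; rewrite /mix XE XrE YE YrE /B HT_CS//; field.
have m1 : (-1 : R) ^+ 2 = 1 by rewrite sqrrN expr1n.
have XE' n : X n = mix 1 (A n) (B n) by rewrite AE BE mixK// expr1n.
have YE' n : Y n = mix (-1) (B n) (A n).
  by rewrite AE BE; have := @mixK (-1) (Y n) (X n) m1; rewrite opprK.
split => [[cX cY]|[cA cB]]; split.
- by under eq_fun do rewrite -/(A _) AE; exact: cvg2_mix.
- by under eq_fun do rewrite -/(B _) BE; exact: cvg2_mix.
- under eq_fun do rewrite -/(X _) XE'.
  rewrite -(@mixK 1 p q) ?expr1n//; apply: cvg2_mix => //; exact: L2_mix.
- under eq_fun do rewrite -/(Y _) YE'.
  rewrite -(@mixK (-1) q p) ?opprK//; apply: cvg2_mix => //; exact: L2_mix.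
Qed.

Theorem fourier_inversion a b p q : L2 a -> L2 b -> L2 p -> L2 q ->
  F2 a b p q <-> G2 p q a b.
Proof.
move=> La Lb Lp Lq; rewrite F2_HT// G2_HT//.
have L1 : L2 (mix (-1) p q) by exact: L2_mix.
have L2' : L2 (mix 1 q p) by exact: L2_mix.
by split => -[h1 h2]; split; exact: HT_inversion.
Qed.

Lemma fourier_exists a b : L2 a -> L2 b ->
  exists p q, [/\ L2 p, L2 q & F2 a b p q].
Proof.
move=> La Lb; have [A LA cA] := HT_exists La; have [B LB cB] := HT_exists Lb.
exists (mix 1 A B), (mix (-1) B A).
have L1 : L2 (mix 1 A B) by exact: L2_mix.
have L2' : L2 (mix (-1) B A) by exact: L2_mix.
split => //; rewrite F2_HT//; split.
  by have := @mixK (-1) A B; rewrite opprK sqrrN expr1n => ->.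
by rewrite mixK// expr1n.
Qed.

Section ConvolutionTheorem.
Variable K : R -> R.
Hypotheses (IK : L1 K) (K0 : forall x, 0 <= K x) (k0 : 0 < \int[mu]_x K x).

(** [mcos - i msin] is the unnormalized Fourier transform of [K]; [mulr_re] and [mulr_im] below are
    the two parts of its product with p + i q. *)
Definition mcos x := \int[mu]_s (cosM (x, s) * K s).
Definition msin x := \int[mu]_s (sinM (x, s) * K s).

Lemma measurable_mcos : measurable_fun setT mcos.
Proof. exact: (measurable_kernel measurable_cosM normr_cosM IK). Qed.

Lemma measurable_msin : measurable_fun setT msin.
Proof. exact: (measurable_kernel measurable_sinM normr_sinM IK). Qed.

Let bnd (k : R * R -> R) x : measurable_fun setT k -> (forall z, `|k z| <= 1) ->
  `|\int[mu]_s (k (x, s) * K s)| <= \int[mu]_s K s.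
Proof.
move=> mk k1; have I1 := L1_slice x mk k1 IK.
apply: (le_trans (le_normr_Rintegral _ I1)) => //.
apply: le_Rintegral => //; first exact: L1_norm.
by move=> s _; rewrite normrM (ger0_norm (K0 s)) ler_piMl.
Qed.

Lemma normr_mcos x : `|mcos x| <= \int[mu]_s K s.
Proof. exact: (bnd x measurable_cosM normr_cosM). Qed.

Lemma normr_msin x : `|msin x| <= \int[mu]_s K s.
Proof. exact: (bnd x measurable_sinM normr_sinM). Qed.

Let mulr_re p q x := mcos x * p x + msin x * q x.
Let mulr_im p q x := mcos x * q x - msin x * p x.

Lemma L2_mulr_re p q : L2 p -> L2 q -> L2 (mulr_re p q).
Proof.
move=> Lp Lq; apply: (@L2D _ (fun x => mcos x * p x) (fun x => msin x * q x)).
  exact: (L2Mb measurable_mcos normr_mcos).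
exact: (L2Mb measurable_msin normr_msin).
Qed.

Lemma L2_mulr_im p q : L2 p -> L2 q -> L2 (mulr_im p q).
Proof.
move=> Lp Lq; apply: (@L2B _ (fun x => mcos x * q x) (fun x => msin x * p x)).
  exact: (L2Mb measurable_mcos normr_mcos).
exact: (L2Mb measurable_msin normr_msin).
Qed.

Let IKt t : L1 (fun s => K (t - s)). Proof. exact: L1_reflect. Qed.

(** The substitution s -> t - s absorbs the phase e^(i t x) into the kernel. This is the real part
    of e^(i t x) (mcos - i msin), and [shift_sin] is minus its imaginary part. *)
Let shift_cos x t : cos (t * x) * mcos x + sin (t * x) * msin x =
  \int[mu]_s (cosM (x, s) * K (t - s)).
Proof.
have I1 := L1_slice x measurable_cosM normr_cosM IK.
have I2 := L1_slice x measurable_sinM normr_sinM IK.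
have I3 := L1_slice x measurable_cosM normr_cosM (IKt t).
rewrite /mcos /msin -!RintegralZl// -RintegralD//; [|exact: L1Z..].
rewrite -[RHS](Rintegral_reflect t)//; apply: eq_Rintegral => s _.
rewrite /cosM /sinM/= subKr mulrBr cosB (mulrC x t); ring.
Qed.

Let shift_sin x t : cos (t * x) * msin x - sin (t * x) * mcos x =
  - \int[mu]_s (sinM (x, s) * K (t - s)).
Proof.
have I1 := L1_slice x measurable_cosM normr_cosM IK.
have I2 := L1_slice x measurable_sinM normr_sinM IK.
have I3 := L1_slice x measurable_sinM normr_sinM (IKt t).
rewrite /mcos /msin -!RintegralZl// -RintegralB//; [|exact: L1Z..].
rewrite -[in RHS](Rintegral_reflect t)// -mulN1r -RintegralZl//; last first.
  exact: (L1_reflect t I3).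
apply: eq_Rintegral => s _.
rewrite /cosM /sinM/= subKr mulrBr sinB (mulrC x t); ring.
Qed.

(** Exact for every N: the truncation acts on the frequency variable, where it commutes with
    multiplication by the symbol, and it makes [p] and [q] integrable, as Fubini requires. *)
Lemma IR_conv N p q : L2 p -> L2 q ->
  IR N (mulr_re p q) (mulr_im p q) = conv K (IR N p q).
Proof.
move=> Lp Lq; apply/funext => t.
have Lr := L2_mulr_re Lp Lq; have Li := L2_mulr_im Lp Lq.
have Tp := L1_trunc N Lp; have Tq := L1_trunc N Lq.
transitivity (hc * \int[mu]_x (trunc N p x * \int[mu]_s (cosM (x, s) * K (t - s)))
   - hc * \int[mu]_x (trunc N q x * \int[mu]_s (sinM (x, s) * K (t - s)))).
  rewrite /IR /CT /ST -!mulrBr; congr (_ * _).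
  rewrite -RintegralB//; [|exact: Icos|exact: Isin].
  rewrite -RintegralB//; last 2 first.
  - exact: (L1_kernel measurable_cosM normr_cosM Tp (IKt t)).
  - exact: (L1_kernel measurable_sinM normr_sinM Tq (IKt t)).
  apply: eq_Rintegral => x _.
  rewrite -shift_cos -[X in _ = _ - _ * X]opprK -shift_sin.
  by rewrite /trunc /mulr_re /mulr_im /cosM /sinM/=; ring.
rewrite (Fubini_kernel measurable_cosM normr_cosM Tp (IKt t)).
rewrite (Fubini_kernel measurable_sinM normr_sinM Tq (IKt t)).
have J (k : R * R -> R) w : measurable_fun setT k -> (forall z, `|k z| <= 1) ->
    L1 w -> L1 (fun s => K (t - s) * \int[mu]_x (k (x, s) * w x)).
  move=> mk k1 Iw.
  have mk' : measurable_fun setT (fun z : R * R => k (z.2, z.1)).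
    apply: measurableT_comp => //.
    by apply: measurable_fun_pair.
  exact: (@L1_kernel _ _ _ (fun z => k (z.2, z.1)) 1 mk' (fun z => k1 _) (IKt t) Iw).
rewrite -mulrBr -RintegralB//; last 2 first.
- exact: (J _ _ measurable_cosM normr_cosM).
- exact: (J _ _ measurable_sinM normr_sinM).
have IW := L1B (J _ _ measurable_cosM normr_cosM Tp)
  (J _ _ measurable_sinM normr_sinM Tq).
rewrite /conv -[LHS](RintegralZl hc measurableT IW).
apply: eq_Rintegral => s _; rewrite /IR /CT /ST /= -!mulrBr mulrCA.
congr (_ * (_ * (_ - _))); apply: eq_Rintegral => x _;
  by rewrite /cosM /sinM/= (mulrC x).
Qed.

Theorem G2_conv p q a b : L2 p -> L2 q -> L2 a -> L2 b -> G2 p q a b ->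
  G2 (mulr_re p q) (mulr_im p q) (conv K a) (conv K b).
Proof.
move=> Lp Lq La Lb [ca cb]; split.
  under eq_fun do rewrite IR_conv//.
  by apply: (cvg2_conv IK K0 k0) => // n; exact: L2_IR.
have LpN := L2N Lp.
(* The imaginary part of an inverse transform is the real part of that of -i (p + i q) = q - i p, so
   [IR_conv] applies to the pair (q, -p). *)
have -> : (fun n => IR n%:R (mulr_im p q) (fun x => - mulr_re p q x)) =
    (fun n => conv K (IR n%:R q (fun x => - p x))).
  apply/funext => n; rewrite -IR_conv//; congr (IR _ _ _); apply/funext => x;
    rewrite /mulr_re /mulr_im; ring.
by apply: (cvg2_conv IK K0 k0) => // n; exact: L2_IR.
Qed.

End ConvolutionTheorem.

End FourierPairs.

(** * The Fourier-Laplace transform of vector-valued functions *)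

Section WeightedComponents.
Context {R : realType} {n : nat}.
Local Notation mu := (@lebesgue_measure R).
Implicit Types (g h k v : R -> 'I_n -> R[i]) (rho N t xi : R) (i : 'I_n).

(** With the weight attached to the components, L^2_rho is plain L^2. Taking rho = 0 gives the
    unweighted components used on the frequency side. *)
Definition wre rho g i t := expR (- (rho * t)) * complex.Re (g t i).
Definition wim rho g i t := expR (- (rho * t)) * complex.Im (g t i).

Lemma measurable_weight rho :
  measurable_fun setT (fun t : R => expR (rho * t)).
Proof. by apply: measurableT_comp => //; exact: measurable_funM. Qed.

Lemma measurable_weightN rho :
  measurable_fun setT (fun t : R => expR (- (rho * t))).
Proof.
by apply: measurableT_comp => //; apply: measurableT_comp => //; exact: measurable_funM.
Qed.

Lemma vmeas_w rho g : vmeas setT g <->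
  forall i, measurable_fun setT (wre rho g i) /\ measurable_fun setT (wim rho g i).
Proof.
have me := measurable_weightN rho; have me' := measurable_weight rho.
have U (w u : R -> R) : u = (fun t => expR (rho * t) * (expR (- (rho * t)) * u t)).
  apply/funext => t; rewrite mulrA -expRD subrr expR0 mul1r//.
split=> H i; have [H1 H2] := H i; split.
- exact: measurable_funM.
- exact: measurable_funM.
- by rewrite (U id (fun t => _)); exact: measurable_funM.
- by rewrite (U id (fun t => _)); exact: measurable_funM.
Qed.

Lemma vnorm2_weight rho g t : vnorm2 (g t) * expR (- (2 * rho * t)) =
  \sum_(i < n) (wre rho g i t ^+ 2 + wim rho g i t ^+ 2).
Proof.
rewrite /vnorm2 mulr_suml; apply: eq_bigr => i _.
rewrite /wre /wim !exprMn -mulrDr [RHS]mulrC; congr (_ * _).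
by rewrite expr2 -expRD; congr expR; ring.
Qed.

Lemma integral_vnorm2 rho g : vmeas setT g ->
  (\int[mu]_t (vnorm2 (g t) * expR (- (2 * rho * t)))%:E =
   \sum_(i < n) (nsq (wre rho g i) + nsq (wim rho g i)))%E.
Proof.
move=> /(vmeas_w rho) mg.
under eq_integral do rewrite vnorm2_weight -sumEFin.
rewrite ge0_integral_sum//; last 2 first.
- move=> i; have [m1 m2] := mg i; apply/measurable_EFinP.
  by apply: measurable_funD; exact: measurable_funX.
- by move=> i x _; rewrite lee_fin addr_ge0// sqr_ge0.
apply: eq_bigr => i _; have [m1 m2] := mg i.
under eq_integral do rewrite EFinD.
rewrite ge0_integralD//.
- by move=> x _; rewrite lee_fin sqr_ge0.
- exact: measurable_sqr.
- by move=> x _; rewrite lee_fin sqr_ge0.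
- exact: measurable_sqr.
Qed.

Lemma le_sum_component (x : 'I_n -> \bar R) i : (forall j, 0 <= x j)%E ->
  (x i <= \sum_(j < n) x j)%E.
Proof. by move=> x0; rewrite (bigD1 i)//= leeDl// sume_ge0. Qed.

Let comp_ge0 (u v : 'I_n -> R -> R) i : (0 <= nsq (u i) + nsq (v i))%E.
Proof. by rewrite adde_ge0 ?nsq_ge0. Qed.

Lemma L2wP rho g : L2w setT rho g <->
  forall i, L2 (wre rho g i) /\ L2 (wim rho g i).
Proof.
split=> [[mg +] i|H].
  rewrite integral_vnorm2// => fg.
  have := le_lt_trans (le_sum_component i (comp_ge0 _ _)) fg => h.
  have [m1 m2] := (vmeas_w rho g).1 mg i.
  by split; split => //; apply: le_lt_trans h; rewrite ?leeDl ?leeDr ?nsq_ge0.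
have mg : vmeas setT g by apply/(vmeas_w rho) => i; have [[] + _ []] := H i.
split => //; rewrite integral_vnorm2//.
apply: lte_sum_pinfty => i _; have [[_ h1] [_ h2]] := H i.
exact: lte_add_pinfty.
Qed.

Lemma cvg_components rho (g_ : nat -> R -> 'I_n -> R[i]) g :
  (forall m, vmeas setT (g_ m)) -> vmeas setT g ->
  ((fun m => \int[mu]_t
      (vnorm2 (vsub (g t) (g_ m t)) * expR (- (2 * rho * t)))%:E)%E @ \oo --> 0%E) <->
  (forall i, cvg2 (fun m => wre rho (g_ m) i) (wre rho g i) /\
             cvg2 (fun m => wim rho (g_ m) i) (wim rho g i)).
Proof.
move=> mg_ mg.
have mB m : vmeas setT (fun t => vsub (g t) (g_ m t)).
  by move=> i; have [? ?] := mg i; have [? ?] := mg_ m i; split;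
    [under eq_fun do rewrite raddfB|under eq_fun do rewrite raddfB];
    exact: measurable_funB.
have E m : (\int[mu]_t
      (vnorm2 (vsub (g t) (g_ m t)) * expR (- (2 * rho * t)))%:E =
  \sum_(i < n) (nsq (wre rho (g_ m) i \- wre rho g i)%R +
                nsq (wim rho (g_ m) i \- wim rho g i)%R))%E.
  rewrite (integral_vnorm2 rho (mB m)); apply: eq_bigr => i _.
  by congr (_ + _)%E; rewrite nsqBC; congr nsq; apply/funext => t;
    rewrite /wre /wim /= /vsub raddfB mulrBr.
under eq_fun do rewrite E.
have x0 m i := comp_ge0 (fun i => wre rho (g_ m) i \- wre rho g i)
  (fun i => wim rho (g_ m) i \- wim rho g i) i.
split=> [H i|H].
  have L m := le_sum_component i (x0 m).
  by split; apply: cvg2_squeeze H => m; apply: le_trans (L m);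
    rewrite ?leeDl ?leeDr ?nsq_ge0.
rewrite [X in _ --> X](_ : _ = \sum_(i < n) 0)%E; last by rewrite big1.
apply: cvg_nnesum => // i _; first exact: nearW.
have [h1 h2] := H i; rewrite -[0%E]adde0; exact: cvgeD.
Qed.

Lemma Rintegral_trunc N (F : R -> R) :
  \int[mu]_(x in `[- N, N]) F x = \int[mu]_x trunc N F x.
Proof.
rewrite Rintegral_mkcond; apply: eq_Rintegral => x _.
by rewrite patchE /trunc indE mem_setE in_itv/=; case: ifP; rewrite ?mul1r ?mul0r.
Qed.

(** Splitting e^(-(rho + i xi) t) into the weight and e^(-i xi t) leaves the truncated Fourier
    integral of the weighted components. In the adjoint case below, the weight cancels the factor
    e^(rho t) in front of the integral. *)
Lemma FLtrunc_wre rho g N i : L2w setT rho g ->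
  wre 0 (FLtrunc rho g N) i = IR N (wre rho g i) (fun t => - wim rho g i t).
Proof.
move=> /L2wP /(_ i) [L1g L2g]; apply/funext => xi.
rewrite /wre mul0r oppr0 expR0 mul1r /FLtrunc /c_sqrt2pi_inv /= mul0r subr0.
rewrite -/hc /IR ST_oppr// opprK /CT /ST -mulrDr; congr (_ * _).
have I1 := L1_slice xi measurable_cosM normr_cosM (L1_trunc N L1g).
have I2 := L1_slice xi measurable_sinM normr_sinM (L1_trunc N L2g).
rewrite -RintegralD// Rintegral_trunc; apply: eq_Rintegral => t _.
rewrite /cosM /sinM /trunc /wre /wim /=; case: (g t i) => a b /=.
by rewrite !(mul0r, mulr0, subr0, add0r, addr0) sinN cosN; ring.
Qed.

Lemma FLtrunc_wim rho g N i : L2w setT rho g ->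
  wim 0 (FLtrunc rho g N) i = IR N (wim rho g i) (wre rho g i).
Proof.
move=> /L2wP /(_ i) [L1g L2g]; apply/funext => xi.
rewrite /wim mul0r oppr0 expR0 mul1r /FLtrunc /c_sqrt2pi_inv /= mul0r addr0.
rewrite -/hc /IR /CT /ST -mulrBr; congr (_ * _).
have I1 := L1_slice xi measurable_cosM normr_cosM (L1_trunc N L2g).
have I2 := L1_slice xi measurable_sinM normr_sinM (L1_trunc N L1g).
rewrite -RintegralB// Rintegral_trunc; apply: eq_Rintegral => t _.
rewrite /cosM /sinM /trunc /wre /wim /=; case: (g t i) => a b /=.
by rewrite !(mul0r, mulr0, subr0, add0r, addr0) sinN cosN; ring.
Qed.

Lemma FLadjtrunc_wre rho k N i : L2w setT 0 k ->
  wre rho (FLadjtrunc rho k N) i = IR N (wre 0 k i) (wim 0 k i).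
Proof.
move=> /L2wP /(_ i) [L1g L2g]; apply/funext => t.
rewrite /wre /FLadjtrunc /c_sqrt2pi_inv /= mul0r subr0.
rewrite -/hc /IR /CT /ST -mulrBr mulrCA; congr (_ * _).
have I1 := L1_slice t measurable_cosM normr_cosM (L1_trunc N L1g).
have I2 := L1_slice t measurable_sinM normr_sinM (L1_trunc N L2g).
rewrite -RintegralB// Rintegral_trunc.
transitivity (expR (- (rho * t)) * (expR (rho * t) * \int[mu]_x
  (cosM (t, x) * trunc N (wre 0 k i) x - sinM (t, x) * trunc N (wim 0 k i) x))).
  congr (_ * _); rewrite -RintegralZl//; last exact: L1B.
  apply: eq_Rintegral => x _.
  rewrite /cosM /sinM /trunc /wre /wim /=; case: (k x i) => a b /=.
  by rewrite !(mul0r, mulr0, subr0, add0r, addr0, oppr0, expR0, mul1r) (mulrC x); ring.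
by rewrite mulrA -expRD addNr expR0 mul1r.
Qed.

Lemma FLadjtrunc_wim rho k N i : L2w setT 0 k ->
  wim rho (FLadjtrunc rho k N) i = IR N (wim 0 k i) (fun x => - wre 0 k i x).
Proof.
move=> /L2wP /(_ i) [L1g L2g]; apply/funext => t.
rewrite /wim /FLadjtrunc /c_sqrt2pi_inv /= mul0r addr0.
rewrite -/hc /IR ST_oppr// opprK /CT /ST -mulrDr mulrCA; congr (_ * _).
have I1 := L1_slice t measurable_cosM normr_cosM (L1_trunc N L2g).
have I2 := L1_slice t measurable_sinM normr_sinM (L1_trunc N L1g).
rewrite -RintegralD// Rintegral_trunc.
transitivity (expR (- (rho * t)) * (expR (rho * t) * \int[mu]_x
  (cosM (t, x) * trunc N (wim 0 k i) x + sinM (t, x) * trunc N (wre 0 k i) x))).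
  congr (_ * _); rewrite -RintegralZl//; last exact: L1D.
  apply: eq_Rintegral => x _.
  rewrite /cosM /sinM /trunc /wre /wim /=; case: (k x i) => a b /=.
  by rewrite !(mul0r, mulr0, subr0, add0r, addr0, oppr0, expR0, mul1r) (mulrC x); ring.
by rewrite mulrA -expRD addNr expR0 mul1r.
Qed.

Lemma vmeas_FLtrunc rho g N : L2w setT rho g -> vmeas setT (FLtrunc rho g N).
Proof.
move=> Lg; apply/(vmeas_w 0) => i; have [La Lb] := (L2wP rho g).1 Lg i.
rewrite FLtrunc_wre// FLtrunc_wim//.
by split; [have [] := L2_IR N La (L2N Lb)|have [] := L2_IR N Lb La].
Qed.

Lemma vmeas_FLadjtrunc rho k N : L2w setT 0 k -> vmeas setT (FLadjtrunc rho k N).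
Proof.
move=> Lk; apply/(vmeas_w rho) => i; have [La Lb] := (L2wP 0 k).1 Lk i.
rewrite FLadjtrunc_wre// FLadjtrunc_wim//.
by split; [have [] := L2_IR N La Lb|have [] := L2_IR N Lb (L2N La)].
Qed.

Lemma FLP rho g h : L2w setT rho g -> L2w setT 0 h -> FL rho g h <->
  forall i, F2 (wre rho g i) (wim rho g i) (wre 0 h i) (wim 0 h i).
Proof.
move=> Lg Lh.
have mt m := vmeas_FLtrunc m%:R Lg.
have := cvg_components 0 mt Lh.1.
under [in X in (X @ _ --> _) <-> _]eq_fun do
  under eq_integral do rewrite mulr0 mul0r oppr0 expR0 mulr1.
move=> C; rewrite /FL; split=> [[_ [_ /C H]] i|H].
  have [] := H i; under eq_fun do rewrite FLtrunc_wre//.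
  by under [in X in _ -> X]eq_fun do rewrite FLtrunc_wim//; split.
do 2 split => //; apply/C => i; have [] := H i; split.
  by under eq_fun do rewrite FLtrunc_wre//.
by under eq_fun do rewrite FLtrunc_wim//.
Qed.

Lemma FLadjP rho k v : L2w setT 0 k -> L2w setT rho v -> FLadj rho k v <->
  forall i, G2 (wre 0 k i) (wim 0 k i) (wre rho v i) (wim rho v i).
Proof.
move=> Lk Lv.
have mt m := vmeas_FLadjtrunc rho m%:R Lk.
have C := cvg_components rho mt Lv.1.
rewrite /FLadj; split=> [[_ [_ /C H]] i|H].
  have [h1 h2] := H i; split.
    by move: h1; under eq_fun do rewrite FLadjtrunc_wre//.
  by move: h2; under eq_fun do rewrite FLadjtrunc_wim//.
do 2 split => //; apply/C => i; have [h1 h2] := H i; split.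
  by under eq_fun do rewrite FLadjtrunc_wre//.
by under eq_fun do rewrite FLadjtrunc_wim//.
Qed.

Lemma FL_FLadj rho g h : FL rho g h <-> FLadj rho h g.
Proof.
split=> H; have [L1 [L2 _]] := H.
  apply/FLadjP => // i; have := (FLP L1 L2).1 H i.
  have [? ?] := (L2wP _ _).1 L1 i; have [? ?] := (L2wP _ _).1 L2 i.
  by apply: (fourier_inversion _ _ _ _).1.
apply/FLP => // i; have := (FLadjP L1 L2).1 H i.
have [? ?] := (L2wP _ _).1 L1 i; have [? ?] := (L2wP _ _).1 L2 i.
by apply: (fourier_inversion _ _ _ _).2.
Qed.

Lemma FL_exists rho g : L2w setT rho g -> exists h, FL rho g h.
Proof.
move=> Lg; have C i : exists pq : (R -> R) * (R -> R), [/\ L2 pq.1, L2 pq.2 &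
    F2 (wre rho g i) (wim rho g i) pq.1 pq.2].
  have [H1 H2] := (L2wP _ _).1 Lg i.
  by have [p [q ?]] := fourier_exists H1 H2; exists (p, q).
have {}C := boolp.choice C.
have [h Hh] := C; pose k := fun t i => Complex ((h i).1 t) ((h i).2 t).
have kre i : wre 0 k i = (h i).1.
  by apply/funext => t; rewrite /wre mul0r oppr0 expR0 mul1r.
have kim i : wim 0 k i = (h i).2.
  by apply/funext => t; rewrite /wim mul0r oppr0 expR0 mul1r.
have Lk : L2w setT 0 k by apply/L2wP => i; rewrite kre kim; have [] := Hh i.
by exists k; apply/FLP => // i; rewrite kre kim; have [] := Hh i.
Qed.

(** * Changes of representative and uniqueness almost everywhere *)

Lemma eq_ae_component (F : R[i] -> R) g h : {ae mu, forall t, g t = h t} ->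
  forall i, {ae mu, forall t, F (g t i) = F (h t i)}.
Proof. by move=> gh i; apply: aeS gh => t ->. Qed.

Lemma eq_L2w_ae rho g h : vmeas setT h -> {ae mu, forall t, g t = h t} ->
  L2w setT rho g -> L2w setT rho h.
Proof.
move=> /(vmeas_w rho) mh gh /L2wP Lg; apply/L2wP => i.
have [[m1 f1] [m2 f2]] := Lg i; have [m3 m4] := mh i.
split; split => //.
  rewrite -(@eq_nsq_ae _ (wre rho g i))//.
  by apply: aeS (eq_ae_component (@complex.Re R) gh i) => t e; rewrite /wre e.
rewrite -(@eq_nsq_ae _ (wim rho g i))//.
by apply: aeS (eq_ae_component (@complex.Im R) gh i) => t e; rewrite /wim e.
Qed.

Lemma eq_cvg2_ae (u_ : nat -> R -> R) (u v : R -> R) :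
  (forall m, measurable_fun setT (u_ m)) -> measurable_fun setT u ->
  measurable_fun setT v -> {ae mu, forall t, u t = v t} -> cvg2 u_ u -> cvg2 u_ v.
Proof.
move=> mu_ mu1 mv uv; rewrite /cvg2.
under eq_fun => m.
  rewrite (@eq_nsq_ae _ (u_ m \- u) (u_ m \- v)); last 3 first.
  - exact: measurable_funB.
  - exact: measurable_funB.
  - by apply: aeS uv => t /= ->.
  over.
by [].
Qed.

Lemma eq_FLadj_ae rho k g h : vmeas setT h -> {ae mu, forall t, g t = h t} ->
  FLadj rho k g -> FLadj rho k h.
Proof.
move=> mh gh H; have [Lk [Lg _]] := H; have Lh := eq_L2w_ae mh gh Lg.
apply/FLadjP => // i; have [c1 c2] := (FLadjP Lk Lg).1 H i.
have [Lp Lq] := (L2wP _ _).1 Lk i.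
have [[m1 _] [m2 _]] := (L2wP _ _).1 Lg i.
have [[m3 _] [m4 _]] := (L2wP _ _).1 Lh i.
split.
  apply: eq_cvg2_ae c1 => //; first by move=> m; have [] := L2_IR m%:R Lp Lq.
  by apply: aeS (eq_ae_component (@complex.Re R) gh i) => t e; rewrite /wre e.
apply: eq_cvg2_ae c2 => //; first by move=> m; have [] := L2_IR m%:R Lq (L2N Lp).
by apply: aeS (eq_ae_component (@complex.Im R) gh i) => t e; rewrite /wim e.
Qed.

Lemma ae_forall_ord (P : 'I_n -> R -> Prop) :
  (forall i, {ae mu, forall t, P i t}) -> {ae mu, forall t, forall i, P i t}.
Proof.
move=> H; have : {ae mu, forall t, forall k : nat, forall i : 'I_n, i = k :> nat -> P i t}.
  apply: ae_foralln => k; have [kn|nk] := ltnP k n; last first.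
    by apply: aeW => t i ik; move: nk; rewrite -ik leqNgt ltn_ord.
  apply: aeS (H (Ordinal kn)) => t Pt i ik.
  by rewrite (_ : i = Ordinal kn)//; exact: val_inj.
by apply: aeS => t Pt i; exact: (Pt i).
Qed.

Lemma FLadj_unique rho k g h : FLadj rho k g -> FLadj rho k h ->
  {ae mu, forall t, g t = h t}.
Proof.
move=> H1 H2; have [Lk [Lg _]] := H1; have [_ [Lh _]] := H2.
have : {ae mu, forall t, forall i, g t i = h t i}.
  apply: ae_forall_ord => i.
  have [c1 c2] := (FLadjP Lk Lg).1 H1 i; have [d1 d2] := (FLadjP Lk Lh).1 H2 i.
  have [Lp Lq] := (L2wP _ _).1 Lk i.
  have [[m1 _] [m2 _]] := (L2wP _ _).1 Lg i.
  have [[m3 _] [m4 _]] := (L2wP _ _).1 Lh i.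
  have mm m := (L2_IR m%:R Lp Lq).1; have mm' m := (L2_IR m%:R Lq (L2N Lp)).1.
  have e1 := cvg2_unique mm m1 m3 c1 d1; have e2 := cvg2_unique mm' m2 m4 c2 d2.
  apply: aeS (aeI e1 e2) => t; rewrite /wre /wim => -[f1 f2].
  have e0 : expR (- (rho * t)) != 0 by rewrite gt_eqF// expR_gt0.
  move: (mulfI e0 f1) (mulfI e0 f2).
  by case: (g t i) (h t i) => a b [a' b'] /= -> ->.
by apply: aeS => t e; apply/funext.
Qed.

End WeightedComponents.

(** * Fractional integration *)

Section FractionalIntegral.
Context {R : realType} {alpha rho : R}.
Hypotheses (alpha01 : 0 < alpha <= 1) (rho0 : 0 < rho).
Local Notation mu := (@lebesgue_measure R).

(** The normalized fractional kernel with the weight e^(-rho s) absorbed. The cut-off [chi] discards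
    negative times, where the power only has its default values. *)
Definition fracK (s : R) : R := (Gamma alpha)^-1 * (chi s * gker alpha rho s).

Let G0 : 0 < Gamma alpha. Proof. exact: Gamma_gt0. Qed.

Lemma fracK_ge0 s : 0 <= fracK s.
Proof.
rewrite /fracK mulr_ge0// ?invr_ge0 ?(ltW G0)// mulr_ge0// ?gker_ge0//.
by rewrite /chi; case: ifP.
Qed.

Let chi_patch (h : R -> R) :
  (fun s => chi s * h s) = patch (fun=> 0) `]0, +oo[%classic h.
Proof.
apply/funext => s; rewrite patchE /chi mem_setE in_itv/= andbT.
by case: ifP; rewrite ?mul1r ?mul0r.
Qed.

Lemma L1_fracK : L1 fracK.
Proof.
apply: (@L1Z _ _ (fun s => chi s * gker alpha rho s)); rewrite chi_patch.
have := integrable_gker alpha01 rho0.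
by rewrite integrable_mkcond// restrict_EFin.
Qed.

Let Rintegral_fracK (h : R -> R) (M : R) : measurable_fun setT h ->
  (forall s, `|h s| <= M) ->
  \int[mu]_s (h s * fracK s) =
  (Gamma alpha)^-1 * \int[mu]_(s in `]0, +oo[) (gker alpha rho s * h s).
Proof.
move=> mh hM; have I := integrable_gker_bounded alpha01 rho0 mh hM.
rewrite -RintegralZl//.
rewrite [RHS]Rintegral_mkcond; apply: eq_Rintegral => s _.
rewrite /fracK patchE /chi mem_setE in_itv/= andbT.
by case: ifP => _; [ring|rewrite mul0r !mulr0].
Qed.

Let S (x : R) := rho ^+ 2 + x ^+ 2.

Let S_gt0 x : 0 < S x.
Proof. by rewrite /S ltr_wpDr ?sqr_ge0// exprn_gt0. Qed.

Lemma mcos_fracK x : mcos fracK x =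
  S x `^ (- alpha / 2) * cos (alpha * atan (rho^-1 * x)).
Proof.
rewrite /mcos (@Rintegral_fracK (fun s => cosM (x, s)) 1); last 2 first.
- rewrite /cosM /=; apply: measurableT_comp; first exact: measurable_cos.
  exact: measurable_funM.
- by move=> s; exact: normr_cosM.
rewrite /cosM/= laplace_cos// mulNr powRN.
by rewrite !mulrA mulVf ?mul1r// gt_eqF.
Qed.

Lemma msin_fracK x : msin fracK x =
  S x `^ (- alpha / 2) * sin (alpha * atan (rho^-1 * x)).
Proof.
rewrite /msin (@Rintegral_fracK (fun s => sinM (x, s)) 1); last 2 first.
- rewrite /sinM /=; apply: measurableT_comp; first exact: measurable_sin.
  exact: measurable_funM.
- by move=> s; exact: normr_sinM.
rewrite /sinM/= laplace_sin// mulNr powRN.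
by rewrite !mulrA mulVf ?mul1r// gt_eqF.
Qed.

Lemma Rintegral_fracK_gt0 : 0 < \int[mu]_s fracK s.
Proof.
have -> : \int[mu]_s fracK s = mcos fracK 0.
  by apply: eq_Rintegral => s _; rewrite /cosM/= mul0r cos0 mul1r.
by rewrite mcos_fracK mulr0 atan0 mulr0 cos0 mulr1 powR_gt0.
Qed.

(** As rho > 0, the point rho + i xi stays in the right half-plane: the branch cut is never met and
    the argument is the arctangent of xi / rho. *)
Lemma cpow_polar gamma xi : cpow (Complex rho xi) gamma =
  Complex (S xi `^ (gamma / 2) * cos (gamma * atan (rho^-1 * xi)))
          (S xi `^ (gamma / 2) * sin (gamma * atan (rho^-1 * xi))).
Proof.
rewrite /cpow ifF; last by apply/eqP => -[] r0; move: rho0; rewrite r0 ltxx.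
rewrite /cabs /carg/= rho0 /cexp/= expR0 -/(S xi) -powR12_sqrt ?(ltW (S_gt0 _))//.
rewrite -powRrM (mulrC 2^-1) (mulrC xi) !mul1r.
by apply/eqP; rewrite eq_complex/= !mul0r addr0 subr0 !eqxx.
Qed.

Lemma cpow_fracK xi : cpow (Complex rho xi) (- alpha) =
  Complex (mcos fracK xi) (- msin fracK xi).
Proof.
by rewrite cpow_polar mcos_fracK msin_fracK (mulNr _ (atan _)) sinN cosN mulrN.
Qed.

Lemma cpowNK xi : cpow (Complex rho xi) alpha * cpow (Complex rho xi) (- alpha) = 1.
Proof.
have h : S xi `^ (alpha / 2) * S xi `^ (- alpha / 2) = 1.
  by rewrite -powRD ?(gt_eqF (S_gt0 _)) ?implybT// -mulrDl subrr mul0r powRr0.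
rewrite !cpow_polar (mulNr _ (atan _)) cosN sinN; set th := _ * atan _.
have c := cos2Dsin2 th; apply/eqP; rewrite eq_complex/=; apply/andP; split.
  apply/eqP; transitivity (S xi `^ (alpha / 2) * S xi `^ (- alpha / 2) *
     (cos th ^+ 2 + sin th ^+ 2)); first by ring.
  by rewrite h c mulr1.
by apply/eqP; ring.
Qed.

Variable n : nat.
Implicit Types (g h : R -> 'I_n -> R[i]).

(** The fractional integral, obtained by convolving the weighted components and then removing the
    weight. It is thus defined at every t, and [fracI_ae] identifies it almost everywhere with the
    integral in (i). *)
Definition fracI g t i : R[i] :=
  Complex (expR (rho * t) * conv fracK (wre rho g i) t)
          (expR (rho * t) * conv fracK (wim rho g i) t).

Lemma wre_fracI g i : wre rho (fracI g) i = conv fracK (wre rho g i).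
Proof. by apply/funext => t; rewrite /wre /= mulrA -expRD addNr expR0 mul1r. Qed.

Lemma wim_fracI g i : wim rho (fracI g) i = conv fracK (wim rho g i).
Proof. by apply/funext => t; rewrite /wim /= mulrA -expRD addNr expR0 mul1r. Qed.

Lemma FLadj_fracI h g : FLadj rho h g ->
  FLadj rho (fun xi i => cpow (Complex rho xi) (- alpha) * h xi i) (fracI g).
Proof.
move=> H; have [Lh [Lg _]] := H; set k := fun xi i => _.
have kre i : wre 0 k i = fun x => mcos fracK x * wre 0 h i x +
                                  msin fracK x * wim 0 h i x.
  apply/funext => x; rewrite /wre /wim /k cpow_fracK mul0r oppr0 expR0 !mul1r.
  by case: (h x i) => a b /=; rewrite mulNr opprK.
have kim i : wim 0 k i = fun x => mcos fracK x * wim 0 h i x -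
                                  msin fracK x * wre 0 h i x.
  apply/funext => x; rewrite /wre /wim /k cpow_fracK mul0r oppr0 expR0 !mul1r.
  by case: (h x i) => a b /=; rewrite mulNr.
have Lk : L2w setT 0 k.
  apply/L2wP => i; have [Lp Lq] := (L2wP _ _).1 Lh i; rewrite kre kim; split.
    exact: (L2_mulr_re L1_fracK fracK_ge0 Lp Lq).
  exact: (L2_mulr_im L1_fracK fracK_ge0 Lp Lq).
have LI : L2w setT rho (fracI g).
  apply/L2wP => i; have [La Lb] := (L2wP _ _).1 Lg i.
  rewrite wre_fracI wim_fracI.
  by split; apply: (L2_conv L1_fracK fracK_ge0 Rintegral_fracK_gt0).
apply/FLadjP => // i; rewrite kre kim wre_fracI wim_fracI.
have [Lp Lq] := (L2wP _ _).1 Lh i; have [La Lb] := (L2wP _ _).1 Lg i.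
apply: (G2_conv L1_fracK fracK_ge0 Rintegral_fracK_gt0) => //.
exact: ((FLadjP Lh Lg).1 H i).
Qed.

(** Splitting e^(-rho t) as e^(-rho (t-s)) e^(-rho s) lets the weight leave the integral, and the
    cut-off at t - s restricts the integration to s < t. *)
Let kernelE t (a : R -> R) s : fracK (t - s) * (expR (- (rho * s)) * a s) =
  ((Gamma alpha)^-1 * expR (- (rho * t))) *
  patch (fun=> 0) `]-oo, t[%classic (fun s => (t - s) `^ (alpha - 1) * a s) s.
Proof.
rewrite /fracK /gker patchE /chi mem_setE in_itv/= subr_gt0.
case: ifP => _; last by rewrite !(mul0r, mulr0).
have -> : expR (- (rho * t)) = expR (- (rho * (t - s))) * expR (- (rho * s)).
  by rewrite -expRD; congr expR; ring.
by ring.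
Qed.

Lemma fracK_integrable t (a : R -> R) :
  L1 (fun s => fracK (t - s) * (expR (- (rho * s)) * a s)) ->
  mu.-integrable `]-oo, t[ (EFin \o (fun s => (t - s) `^ (alpha - 1) * a s)) /\
  expR (rho * t) * conv fracK (fun s => expR (- (rho * s)) * a s) t =
  (Gamma alpha)^-1 * \int[mu]_(s in `]-oo, t[) ((t - s) `^ (alpha - 1) * a s).
Proof.
move=> I; set r := fun s => (t - s) `^ (alpha - 1) * a s.
have c0 : (Gamma alpha)^-1 * expR (- (rho * t)) != 0.
  by rewrite mulf_neq0// ?invr_eq0 gt_eqF// expR_gt0.
have I2 : L1 (patch (fun=> 0) `]-oo, t[%classic r).
  have := L1Z ((Gamma alpha)^-1 * expR (- (rho * t)))^-1 I.
  apply: eq_integrable => // s _ /=.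
  by rewrite kernelE mulrA mulVf// mul1r.
split; first by rewrite integrable_mkcond// restrict_EFin.
rewrite [in RHS]Rintegral_mkcond /conv; under eq_Rintegral do rewrite kernelE.
rewrite RintegralZl// mulrA; congr (_ * _).
by rewrite mulrCA -expRD subrr expR0 mulr1.
Qed.

Lemma fracI_ae g : L2w setT rho g -> {ae mu, forall t, forall i,
  cintegrable `]-oo, t[ (fun s => ((t - s) `^ (alpha - 1))%:C%C * g s i) /\
  fracI g t i = ((Gamma alpha)^-1)%:C%C *
    cint `]-oo, t[ (fun s => ((t - s) `^ (alpha - 1))%:C%C * g s i)}.
Proof.
move=> /L2wP Lg; apply: ae_forall_ord => i; have [La Lb] := Lg i.
apply: aeS (aeI (conv_ae_L1 L1_fracK fracK_ge0 La)
                (conv_ae_L1 L1_fracK fracK_ge0 Lb)) => t [Ia Ib].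
have [I1 e1] := fracK_integrable Ia; have [I2 e2] := fracK_integrable Ib.
have re s : complex.Re (((t - s) `^ (alpha - 1))%:C%C * g s i) =
    (t - s) `^ (alpha - 1) * complex.Re (g s i).
  by case: (g s i) => x y /=; rewrite mul0r subr0.
have im s : complex.Im (((t - s) `^ (alpha - 1))%:C%C * g s i) =
    (t - s) `^ (alpha - 1) * complex.Im (g s i).
  by case: (g s i) => x y /=; rewrite mul0r addr0.
split.
  split; [apply: eq_integrable I1|apply: eq_integrable I2] => // s _ /=.
    by rewrite re.
  by rewrite im.
apply/eqP; rewrite eq_complex /fracI e1 e2 /cint /= !mul0r subr0 addr0.
have -> := eq_Rintegral mu (D := `]-oo, t[%classic) (fun s _ => re s).
by have -> := eq_Rintegral mu (D := `]-oo, t[%classic) (fun s _ => im s); rewrite !eqxx.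
Qed.

End FractionalIntegral.

(** * The superposition operator *)

Section Nemytskii.
Context {R : realType} {n : nat}.
Local Notation mu := (@lebesgue_measure R).
Implicit Types (v w : 'I_n -> R[i]) (d e t s : R).

Lemma vnorm2_ge0 v : 0 <= vnorm2 v.
Proof. by apply: sumr_ge0 => i _; rewrite addr_ge0// sqr_ge0. Qed.

Lemma component_le_vnorm2 v i :
  complex.Re (v i) ^+ 2 + complex.Im (v i) ^+ 2 <= vnorm2 v.
Proof.
rewrite /vnorm2 (bigD1 i)//= lerDl.
by apply: sumr_ge0 => j _; rewrite addr_ge0// sqr_ge0.
Qed.

Lemma normr_Re_le v i : `|complex.Re (v i)| <= vnorm v.
Proof.
rewrite -sqrtr_sqr ler_wsqrtr// (le_trans _ (component_le_vnorm2 v i))//.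
by rewrite lerDl sqr_ge0.
Qed.

Lemma normr_Im_le v i : `|complex.Im (v i)| <= vnorm v.
Proof.
rewrite -sqrtr_sqr ler_wsqrtr// (le_trans _ (component_le_vnorm2 v i))//.
by rewrite lerDr sqr_ge0.
Qed.

Lemma vnorm2_le_add v w : vnorm2 v <= 2 * vnorm2 (vsub v w) + 2 * vnorm2 w.
Proof.
rewrite /vnorm2 !mulr_sumr -big_split/=; apply: ler_sum => i _.
rewrite /vsub; case: (v i) (w i) => a b [a' b'] /=.
have h1 := sqr_ge0 (a - 2 * a'); have h2 := sqr_ge0 (b - 2 * b'); nra.
Qed.

Section Superposition.
Variables (phi : R -> ('I_n -> R[i]) -> R) (y : R -> 'I_n -> R[i]).
Hypothesis my : vmeas setT y.
Hypothesis phi_lsc : forall t v a, 0 < t -> a < phi t v -> exists2 d, 0 < d &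
  forall s w, 0 < s -> `|s - t| < d -> vnorm (vsub w v) < d -> a < phi s w.

(** A rational centre in time, one rational radius common to all coordinates, and rational centres
    for the real and imaginary part of each component. The type is countable, so unions over it
    preserve measurability. *)
Let box : Type := (rat * rat * {ffun 'I_n -> rat * rat})%type.
Let in_box (b : box) s w := [/\ 0 < s, `|s - ratr b.1.1| < ratr b.1.2 &
  forall i, `|complex.Re (w i) - ratr (b.2 i).1| < ratr b.1.2 /\
            `|complex.Im (w i) - ratr (b.2 i).2| < ratr b.1.2].

Let measurable_box b : measurable [set t | in_box b t (y t)].
Proof.
have B (g : R -> R) (q r : R) : measurable_fun setT g ->
    measurable [set t | `|g t - q| < r].
  move=> mg; have := @measurable_fun_ltr _ _ _ setT (fun t => `|g t - q|) (cst r).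
  move=> /(_ _ (measurable_cst _)) H; rewrite -[X in measurable X]setTI.
  apply: (measurable_fun_ltr _ _ measurableT) => //.
  by apply: measurableT_comp => //; exact: measurable_funB.
have -> : [set t | in_box b t (y t)] =
  `]0, +oo[%classic `&` [set t | `|t - ratr b.1.1| < ratr b.1.2] `&`
  \bigcap_(i in [set: 'I_n])
   ([set t | `|complex.Re (y t i) - ratr (b.2 i).1| < ratr b.1.2] `&`
    [set t | `|complex.Im (y t i) - ratr (b.2 i).2| < ratr b.1.2]).
  apply/seteqP; split => t.
    move=> [t0 h1 h2]; split; first by split => //=; rewrite in_itv/= t0.
    by move=> i _; have [] := h2 i.
  move=> [[/= + h1] h2]; rewrite in_itv/= andbT => t0; split => // i.
  by have [] := h2 i I.
apply: measurableI.
  by apply: measurableI => //; exact: B.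
apply: fin_bigcap_measurable => // i _; have [m1 m2] := my i.
by apply: measurableI; exact: B.
Qed.

Let box_around t v d : 0 < d -> 0 < t -> exists b, in_box b t v /\
  forall s w, in_box b s w -> `|s - t| < d /\ vnorm (vsub w v) < d.
Proof.
move=> d0 t0.
have n0 : 0 < 3 * n.+1%:R :> R by rewrite mulr_gt0// ltr0n.
(* Two points of a box of radius r differ by less than 2 r in each real coordinate, so their vector
   parts are at squared distance at most 8 n r^2 < (3 (n+1) r)^2. Using n + 1 also covers n = 0. *)
have e0 : 0 < d / (3 * n.+1%:R) by rewrite divr_gt0.
have [r] := rat_in_itvoo e0; rewrite in_itv/= => /andP[r0 re].
have approx (x : R) : exists q : rat, `|x - ratr q| < ratr r.
  have : x - ratr r < x + ratr r by lra.
  move=> /rat_in_itvoo [q]; rewrite in_itv/= => /andP[h1 h2]; exists q.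
  by rewrite ltr_norml; apply/andP; split; lra.
have [q hq] := approx t.
have [zr hzr] := boolp.choice (fun i => approx (complex.Re (v i))).
have [zi hzi] := boolp.choice (fun i => approx (complex.Im (v i))).
exists (q, r, [ffun i => (zr i, zi i)]); split.
  by split => //= i; rewrite ffunE.
move=> s w [/= s0 h1 h2].
have r3 : ratr r * (3 * n.+1%:R) < d by rewrite -ltr_pdivlMr.
have tri (x x' z : R) : `|x - z| < ratr r -> `|x' - z| < ratr r ->
    (x' - x) ^+ 2 <= 4 * ratr r ^+ 2.
  rewrite !ltr_norml => /andP[? ?] /andP[? ?].
  have -> : 4 * ratr r ^+ 2 = (2 * ratr r) ^+ 2 :> R by ring.
  rewrite -(real_normK (num_real (x' - x))) lerXn2r ?nnegrE//; first by lra.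
  by rewrite ler_norml; apply/andP; split; lra.
have n1 : 1 <= n.+1%:R :> R by rewrite ler1n.
have r3' : 3 * ratr r < d by apply: le_lt_trans r3; nra.
split.
  move: hq h1; rewrite !ltr_norml => /andP[? ?] /andP[? ?].
  by apply/andP; split; lra.
have nn : 0 <= n%:R :> R by [].
rewrite /vnorm -(ger0_norm (ltW d0)) -sqrtr_sqr ltr_sqrt ?exprn_gt0//.
apply: (@le_lt_trans _ _ (\sum_(i < n) 8 * ratr r ^+ 2)).
  apply: ler_sum => i _; have := h2 i; rewrite ffunE /= => -[h3 h4].
  have := tri _ _ _ (hzr i) h3; have := tri _ _ _ (hzi i) h4.
  rewrite /vsub; case: (w i) (v i) => a b [a' b'] /=; lra.
rewrite sumr_const card_ord -mulr_natl.
apply: (@lt_le_trans _ _ ((ratr r * (3 * n.+1%:R)) ^+ 2)).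
  rewrite -natr1; nra.
by rewrite lerXn2r ?nnegrE ?(ltW r3)// ?(ltW d0)// mulr_ge0 ?(ltW r0)// ltW.
Qed.

(** By lower semicontinuity the set where phi t (y t) > a is the union of the preimages, under t ->
    (t, y t), of the boxes on which [phi] exceeds a throughout. There are countably many of them,
    and each preimage is measurable because [y] is. *)
Lemma measurable_superposition :
  measurable_fun (`]0, +oo[%classic : set R) (fun t => phi t (y t)).
Proof.
apply: (measurability _ (RGenOInfty.measurableE R)) => _ [_ [a ->] <-].
pose good (b : box) := `[< forall s w, in_box b s w -> a < phi s w >].
have -> : `]0%R, +oo[%classic `&` (fun t => phi t (y t)) @^-1` `]a, +oo[%classic =
  \bigcup_(b in [set: box]) (if good b then [set t | in_box b t (y t)] else set0).
  apply/seteqP; split => t.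
    rewrite /= !in_itv/= !andbT => -[t0 at_].
    have [d d0 dP] := phi_lsc t0 at_; have [b [bt bP]] := box_around (y t) d0 t0.
    exists b => //; rewrite ifT//; apply/asboolP => s w bsw.
    by have [? ?] := bP _ _ bsw; apply: dP => //; case: bsw.
  move=> [b _]; case: ifP => // /asboolP gb bt.
  by rewrite /= !in_itv/= !andbT; split; [case: bt|exact: gb bt].
apply: countable_bigcupT_measurable => [|b]; first exact: countableP.
by case: ifP => // _; exact: measurable_box.
Qed.

End Superposition.

Variables (f : R -> ('I_n -> R[i]) -> 'I_n -> R[i]) (y : R -> 'I_n -> R[i]).
Hypothesis f_cont : cont_pos f.

Lemma vmeas_ftilde : vmeas setT y -> vmeas setT (fun t => ftilde f t (y t)).
Proof.
move=> my i.
have H (F : R[i] -> R) : (forall v w : 'I_n -> R[i], `|F (v i) - F (w i)| <= vnorm (vsub v w)) ->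
    F 0 = 0 -> measurable_fun setT (fun t => F (ftilde f t (y t) i)).
  move=> FL F0.
  have : measurable_fun (`]0, +oo[%classic : set R) (fun t => F (f t (y t) i)).
    apply: (@measurable_superposition (fun t v => F (f t v i)) y my).
    move=> t v a t0 av; have e0 : 0 < F (f t v i) - a by rewrite subr_gt0.
    have [d d0 dP] := f_cont v t0 e0; exists d => // s w s0 st wv.
    have := le_lt_trans (FL _ _) (dP s w s0 st wv).
    rewrite ltr_norml => /andP[+ _]; lra.
  have mI : measurable (`]0%R, +oo[%classic : set R) by [].
  move=> /(measurable_restrictT _ mI).
  congr measurable_fun; apply/funext => t.
  by rewrite patchE /ftilde mem_setE in_itv/= andbT; case: ifP.
split; apply: H => // v w.
  by have := normr_Re_le (vsub v w) i; rewrite /vsub raddfB.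
by have := normr_Im_le (vsub v w) i; rewrite /vsub raddfB.
Qed.

Variables (c rho0 rho : R).
Hypotheses (c0 : 0 <= c) (rho0_lt : rho0 < rho)
  (f_lip : forall t, 0 < t -> forall v w,
    vnorm (vsub (f t v) (f t w)) <= c * vnorm (vsub v w)).

Lemma vnorm2_lip t v : 0 < t ->
  vnorm2 (f t v) <= 2 * c ^+ 2 * vnorm2 v + 2 * vnorm2 (f t (fun=> 0)).
Proof.
move=> t0; apply: le_trans (vnorm2_le_add _ (f t (fun=> 0))) _.
rewrite lerD2r -mulrA ler_pM2l//.
have := f_lip t0 v (fun=> 0).
have -> : vsub v (fun=> 0) = v by apply/funext => i; rewrite /vsub subr0.
have vn (w : 'I_n -> R[i]) : vnorm w ^+ 2 = vnorm2 w by rewrite sqr_sqrtr// vnorm2_ge0.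
rewrite -!vn -exprMn => h.
by rewrite lerXn2r// nnegrE ?mulr_ge0 ?sqrtr_ge0.
Qed.

Lemma measurable_vnorm2 (D : set R) (g : R -> 'I_n -> R[i]) : vmeas D g ->
  measurable_fun D (fun t => vnorm2 (g t)).
Proof.
move=> mg; apply: measurable_sum => i; have [m1 m2] := mg i.
by apply: measurable_funD; exact: measurable_funX.
Qed.

Lemma L2w_integrable (D : set R) (r : R) (g : R -> 'I_n -> R[i]) : measurable D ->
  L2w D r g ->
  mu.-integrable D (EFin \o (fun t => vnorm2 (g t) * expR (- (2 * r * t)))).
Proof.
move=> mD [mg fg]; apply/integrableP; split.
  apply/measurable_EFinP; apply: measurable_funM; first exact: measurable_vnorm2.
  apply: measurable_funTS; exact: (measurable_weightN (2 * r)).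
rewrite (_ : (\int[mu]_(x in D) _)%E =
  \int[mu]_(t in D) (vnorm2 (g t) * expR (- (2 * r * t)))%:E)%E//.
by apply: eq_integral => t _ /=; rewrite ger0_norm// mulr_ge0 ?vnorm2_ge0 ?expR_ge0.
Qed.

(** The Lipschitz bound dominates the square of f(t, y) by 2 c^2 |y|^2 + 2 |f(t, 0)|^2. The first
    term lies in the right space already; for the second, e^(-2 rho t) <= e^(-2 rho0 t) since t > 0
    on the support. *)
Lemma L2w_ftilde : L2w `]0, +oo[ rho0 (fun t => f t (fun=> 0)) ->
  L2w setT rho y -> L2w setT rho (fun t => ftilde f t (y t)).
Proof.
move=> Lf Ly; have mF := vmeas_ftilde Ly.1; split => //.
have I1 := L2w_integrable measurableT Ly.
pose g0 t := vnorm2 (f t (fun=> 0)) * expR (- (2 * rho0 * t)).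
have I2 : L1 (patch (fun=> 0) `]0, +oo[%classic g0).
  have mI : measurable (`]0%R, +oo[%classic : set R) by [].
  have := L2w_integrable mI Lf.
  by rewrite integrable_mkcond// restrict_EFin.
have I3 : L1 (fun t => vnorm2 (ftilde f t (y t)) * expR (- (2 * rho * t))).
  have := L1D (L1Z (2 * c ^+ 2) I1) (L1Z 2 I2); apply: le_L1.
    apply: measurable_funM; first exact: measurable_vnorm2.
    exact: (measurable_weightN (2 * rho)).
  move=> t; rewrite ger0_norm ?mulr_ge0 ?vnorm2_ge0 ?expR_ge0//=.
  rewrite patchE /ftilde mem_setE in_itv/= andbT; case: ifPn => t0; last first.
    rewrite /vnorm2 big1; last by move=> i _ /=; rewrite expr0n addr0.
    rewrite mul0r addr_ge0 ?mulr_ge0 ?sqr_ge0 ?expR_ge0 ?vnorm2_ge0//.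
  have h := vnorm2_lip (y t) t0.
  apply: (le_trans (ler_wpM2r (expR_ge0 _) h)).
  rewrite mulrDl; apply: lerD; first by rewrite mulrA.
  rewrite -(mulrA 2 (vnorm2 _)); apply: ler_wpM2l => //.
  apply: ler_wpM2l; first exact: vnorm2_ge0.
  rewrite ler_expR lerN2; apply: ler_wpM2r; first exact: ltW.
  by apply: ler_wpM2l => //; exact: ltW.
have /integrableP[_] := I3; apply: le_lt_trans.
by apply: ge0_le_integral => //;
  [move=> t _; rewrite lee_fin mulr_ge0 ?vnorm2_ge0 ?expR_ge0//
  |apply/measurable_EFinP; exact: (L1_meas I3)
  |apply: measurableT_comp => //; apply/measurable_EFinP; exact: (L1_meas I3)
  |move=> t _ /=; rewrite lee_fin ler_norm].
Qed.

End Nemytskii.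

Lemma vmeas_chiv (R : realType) (n : nat) (y0 : 'I_n -> R[i]) :
  vmeas setT (chiv y0).
Proof.
have mchi : measurable_fun setT (@chi R).
  rewrite (_ : @chi R = \1_(`]0, +oo[%classic)); first exact: measurable_indic.
  by apply/funext => t; rewrite indicE mem_setE in_itv/= andbT /chi; case: ifP.
move=> i; rewrite /chiv; case: (y0 i) => a b /=; split.
  by under eq_fun do rewrite mul0r subr0; exact: measurable_funM.
by under eq_fun do rewrite mul0r addr0; exact: measurable_funM.
Qed.

Theorem theorem3p1 (R : realType) (alpha : R) (n : nat) (rho0 : R)
  (y0 : 'I_n -> R[i]) (f : R -> ('I_n -> R[i]) -> ('I_n -> R[i])) (c : R)
  (rho : R) (y : R -> 'I_n -> R[i]) :
  0 < alpha <= 1 ->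
  cont_pos f ->
  0 <= c ->
  (forall t, 0 < t -> forall y1 y2,
      vnorm (vsub (f t y1) (f t y2)) <= c * vnorm (vsub y1 y2)) ->
  L2w `]0, +oo[ rho0 (fun t => f t (fun _ => 0)) ->
  0 < rho -> rho0 < rho ->
  L2w setT rho y ->
  [<->
    (* (i) *)
    {ae @lebesgue_measure R, forall t,
       forall i : 'I_n,
         cintegrable `]-oo, t[
           (fun s => ((t - s) `^ (alpha - 1))%:C%C * ftilde f s (y s) i) /\
         y t i = (chi t)%:C%C * y0 i
                 + ((Gamma alpha)^-1)%:C%C *
                   cint `]-oo, t[
                     (fun s => ((t - s) `^ (alpha - 1))%:C%C * ftilde f s (y s) i)};
    (* (ii) *)
    exists v : R -> 'I_n -> R[i],
      fracD rho (- alpha) (fun t => ftilde f t (y t)) v /\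
      {ae @lebesgue_measure R, forall t, y t = (fun i => v t i + chiv y0 t i)};
    (* (iii) *)
    exists v : R -> 'I_n -> R[i],
      fracD rho alpha (fun t => vsub (y t) (chiv y0 t)) v /\
      {ae @lebesgue_measure R, forall t, v t = ftilde f t (y t)}
  ].
Proof.
move=> alpha01 f_cont c0 f_lip Lf rho_gt0 rho0_lt Ly.
set F := fun t => ftilde f t (y t); set u := fun t => vsub (y t) (chiv y0 t).
have LF : L2w setT rho F by exact: (L2w_ftilde f_cont c0 rho0_lt f_lip Lf Ly).
have mu_ : vmeas setT u.
  move=> i; have [m1 m2] := Ly.1 i; have [m3 m4] := vmeas_chiv y0 i.
  by split; [under eq_fun do rewrite raddfB|under eq_fun do rewrite raddfB];
    exact: measurable_funB.
have FI := fracI_ae alpha01 rho_gt0 LF.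
tfae.
(* From (i) to (ii): [fracI F] is the value of the operator of order -alpha at [F], and almost
   everywhere it is the integral in (i). *)
- move=> yE; have [h FLh] := FL_exists LF.
  have H := FLadj_fracI alpha01 rho_gt0 ((FL_FLadj rho F h).1 FLh).
  exists (fracI (alpha := alpha) (rho := rho) F); split.
    by exists h; split; [exact: FLh|split; [exact: H.1|exact: H]].
  apply: aeS (aeI FI yE) => t [Ft yt]; apply/funext => i.
  by rewrite (Ft i).2 (yt i).2 addrC.
(* From (ii) to (iii): [v] is a representative of [u], so [k] is the transform of [u]. Multiplying
   [k] by the symbol of order alpha gives back [h], the transform of [F]. *)
- move=> [v [[h [FLh [Lk H]]] yE]].
  set k := fun xi i => _ in Lk H.
  have kE : (fun xi i => cpow (Complex rho xi) alpha * k xi i) = h.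
    by apply/funext => xi; apply/funext => i; rewrite mulrA cpowNK// mul1r.
  have vu : {ae @lebesgue_measure R, forall t, v t = u t}.
    by apply: aeS yE => t yt; apply/funext => i; rewrite /u /vsub yt addrK.
  exists F; split; last by apply: aeW.
  exists k; split; first by apply/FL_FLadj; exact: eq_FLadj_ae vu H.
  by rewrite kE; split; [exact: FLh.2.1|apply/FL_FLadj].
(* From (iii) to (i): now [k] is the transform of [F], so [fracI F] has transform [h], which is also
   that of [u]. Uniqueness of the inverse transform gives [fracI F = u] almost everywhere. *)
- move=> [v [[h [FLh [Lk H]]] vF]].
  set k := fun xi i => _ in Lk H.
  have kE : (fun xi i => cpow (Complex rho xi) (- alpha) * k xi i) = h.
    apply/funext => xi; apply/funext => i.
    by rewrite mulrA [_ * cpow _ alpha]mulrC cpowNK// mul1r.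
  have := FLadj_fracI alpha01 rho_gt0 (eq_FLadj_ae LF.1 vF H).
  rewrite kE => /FLadj_unique /(_ ((FL_FLadj rho u h).1 FLh)) Iu.
  apply: aeS (aeI FI Iu) => t [Ft ut] i; have [I1 I2] := Ft i.
  by split => //; rewrite -I2 ut /u /vsub addrC subrK.
Qed.
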